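(* Let $n,m\ge 1$ be integers, let $\mu>0$, and let $D_{n,m}=\{(z,\zeta)\in\mathbb{C}^n\times\mathbb{C}^m : \|\zeta\|^2<e^{-\mu\|z\|^2}\}$. Then the Bergman kernel $K_{D_{n,m}}$ of $D_{n,m}$ is given, for all $(z,\zeta),(z',\zeta')\in D_{n,m}$, by $$K_{D_{n,m}}((z,\zeta),(z',\zeta'))=\frac{\mu^n}{\pi^{n+m}}\,e^{m\mu\langle z,z'\rangle}\,\left.\frac{d^m}{dt^m}Li_{-n}(t)\right|_{t=e^{\mu\langle z,z'\rangle}\langle\zeta,\zeta'\rangle}$$ $$=\frac{\mu^n}{\pi^{n+m}}\,\left.\frac{d^{m-1}}{dt^{m-1}}\,\frac{Li_{-(n+1)}(e^{\mu\langle z,z'\rangle}t)}{t}\right|_{t=\langle\zeta,\zeta'\rangle}.$$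
   Context: $\langle\cdot,\cdot\rangle$ denotes the standard Hermitian inner product on $\mathbb{C}^n$ or $\mathbb{C}^m$, $\langle z,w\rangle=\sum_j z_j\overline{w_j}$, and $\|z\|^2=\langle z,z\rangle$. For a domain $\Omega\subset\mathbb{C}^N$, $L^2_a(\Omega)$ is the Hilbert space of holomorphic functions on $\Omega$ that are square integrable with respect to Lebesgue measure, with inner product $\langle f,g\rangle=\int_\Omega f\overline{g}\,dz$; the Bergman kernel $K(z,w)=\overline{K_z(w)}$ of $\Omega$ is its reproducing kernel, i.e. $K_z\in L^2_a(\Omega)$ and $f(z)=\langle f,K_z\rangle=\int_\Omega f(w)K(z,w)\,dw$ for all $f\in L^2_a(\Omega)$ and $z\in\Omega$. The polylogarithm function is $Li_s(t)=\sum_{k=1}^\infty k^{-s}t^k$ for $|t|<1$, $s\in\mathbb{C}$. Since $Li_s(0)=0$, a quotient such as $Li_s(ct)/t$ (with $c$ a constant) is understood to be extended holomorphically to $t=0$. *)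

(* Defs.v *)
(* The complex numbers are R[i], for an arbitrary R : realType. *)
From HB Require Import structures.
From mathcomp Require Import all_boot all_order all_algebra.
From mathcomp Require Import complex.
From mathcomp Require Import all_classical all_reals all_analysis.

Set Implicit Arguments.
Unset Strict Implicit.
Unset Printing Implicit Defensive.

Import Order.TTheory GRing.Theory Num.Theory.
Import numFieldNormedType.Exports.

Local Open Scope classical_set_scope.
Local Open Scope ring_scope.
Local Open Scope complex_scope.

Section sigma_finite_product.
Local Open Scope ereal_scope.
Context d1 d2 (T1 : measurableType d1) (T2 : measurableType d2) (R : realType).
Variable m1 : {sigma_finite_measure set T1 -> \bar R}.
Variable m2 : {sigma_finite_measure set T2 -> \bar R}.

(* On m1 \x m2 itself inference of a sigma-finite structure only succeeds for
   subprobabilities, hence this copy. *)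
Definition sigma_finite_product : set (T1 * T2) -> \bar R := m1 \x m2.

HB.instance Definition _ := Measure.copy sigma_finite_product (m1 \x m2).

Let sigma_finite_productT : sigma_finite setT sigma_finite_product.
Proof.
have /sigma_finiteP[F [TF ndF Foo]] := sigma_finiteT m1.
have /sigma_finiteP[G [TG ndG Goo]] := sigma_finiteT m2.
exists (fun n => F n `*` G n).
  rewrite -setXTT TF TG predeqE => -[x y]; split.
    move=> [/= [n _ Fnx] [k _ Gky]]; exists (maxn n k) => //; split.
    - by move: x Fnx; exact/subsetPset/ndF/leq_maxl.
    - by move: y Gky; exact/subsetPset/ndG/leq_maxr.
  by move=> [n _ []/= ? ?]; split; exists n.
move=> k; have [? ?] := Foo k; have [? ?] := Goo k.
split; first exact: measurableX.
rewrite /sigma_finite_product product_measure1E//.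
by rewrite lte_mul_pinfty// ge0_fin_numE.
Qed.

HB.instance Definition _ := Measure_isSigmaFinite.Build _ _ _
  sigma_finite_product sigma_finite_productT.

End sigma_finite_product.

Section tuple_measure.
Context d (T : measurableType d) (R : realType).

Definition tuple_cons n (p : T * n.-tuple T) : n.+1.-tuple T :=
  [tuple of p.1 :: p.2].

Definition tuple_uncons n (t : n.+1.-tuple T) : T * n.-tuple T :=
  (thead t, [tuple of behead t]).

Lemma tuple_consK n : cancel (@tuple_cons n) (@tuple_uncons n).
Proof. by case=> x t; congr pair; apply: val_inj. Qed.

Lemma measurable_tuple_cons n :
  measurable_fun [set: T * n.-tuple T] (@tuple_cons n).
Proof. exact: measurable_cons. Qed.

Lemma measurable_tuple_uncons n :
  measurable_fun [set: n.+1.-tuple T] (@tuple_uncons n).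
Proof.
apply: measurable_fun_pair; first exact: measurable_tnth.
exact: measurable_behead.
Qed.

Section cons_measure.
Variables (n : nat) (mu : {sigma_finite_measure set T -> \bar R}).
Variable nu : {sigma_finite_measure set (n.-tuple T) -> \bar R}.

Definition cons_measure : set (n.+1.-tuple T) -> \bar R :=
  pushforward (sigma_finite_product mu nu) (@tuple_cons n).

Let cons_measure0 : cons_measure set0 = 0%E.
Proof. by rewrite /cons_measure /pushforward preimage_set0 measure0. Qed.

Let cons_measure_ge0 A : (0 <= cons_measure A)%E.
Proof. by rewrite /cons_measure /pushforward measure_ge0. Qed.

Let cons_measure_sigma_additive : semi_sigma_additive cons_measure.
Proof.
exact: (@measure_semi_sigma_additive _ _ _
  (measure_function_pushforward__canonical__measure_function_Measure
    (sigma_finite_product mu nu) (@measurable_tuple_cons n))).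
Qed.

HB.instance Definition _ := isMeasure.Build _ _ _ cons_measure
  cons_measure0 cons_measure_ge0 cons_measure_sigma_additive.

Let cons_measure_sigma_finite : sigma_finite [set: n.+1.-tuple T] cons_measure.
Proof.
have [F FT Foo] := sigma_finiteT (sigma_finite_product mu nu).
exists (fun k => @tuple_uncons n @^-1` F k).
  by rewrite -preimage_bigcup -FT preimage_setT.
move=> k; have [mF Fk] := Foo k; split.
  by rewrite -[X in measurable X]setTI; exact: measurable_tuple_uncons.
rewrite /cons_measure /pushforward -comp_preimage.
by rewrite (_ : _ \o _ = id)//; apply/funext => p; exact: tuple_consK.
Qed.

HB.instance Definition _ := Measure_isSigmaFinite.Build _ _ _ cons_measure
  cons_measure_sigma_finite.

End cons_measure.

(* The n-fold product measure mu \x ... \x mu; for n = 0 it is the point mass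
   on the one-point space of empty tuples. *)
Fixpoint tuple_measure (mu : {sigma_finite_measure set T -> \bar R}) n :
    {sigma_finite_measure set (n.-tuple T) -> \bar R} :=
  if n is k.+1 then cons_measure mu (tuple_measure mu k) else \d_[tuple].

End tuple_measure.

Section complex_space.
Context {R : realType}.
Local Notation C := R[i].

Definition cexp (z : C) : C :=
  (expR (complex.Re z))%:C * (cos (complex.Im z) +i* sin (complex.Im z)).

Definition herm N (z w : 'rV[C]_N) : C := \sum_(j < N) z 0 j * (w 0 j)^*.

(* [herm z z] is real, so taking the real part loses nothing. *)
Definition normsq N (z : 'rV[C]_N) : R := complex.Re (herm z z).

(* Lebesgue measure on C = R^2, a complex number being a pair (Re, Im). *)
Definition lebesgue_plane :
    {sigma_finite_measure set (measurableTypeR R * measurableTypeR R)%type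
      -> \bar R} :=
  sigma_finite_product lebesgue_measure lebesgue_measure.

Definition cvec N (t : N.-tuple (measurableTypeR R * measurableTypeR R)) :
  'rV[C]_N := \row_j ((tnth t j).1 +i* (tnth t j).2).

Definition lebesgue_cvec N := tuple_measure lebesgue_plane N.

Definition cintegral N (Omega : set 'rV[C]_N) (f : 'rV[C]_N -> C) : C :=
  (\int[lebesgue_cvec N]_(t in @cvec N @^-1` Omega) complex.Re (f (cvec t))) +i*
  (\int[lebesgue_cvec N]_(t in @cvec N @^-1` Omega) complex.Im (f (cvec t))).

(* f * conj f = |f|^2, so this is the integrability of |f|^2. *)
Definition square_integrable N (Omega : set 'rV[C]_N) (f : 'rV[C]_N -> C) :=
  (lebesgue_cvec N).-integrable (@cvec N @^-1` Omega)
    (fun t => (complex.Re (f (cvec t) * (f (cvec t))^*))%:E).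

(* Differentiability is over the field C: the codomain is the normed C-module
   C^o and the norm on 'rV[C]_N is the sup norm. *)
Definition holomorphic N (Omega : set 'rV[C]_N) (f : 'rV[C]_N -> C) :=
  forall z, Omega z ->
    differentiable (f : 'rV[C]_N -> C^o) (z : ('rV[C]_N : normedModType C)).

(* L^2_a(Omega); only the values on Omega are relevant. *)
Definition bergman_space N (Omega : set 'rV[C]_N) : set ('rV[C]_N -> C) :=
  [set f | holomorphic Omega f /\ square_integrable Omega f].

(* K_z is w |-> conj (K z w). Only the values of K on Omega x Omega matter. *)
Definition is_bergman_kernel N (Omega : set 'rV[C]_N)
    (K : 'rV[C]_N -> 'rV[C]_N -> C) :=
  forall z, Omega z ->
    bergman_space Omega (fun w => (K z w)^*) /\
    forall f, bergman_space Omega f ->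
      f z = cintegral Omega (fun w => f w * K z w).

(* Li_s(t) for |t| < 1, with k^{-s} = exp (- s ln k). *)
Definition polylog (s t : C) : C :=
  limn (fun N => \sum_(1 <= k < N) cexp (- s * (ln k%:R)%:C) * t ^+ k : C^o).

(* t |-> g t / t, where g 0 = 0, extended to 0 by continuity. *)
Definition quot_by_id (g : C -> C) (t : C) : C :=
  if t == 0 then lim ((fun u => g u / u : C^o) @ (0 : C^o)^') else g t / t.

(* C^n x C^m is 'rV[C]_(n + m), the point (z, zeta) being row_mx z zeta. *)
Definition fock_bargmann_hartogs n m (mu : R) : set 'rV[C]_(n + m) :=
  [set p | normsq (rsubmx p) < expR (- mu * normsq (lsubmx p))].


End complex_space.

Arguments fock_bargmann_hartogs {R} n m mu _.

(* Main.v *)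
(* Rotations of the coordinates preserve the domain D and Lebesgue measure.
   Averaging a function g over them shows that the integral over D of
   g(w) conj(w_l)^k, l being the last index, is a_k M_k, where the a_k are the
   Taylor coefficients of s |-> g(s e_l) and M_k, the squared norm of w_l^k, is
   explicit. Summing over k, for g in the Bergman space g(s e_l) is the integral
   of g(w) sum_k (s conj(w_l))^k / M_k, and 1 / M_k is mu^n / pi^(n+m) times the
   k-th Taylor coefficient of the m-th derivative of Li_{-n}. Every point of D is
   the image of some s e_l under an automorphism
   (z, zeta) |-> (z + a, exp(- mu <z, a> - mu |a|^2 / 2) L zeta), L unitary, which
   transports this formula to all of D. Reproducing kernels being unique, this is
   the first formula; the second one follows by comparing power series. *)
Require Import Defs.
From HB Require Import structures.
From mathcomp Require Import all_boot all_order all_algebra.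
From mathcomp Require Import complex.
From mathcomp Require Import all_classical all_reals all_analysis.
From mathcomp Require Import measurable_realfun.
From mathcomp Require Import ring lra.
Set Implicit Arguments.
Unset Strict Implicit.
Unset Printing Implicit Defensive.
Import Order.TTheory GRing.Theory Num.Theory.
Import numFieldNormedType.Exports.
Local Open Scope classical_set_scope.
Local Open Scope ring_scope.
Local Open Scope complex_scope.

(** * Complex numbers and the exponential *)

(** At s e_l all monomials vanish except the powers of w_l. One-variable Taylor series along complex
    lines therefore suffice, and neither an expansion in several variables nor completeness of an
    orthogonal system enters. The price is that a general point has to be carried to the last axis.
    The pull-back of f under the automorphism is weighted by the (m+1)-th power of the exponential
    factor (with m+1 components in zeta), which is its complex Jacobian determinant up to a
    unimodular constant: this keeps the pull-back square integrable and holomorphic on lines.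
    Averaging and termwise integration need integrable functions. D is unbounded, but its volume is
    M_0 and hence finite, so square integrable functions are integrable. The series in s conj(w_l)
    converges uniformly on D because |w_l| < 1 there. All changes of variables are reduced by
    Tonelli's theorem to affine substitutions on the real line. This is why unitary maps occur only
    as products of transvections, and automorphisms only as translations, dilations of the fibres
    and such products. *)

Lemma le_of_eq d (T : porderType d) (x y : T) : x = y -> (x <= y)%O.
Proof. by move->. Qed.

Section ComplexBasics.
Context {R : realType}.
Local Notation C := R[i].
Local Notation Co := R[i]^o.
Local Notation Re := (@complex.Re R).
Local Notation Im := (@complex.Im R).
Implicit Types (z w : C) (x y : R).

(** The norm of [C] takes its values in [C] itself; a real-valued modulus keeps all estimates in the
    ordered field [R]. *)
Definition cabs z : R := Num.sqrt (Re z ^+ 2 + Im z ^+ 2).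

Lemma normCE z : `|z| = (cabs z)%:C.
Proof. exact: normc_def. Qed.

Lemma cabs_ge0 z : 0 <= cabs z.
Proof. exact: sqrtr_ge0. Qed.

Lemma cabs_sq z : cabs z ^+ 2 = Re z ^+ 2 + Im z ^+ 2.
Proof. by rewrite sqr_sqrtr// addr_ge0// sqr_ge0. Qed.

Lemma cabs0 : cabs 0 = 0.
Proof. by rewrite /cabs /= expr0n /= addr0 sqrtr0. Qed.

Lemma cabs1 : cabs 1 = 1.
Proof. by rewrite /cabs /= expr0n /= addr0 expr1n sqrtr1. Qed.

Lemma cabsM z w : cabs (z * w) = cabs z * cabs w.
Proof. by have := normrM z w; rewrite !normCE -rmorphM => /complexI. Qed.

Lemma cabsX z n : cabs (z ^+ n) = cabs z ^+ n.
Proof. by elim: n => [|n IH]; rewrite ?expr0 ?cabs1// !exprS cabsM IH. Qed.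

Lemma cabsN z : cabs (- z) = cabs z.
Proof. by have := normrN z; rewrite !normCE => /complexI. Qed.

Lemma cabsB z w : cabs (z - w) = cabs (w - z).
Proof. by rewrite -cabsN opprB. Qed.

Lemma cabsV z : cabs z^-1 = (cabs z)^-1.
Proof.
by have := normfV z; rewrite !normCE -fmorphV => /complexI.
Qed.

Lemma cabsD z w : cabs (z + w) <= cabs z + cabs w.
Proof. by have := ler_normD z w; rewrite !normCE -rmorphD/= lecR. Qed.

Lemma cabs_eq0 z : (cabs z == 0) = (z == 0).
Proof. by have := normr_eq0 z; rewrite normCE -(rmorph0 (real_complex R)) (inj_eq (@complexI R)). Qed.

Lemma cabs_gt0 z : (0 < cabs z) = (z != 0).
Proof. by rewrite lt_def cabs_ge0 cabs_eq0 andbT. Qed.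

Lemma cabs_conj z : cabs z^* = cabs z.
Proof. by have := normcJ z; rewrite !normCE => /complexI. Qed.

Lemma cabs_real x : cabs x%:C = `|x|.
Proof. by rewrite /cabs /= expr0n /= addr0 sqrtr_sqr. Qed.

Lemma cabs_nat n : cabs n%:R = n%:R.
Proof. by rewrite -(rmorph_nat (real_complex R)) cabs_real ger0_norm. Qed.

Lemma cabs_Re z : `|Re z| <= cabs z.
Proof. by rewrite -sqrtr_sqr ler_sqrt ?lerDl ?addr_ge0 ?sqr_ge0. Qed.

Lemma cabs_Im z : `|Im z| <= cabs z.
Proof. by rewrite -sqrtr_sqr ler_sqrt ?lerDr ?addr_ge0 ?sqr_ge0. Qed.

Lemma cabs_ReIm z : cabs z <= `|Re z| + `|Im z|.
Proof.
rewrite -[leRHS]ger0_norm ?addr_ge0// -sqrtr_sqr ler_sqrt ?sqr_ge0//.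
rewrite sqrrD !real_normK ?num_real// -addrA lerD2l lerDr.
by rewrite mulrn_wge0// mulr_ge0.
Qed.

Lemma cabs_sum (I : Type) (r : seq I) (P : pred I) (F : I -> C) :
  cabs (\sum_(i <- r | P i) F i) <= \sum_(i <- r | P i) cabs (F i).
Proof.
elim/big_ind2 : _ => //; first by rewrite cabs0.
by move=> a b c d ab cd; apply: (le_trans (cabsD _ _)); exact: lerD.
Qed.

Lemma mulcJ z : z * z^* = (cabs z ^+ 2)%:C.
Proof. by rewrite -sqr_normc normCE rmorphXn. Qed.

Lemma cReD z w : Re (z + w) = Re z + Re w. Proof. by case: z; case: w. Qed.
Lemma cImD z w : Im (z + w) = Im z + Im w. Proof. by case: z; case: w. Qed.
Lemma cReN z : Re (- z) = - Re z. Proof. by case: z. Qed.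
Lemma cImN z : Im (- z) = - Im z. Proof. by case: z. Qed.
Lemma cReM z w : Re (z * w) = Re z * Re w - Im z * Im w.
Proof. by case: z; case: w. Qed.
Lemma cImM z w : Im (z * w) = Re z * Im w + Im z * Re w.
Proof. by case: z; case: w. Qed.
Lemma cReJ z : Re z^* = Re z. Proof. by case: z. Qed.
Lemma cImJ z : Im z^* = - Im z. Proof. by case: z. Qed.
Lemma conjcM z w : conjc (z * w) = conjc z * conjc w. Proof. exact: rmorphM. Qed.
Lemma conjcB z w : conjc (z - w) = conjc z - conjc w. Proof. exact: rmorphB. Qed.
Lemma conjcN z : conjc (- z) = - conjc z. Proof. exact: rmorphN. Qed.
Lemma conjcX z n : conjc (z ^+ n) = conjc z ^+ n. Proof. exact: rmorphXn. Qed.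

Lemma complex_ext z w : Re z = Re w -> Im z = Im w -> z = w.
Proof. by case: z w => [a b] [c d] /= -> ->. Qed.

(** Radii of balls in [Co] are positive elements of [C], hence real; this converts norm balls into
    [cabs] balls. *)
Lemma lt0c_real (e : C) : 0 < e -> exists2 d : R, 0 < d & e = d%:C.
Proof.
case: e => a b; rewrite ltcE /= => /andP[/eqP -> a0].
by exists a.
Qed.

Lemma nbhs_cabsP (z : Co) (A : set Co) :
  nbhs z A <-> exists2 d : R, 0 < d & forall w, cabs (w - z) < d -> A w.
Proof.
split=> [/nbhs_normP[e /= e0 eA]|[d d0 dA]].
  have [d d0 ed] := lt0c_real e0; exists d => // w wd; apply: eA => /=.
  by rewrite distrC normCE ed ltcR.
apply/(@nbhs_normP _ Co z A); exists d%:C => /=; first by rewrite ltcR.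
by move=> w /=; rewrite distrC normCE ltcR; exact: dA.
Qed.

Lemma cvg_cabsP (T : Type) (F : set_system T) (FF : Filter F) (f : T -> Co) (l : Co) :
  f @ F --> l <-> forall e : R, 0 < e -> \forall x \near F, cabs (f x - l) < e.
Proof.
split=> [fl e e0|h A /nbhs_cabsP[d d0 dA]].
  by apply: (fl [set w | cabs (w - l) < e]); apply/nbhs_cabsP; exists e.
by apply: filterS (h _ d0) => x; exact: dA.
Qed.

Lemma cvg_cabs0P (T : Type) (F : set_system T) (FF : Filter F) (f : T -> Co) (l : Co) :
  f @ F --> l <-> (fun x : T => cabs (f x - l)) @ F --> (0 : R).
Proof.
split=> [/cvg_cabsP fl|fl].
  apply/cvgrPdist_lt => e e0; have := fl _ e0; apply: filterS => x.
  by rewrite sub0r normrN ger0_norm ?cabs_ge0.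
apply/cvg_cabsP => e e0; move/cvgrPdist_lt : fl => /(_ _ e0).
by apply: filterS => x; rewrite sub0r normrN ger0_norm ?cabs_ge0.
Qed.

Lemma continuous_cabs_lip (f : Co -> R) :
  (forall z w, `|f z - f w| <= cabs (z - w)) -> continuous f.
Proof.
move=> h z; apply: (proj2 (@cvgrPdist_lt _ _ _ (nbhs z) _ f (f z))) => e e0.
apply: (proj2 (nbhs_cabsP z _)); exists e => // w wz.
by apply: le_lt_trans (h _ _) _; rewrite cabsB.
Qed.

Lemma continuous_Re : continuous (Re : Co -> R).
Proof. by apply: continuous_cabs_lip => z w; rewrite -cReN -cReD cabs_Re. Qed.

Lemma continuous_Im : continuous (Im : Co -> R).
Proof. by apply: continuous_cabs_lip => z w; rewrite -cImN -cImD cabs_Im. Qed.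

Lemma continuous_cabs : continuous (cabs : Co -> R).
Proof.
apply: continuous_cabs_lip => z w.
rewrite ler_norml lerNl opprB !lerBlDr; apply/andP; split.
  by rewrite -{1}(subrK z w) cabsB cabsD.
by rewrite -{1}(subrK w z) cabsD.
Qed.

Lemma cvg_ReIm (T : Type) (F : set_system T) (FF : Filter F) (f : T -> Co) (l : Co) :
  Re \o f @ F --> Re l -> Im \o f @ F --> Im l -> f @ F --> l.
Proof.
move=> /cvgrPdist_lt rf /cvgrPdist_lt imf; apply/cvg_cabsP => e e0.
have e2 : 0 < e / 2 by rewrite divr_gt0.
near=> x; apply: le_lt_trans (cabs_ReIm _) _; rewrite (splitr e) ltrD//.
  by rewrite cReD cReN distrC; near: x; exact: rf.
by rewrite cImD cImN distrC; near: x; exact: imf.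
Unshelve. all: by end_near. Qed.

Lemma continuous_real_complex : continuous (real_complex R : R -> Co).
Proof. by move=> x; apply: cvg_ReIm; [exact: cvg_id|exact: cvg_cst]. Qed.

Lemma continuous_cabs_lipC (f : Co -> Co) :
  (forall z w, cabs (f z - f w) <= cabs (z - w)) -> continuous f.
Proof.
move=> h z; apply: (proj2 (@cvg_cabsP _ (nbhs z) _ f (f z))) => e e0.
by apply: (proj2 (nbhs_cabsP z _)); exists e => // w; exact: le_lt_trans.
Qed.

Lemma continuous_conjc : continuous (@conjc R : Co -> Co).
Proof.
by apply: continuous_cabs_lipC => z w; rewrite -rmorphB cabs_conj.
Qed.

(** In one complex variable the differential is multiplication by a number [c]. The non-strict bound
    lets the case h = 0 be included. *)
Lemma differentiable_cabsP (f : Co -> Co) (z : Co) :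
  differentiable f z <-> exists c : C, forall e : R, 0 < e ->
    exists2 d : R, 0 < d & forall h, cabs h < d ->
      cabs (f (z + h) - f z - c * h) <= e * cabs h.
Proof.
rewrite -derivable1_diffP; split=> [/cvg_ex[/= c hc]|[c hc]].
  exists c => e e0; move/cvg_cabsP : hc => /(_ _ e0)/nbhs_cabsP[d d0 hd].
  exists d => // h hlt; have [->|h0] := eqVneq h 0.
    by rewrite addr0 subrr mulr0 subrr cabs0 mulr0.
  have := hd h; rewrite subr0 => /(_ hlt h0).
  rewrite /GRing.scale/= mulr1 => /ltW hle.
  have -> : f (z + h) - f z - c * h = (h^-1 * (f (h + z) - f z) - c) * h.
    by rewrite mulrBl mulrAC mulVf// mul1r [z + h]addrC.
  by rewrite cabsM ler_wpM2r// cabs_ge0.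
apply/cvg_ex; exists c; apply/cvg_cabsP => e e0.
(* Half of [e] turns the non-strict bound into the strict one that the limit demands. *)
have e2 : 0 < e / 2 by rewrite divr_gt0.
have [d d0 hd] := hc _ e2.
apply/nbhs_cabsP; exists d => // h; rewrite subr0 => hlt h0 /=.
rewrite /GRing.scale/= mulr1.
have -> : h^-1 * (f (h + z) - f z) - c = h^-1 * (f (z + h) - f z - c * h).
  by apply/esym; rewrite mulrBr [c * h]mulrC mulKf// [z + h]addrC.
rewrite cabsM cabsV ltr_pdivrMl ?cabs_gt0//.
apply: le_lt_trans (hd _ hlt) _; rewrite mulrC ltr_pM2l ?cabs_gt0//.
by rewrite gtr_pMr// invf_lt1// ltr1n.
Qed.

End ComplexBasics.

Section ComplexExp.
Context {R : realType}.
Local Notation C := R[i].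
Local Notation Co := R[i]^o.
Local Notation Re := (@complex.Re R).
Local Notation Im := (@complex.Im R).
Implicit Types (z w : C) (x y : R).

Lemma Re_cexp z : complex.Re (cexp z) = expR (Re z) * cos (Im z).
Proof. by rewrite /cexp cReM /= mul0r subr0. Qed.

Lemma Im_cexp z : complex.Im (cexp z) = expR (Re z) * sin (Im z).
Proof. by rewrite /cexp cImM /= mul0r addr0. Qed.

Lemma cexpD z w : cexp (z + w) = cexp z * cexp w.
Proof.
by apply: complex_ext; rewrite ?[RHS]cReM ?[RHS]cImM !Re_cexp !Im_cexp cReD cImD expRD ?cosD ?sinD; ring.
Qed.

Lemma cexp0 : cexp (0 : C) = 1.
Proof. by apply: complex_ext; rewrite ?(Re_cexp, Im_cexp) /= expR0 ?cos0 ?sin0 mul1r. Qed.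

Lemma cabs_cexp z : cabs (cexp z) = expR (Re z).
Proof.
apply/eqP; rewrite -(eqrXn2 (n := 2))// ?cabs_ge0 ?expR_ge0// cabs_sq Re_cexp Im_cexp.
by rewrite !exprMn -mulrDr cos2Dsin2 mulr1.
Qed.

Lemma cexp_neq0 z : cexp z != 0.
Proof. by rewrite -cabs_gt0 cabs_cexp expR_gt0. Qed.

Lemma cexpN z : cexp (- z) = (cexp z)^-1.
Proof.
by apply: (mulfI (cexp_neq0 z)); rewrite -cexpD subrr cexp0 divff ?cexp_neq0.
Qed.

Lemma cexp_natM n z : cexp (n%:R * z) = cexp z ^+ n.
Proof.
elim: n => [|n IH]; first by rewrite mul0r cexp0 expr0.
by rewrite -addn1 natrD mulrDl mul1r cexpD IH addn1 exprSr.
Qed.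

Lemma conj_cexp z : (cexp z)^* = cexp z^*.
Proof.
apply: complex_ext; rewrite ?cReJ ?cImJ ?(Re_cexp, Im_cexp) ?cReJ ?cImJ ?cosN//.
by rewrite sinN mulrN.
Qed.

Lemma cexp_real x : cexp x%:C = (expR x)%:C.
Proof. by apply: complex_ext; rewrite ?(Re_cexp, Im_cexp) /= ?cos0 ?sin0 ?mulr1 ?mulr0. Qed.

Lemma cexp_periodic z : cexp (z + (0 +i* (pi *+ 2))) = cexp z.
Proof.
rewrite cexpD [X in _ * X](_ : _ = 1) ?mulr1//.
by apply: complex_ext; rewrite ?(Re_cexp, Im_cexp) /= expR0 mul1r -[pi *+ 2]add0r
  ?(cosD2pi 0) ?(sinD2pi 0) ?cos0 ?sin0.
Qed.

Lemma derivable_real_eps (f : R -> R) (c : R) : is_derive (0 : R) (1 : R) f c ->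
  forall e, 0 < e -> exists2 d, 0 < d & forall h, `|h| < d -> `|f h - f 0 - c * h| <= e * `|h|.
Proof.
move=> [/cvg_ex[/= l fl] fc] e e0.
have -> : c = l by rewrite -fc; exact: cvg_lim.
move/cvgrPdist_lt : fl => /(_ _ e0)/nbhs_normP[d /= d0 hd].
exists d => // h hlt; have [->|h0] := eqVneq h 0.
  by rewrite subrr mulr0 subrr normr0 mulr0.
have := hd h; rewrite /= sub0r normrN => /(_ hlt h0).
rewrite /GRing.scale/= mulr1 addr0 => /ltW hle.
have -> : f h - f 0 - l * h = - ((l - h^-1 * (f h - f 0)) * h).
  by rewrite mulrBl mulrAC mulVf// mul1r opprB.
by rewrite normrN normrM ler_wpM2r.
Qed.

(** The real first-order expansions of exp, cos and sin at 0 are combined through E c - 1 - x = E (c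
    - 1) + (E - 1 - x) and E s - y = E (s - y) + (E - 1 - x) y + x y. *)
Lemma cexp_taylor1 (e : R) : 0 < e -> exists2 d, 0 < d & forall h : C, cabs h < d ->
  cabs (cexp h - 1 - h) <= e * cabs h.
Proof.
(* The final estimate adds up to nine times [k * cabs h], so k <= e / 16 is enough; k <= 1 controls
   the products. *)
move=> e0; pose k := Num.min (e / 16) 1.
have e8 : 0 < k by rewrite lt_min ltr01 divr_gt0.
have k1 : k <= 1 by rewrite ge_min lexx orbT.
have k8 : k <= e / 16 by rewrite ge_min lexx.
clearbody k.
have [dE dE0 hE] := derivable_real_eps (is_derive_expR 0) e8.
have [dC dC0 hC] := derivable_real_eps (is_derive_cos 0) e8.
have [dS dS0 hS] := derivable_real_eps (is_derive_sin 0) e8.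
exists (Num.min (Num.min dE k) (Num.min dC dS)).
  by rewrite !lt_min dE0 dC0 dS0 e8.
move=> h; rewrite !lt_min => /andP[/andP[h1 h2] /andP[h3 h4]].
 set N := cabs h in h1 h2 h3 h4 *.
have xN := cabs_Re h; have yN := cabs_Im h.
have {}hE := hE _ (le_lt_trans xN h1).
have {}hC := hC _ (le_lt_trans yN h3).
have {}hS := hS _ (le_lt_trans yN h4).
have N0 : 0 <= N := cabs_ge0 h.
have {}h2 := ltW h2.
move: hE hC hS; rewrite expR0 cos0 sin0 oppr0 mul0r !subr0 ?addr0 !mul1r => hE hC hS.
set E := expR (Re h) in hE; set c := cos (Im h) in hC; set s := sin (Im h) in hS.
have kN (u : R) : `|u| <= N -> k * `|u| <= k * N by move=> ?; rewrite ler_wpM2l// ltW.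
have {}hE := le_trans hE (kN _ xN).
have {}hC := le_trans hC (kN _ yN).
have {}hS := le_trans hS (kN _ yN).
have E1 : `|E| <= 3.
  have -> : E = (E - 1 - Re h) + (1 + Re h) by ring.
  apply: le_trans (ler_normD _ _) _.
  apply: le_trans (lerD hE (ler_normD _ _)) _; rewrite normr1.
  have : k * N <= 1 * 1 by apply: ler_pM => //; [exact: ltW|exact: le_trans h2 _].
  by have := le_trans xN h2; lra.
apply: le_trans (cabs_ReIm _) _.
rewrite !(cReD, cImD, cReN, cImN) Re_cexp Im_cexp -/E -/c -/s /=.
have -> : E * c - 1 - Re h = E * (c - 1) + (E - 1 - Re h) by ring.
have -> : E * s - 0 - Im h = E * (s - Im h) + (E - 1 - Re h) * Im h + Re h * Im h by ring.
have kNe : k * N <= e / 16 * N by rewrite ler_wpM2r.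
have kN0 : 0 <= k * N by rewrite mulr_ge0// ltW.
have EkN (u : R) : `|u| <= k * N -> `|E * u| <= 3 * (k * N).
  by move=> ?; rewrite normrM ler_pM.
have h5 : `|E * (c - 1) + (E - 1 - Re h)| <= 3 * (k * N) + k * N.
  by apply: le_trans (ler_normD _ _) _; rewrite lerD// EkN.
have h6 : `|(E - 1 - Re h) * Im h| <= k * N.
  rewrite normrM -[leRHS]mulr1 ler_pM//.
  by apply: le_trans yN (le_trans h2 k1).
have h7 : `|Re h * Im h| <= k * N.
  by rewrite normrM ler_pM// (le_trans xN).
have h8 : `|E * (s - Im h) + (E - 1 - Re h) * Im h + Re h * Im h| <= 3 * (k * N) + k * N + k * N.
  apply: le_trans (ler_normD _ _) _; rewrite lerD//.
  by apply: le_trans (ler_normD _ _) _; rewrite lerD// EkN.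
apply: le_trans (lerD h5 h8) _.
move: kNe kN0; rewrite mulrAC; set u := k * N; set v := e * N; lra.
Qed.

Lemma differentiable_cexp (z : Co) : differentiable (@cexp R : Co -> Co) z.
Proof.
apply/differentiable_cabsP; exists (cexp z) => e e0.
have [d d0 hd] := cexp_taylor1 (divr_gt0 e0 (expR_gt0 (Re z))).
exists d => // h /hd hh.
have -> : cexp (z + h) - cexp z - cexp z * h = cexp z * (cexp h - 1 - h).
  by rewrite cexpD; ring.
rewrite cabsM cabs_cexp; apply: le_trans (ler_wpM2l (expR_ge0 _) hh) _.
by rewrite mulrA mulrCA divff ?mulr1// gt_eqF ?expR_gt0.
Qed.

Lemma continuous_cexp : continuous (@cexp R : Co -> Co).
Proof. by move=> z; apply: differentiable_continuous; exact: differentiable_cexp. Qed.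

End ComplexExp.

(** * Integrals of complex-valued functions *)

Section ComplexIntegral.
Context d (T : measurableType d) {R : realType} (nu : {measure set T -> \bar R}).
Local Notation C := R[i].
Local Notation Re := (@complex.Re R).
Local Notation Im := (@complex.Im R).
Implicit Types (D : set T) (f g : T -> C).

Definition cInt D f : C :=
  (\int[nu]_(x in D) Re (f x)) +i* (\int[nu]_(x in D) Im (f x)).

Definition cintble D f :=
  nu.-integrable D (fun x => (Re (f x))%:E) /\ nu.-integrable D (fun x => (Im (f x))%:E).

Lemma eq_cInt D f g : (forall x, D x -> f x = g x) -> cInt D f = cInt D g.
Proof.
by move=> fg; congr Complex; apply: eq_Rintegral => x /set_mem Dx /=; rewrite fg.
Qed.

Lemma eq_cintble D f g : (forall x, D x -> f x = g x) -> measurable D ->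
  cintble D f -> cintble D g.
Proof.
move=> fg mD [h1 h2]; split.
  by apply: eq_integrable h1 => // x /set_mem Dx /=; rewrite fg.
by apply: eq_integrable h2 => // x /set_mem Dx /=; rewrite fg.
Qed.

Variable D : set T.
Hypothesis mD : measurable D.

Lemma rintble_lin (a b : R) (u v : T -> R) : nu.-integrable D (EFin \o u) ->
  nu.-integrable D (EFin \o v) -> nu.-integrable D (EFin \o (fun x => a * u x + b * v x)).
Proof.
move=> iu iv.
have := integrableD mD (integrableZl mD a iu) (integrableZl mD b iv).
by apply: eq_integrable => // x _; rewrite /= EFinD !EFinM.
Qed.

Lemma rint_lin (a b : R) (u v : T -> R) : nu.-integrable D (EFin \o u) ->
  nu.-integrable D (EFin \o v) ->
  \int[nu]_(x in D) (a * u x + b * v x) =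
  a * (\int[nu]_(x in D) u x) + b * (\int[nu]_(x in D) v x).
Proof.
move=> iu iv; rewrite RintegralD//.
- by rewrite !RintegralZl.
- by have := integrableZl mD a iu; apply: eq_integrable => // x _; rewrite /= EFinM.
- by have := integrableZl mD b iv; apply: eq_integrable => // x _; rewrite /= EFinM.
Qed.

Lemma cintbleD f g : cintble D f -> cintble D g -> cintble D (fun x => f x + g x).
Proof.
move=> [f1 f2] [g1 g2]; split.
  by have := rintble_lin 1 1 f1 g1; apply: eq_integrable => // x _ /=; rewrite cReD !mul1r.
by have := rintble_lin 1 1 f2 g2; apply: eq_integrable => // x _ /=; rewrite cImD !mul1r.
Qed.

Lemma cInt_add f g : cintble D f -> cintble D g ->
  cInt D (fun x => f x + g x) = cInt D f + cInt D g.
Proof.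
move=> [f1 f2] [g1 g2]; rewrite {1}/cInt; apply: complex_ext => /=.
  by have := rint_lin 1 1 f1 g1; rewrite !mul1r => <-; apply: eq_Rintegral => x _;
    rewrite cReD !mul1r.
by have := rint_lin 1 1 f2 g2; rewrite !mul1r => <-; apply: eq_Rintegral => x _;
  rewrite cImD !mul1r.
Qed.

Lemma cintbleZ (c : C) f : cintble D f -> cintble D (fun x => c * f x).
Proof.
move=> [f1 f2]; split.
  have := rintble_lin (Re c) (- Im c) f1 f2; apply: eq_integrable => // x _ /=.
  by rewrite cReM mulNr.
have := rintble_lin (Re c) (Im c) f2 f1; apply: eq_integrable => // x _ /=.
by rewrite cImM.
Qed.

Lemma cIntZ (c : C) f : cintble D f -> cInt D (fun x => c * f x) = c * cInt D f.
Proof.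
move=> [f1 f2]; apply: complex_ext.
  rewrite [RHS]cReM /= -[X in _ = X]addr0 addr0 -mulNr -rint_lin//.
  by apply: eq_Rintegral => x _; rewrite cReM mulNr.
rewrite [RHS]cImM /= -rint_lin//.
by apply: eq_Rintegral => x _; rewrite cImM.
Qed.

Lemma cintbleB f g : cintble D f -> cintble D g -> cintble D (fun x => f x - g x).
Proof.
move=> hf hg; have := cintbleD hf (cintbleZ (-1) hg).
by apply: eq_cintble => // x _; rewrite mulN1r.
Qed.

Lemma cIntB f g : cintble D f -> cintble D g ->
  cInt D (fun x => f x - g x) = cInt D f - cInt D g.
Proof.
move=> hf hg; have := cInt_add hf (cintbleZ (-1) hg).
by rewrite cIntZ// mulN1r => <-; apply: eq_cInt => x _; rewrite mulN1r.
Qed.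

Lemma cintble0 : cintble D (fun=> 0).
Proof. by split; exact: integrable0. Qed.

Lemma cInt0 : cInt D (fun=> 0) = 0.
Proof. by rewrite /cInt /= Rintegral_cst// mul0r. Qed.

Lemma cintble_sum n (F : nat -> T -> C) : (forall k, (k < n)%N -> cintble D (F k)) ->
  cintble D (fun x => \sum_(k < n) F k x).
Proof.
elim: n => [|n IH] h.
  by apply: eq_cintble cintble0 => // x _; rewrite big_ord0.
have := cintbleD (IH _) (h n (ltnSn n)).
move=> /(_ (fun k kn => h k (ltnW kn))); apply: eq_cintble => // x _.
by rewrite big_ord_recr.
Qed.

Lemma cInt_sum n (F : nat -> T -> C) : (forall k, (k < n)%N -> cintble D (F k)) ->
  cInt D (fun x => \sum_(k < n) F k x) = \sum_(k < n) cInt D (F k).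
Proof.
elim: n => [|n IH] h.
  by rewrite big_ord0 -[RHS]cInt0; apply: eq_cInt => x _; rewrite big_ord0.
rewrite big_ord_recr /= -IH; last by move=> k kn; apply: h; exact: ltnW.
rewrite -cInt_add.
- by apply: eq_cInt => x _; rewrite big_ord_recr.
- by apply: cintble_sum => k kn; apply: h; exact: ltnW.
- exact: h.
Qed.

(** Treating real and imaginary parts separately costs the factor 2, which is harmless because the
    bound only serves to prove limits. *)
Lemma cInt_bound f (g : T -> R) : cintble D f -> nu.-integrable D (EFin \o g) ->
  (forall x, D x -> cabs (f x) <= g x) -> cabs (cInt D f) <= 2 * \int[nu]_(x in D) g x.
Proof.
move=> [f1 f2] ig fg; apply: (le_trans (cabs_ReIm _)); rewrite mulr_natl mulr2n /=.
apply: lerD; apply: (le_trans (le_normr_Rintegral mD _)) => //; apply: le_Rintegral => //.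
- exact: (integrable_abse f1).
- by move=> x /fg; apply: le_trans; exact: cabs_Re.
- exact: (integrable_abse f2).
- by move=> x /fg; apply: le_trans; exact: cabs_Im.
Qed.

Lemma conj_cInt f : cintble D f -> (cInt D f)^* = cInt D (fun x => (f x)^*).
Proof.
move=> [f1 f2]; apply: complex_ext; rewrite ?cReJ ?cImJ /=.
  by apply: eq_Rintegral => x _; rewrite cReJ.
rewrite -mulN1r -RintegralZl//; apply: eq_Rintegral => x _.
by rewrite cImJ mulN1r.
Qed.

End ComplexIntegral.

Section SegmentIntegral.
Context {R : realType}.
Local Notation C := R[i].
Local Notation Co := R[i]^o.
Local Notation leb := (@lebesgue_measure R).
Local Notation Re := (@complex.Re R).
Local Notation Im := (@complex.Im R).
Implicit Types (a b : R) (f g : R -> C).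

Definition sInt a b f : C := cInt leb `[a, b] f.

Lemma within_continuous_at (T : topologicalType) a b (f : R -> T) :
  (forall x, a <= x <= b -> {for x, continuous f}) -> {within `[a, b], continuous f}.
Proof.
by move=> h; apply: continuous_in_subspaceT => x /set_mem /=; rewrite in_itv /=; exact: h.
Qed.

Lemma cintble_cont a b (f : R -> Co) :
  (forall x, a <= x <= b -> {for x, continuous f}) -> cintble leb `[a, b] f.
Proof.
move=> /within_continuous_at cf; split.
  apply: (@continuous_compact_integrable _ (Re \o f)); first exact: segment_compact.
  by apply: within_continuous_comp cf => z _; exact: continuous_Re.
apply: (@continuous_compact_integrable _ (Im \o f)); first exact: segment_compact.
by apply: within_continuous_comp cf => z _; exact: continuous_Im.
Qed.

Lemma integrable_cst_segment a b (M : R) : leb.-integrable `[a, b] (fun=> M%:E).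
Proof.
by apply: (@continuous_compact_integrable _ (cst M)); [exact: segment_compact|
  apply: continuous_subspaceT; exact: cst_continuous].
Qed.

Lemma rsInt_cst a b (r : R) : a <= b -> \int[leb]_(_ in `[a, b]) r = r * (b - a).
Proof.
move=> ab; rewrite Rintegral_cst//= lebesgue_measure_itv/= lte_fin.
by move: ab; rewrite le_eqVlt => /predU1P[->|->//]; rewrite ltxx subrr.
Qed.

Lemma sInt_cst a b (c : C) : a <= b -> sInt a b (fun=> c) = c * (b - a)%:C.
Proof.
move=> ab; apply: complex_ext; rewrite ?cReM ?cImM /= rsInt_cst//.
  by rewrite mulr0 subr0.
by rewrite mulr0 add0r.
Qed.

Lemma sInt_bound a b f (M : R) : a <= b -> cintble leb `[a, b] f ->
  (forall x, a <= x <= b -> cabs (f x) <= M) -> cabs (sInt a b f) <= 2 * (M * (b - a)).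
Proof.
move=> ab hf hM; rewrite -rsInt_cst//; apply: cInt_bound => //.
exact: integrable_cst_segment.
Qed.

Lemma sInt_split a b c f : a <= b -> b <= c -> cintble leb `[a, c] f ->
  sInt a c f = sInt a b f + sInt b c f.
Proof.
move=> ab bc [f1 f2].
have h (g : R -> R) : leb.-integrable `[a, c] (EFin \o g) ->
    \int[leb]_(x in `[a, c]) g x = \int[leb]_(x in `[a, b]) g x + \int[leb]_(x in `[b, c]) g x.
  move=> ig; apply/eqP; rewrite addrC -subr_eq Rintegral_itvB ?bnd_simp//.
  rewrite Rintegral_itv_obnd_cbnd//; apply: integrableS ig => //.
  by apply: subset_itvr; rewrite bnd_simp.
by apply: complex_ext; rewrite ?cReD ?cImD /= h.
Qed.

End SegmentIntegral.

(** * Cauchy's theorem and power series expansions *)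

Section Goursat.
Context {R : realType}.
Local Notation C := R[i].
Local Notation Co := R[i]^o.
Local Notation leb := (@lebesgue_measure R).
Local Notation Re := (@complex.Re R).
Local Notation Im := (@complex.Im R).
Local Notation "''i'" := (0 +i* 1 : C).
Variable G : Co -> Co.

(** The counterclockwise contour integral of G(z) dz along the boundary of the rectangle, opposite
    sides being paired. *)
Definition bdry_int (x1 x2 y1 y2 : R) : C :=
  'i * sInt y1 y2 (fun y => G (x2 +i* y) - G (x1 +i* y)) -
  sInt x1 x2 (fun x => G (x +i* y2) - G (x +i* y1)).

Lemma continuous_horiz (y x : R) : {for (x +i* y : Co), continuous G} ->
  {for x, continuous (fun x => G (x +i* y))}.
Proof.
have cf : {for x, continuous (fun x => x +i* y : Co)}.
  by apply: cvg_ReIm; [exact: cvg_id|exact: cvg_cst].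
by move=> cG; exact: (continuous_comp cf cG).
Qed.

Lemma continuous_vert (x y : R) : {for (x +i* y : Co), continuous G} ->
  {for y, continuous (fun y => G (x +i* y))}.
Proof.
have cf : {for y, continuous (fun y => x +i* y : Co)}.
  by apply: cvg_ReIm; [exact: cvg_cst|exact: cvg_id].
by move=> cG; exact: (continuous_comp cf cG).
Qed.

Variables (X1 X2 Y1 Y2 : R).
Hypothesis dG : forall x y, X1 <= x <= X2 -> Y1 <= y <= Y2 -> differentiable G (x +i* y : Co).

Let cG x y : X1 <= x <= X2 -> Y1 <= y <= Y2 -> {for (x +i* y : Co), continuous G}.
Proof. by move=> hx hy; apply: differentiable_continuous; exact: dG. Qed.

Let iv x y1 y2 : X1 <= x <= X2 -> Y1 <= y1 -> y2 <= Y2 ->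
  cintble leb `[y1, y2] (fun y => G (x +i* y)).
Proof.
move=> hx h1 h2; apply: cintble_cont => y /andP[? ?].
by apply: continuous_vert; apply: cG => //; rewrite (le_trans h1)//= (le_trans _ h2).
Qed.

Let ih y x1 x2 : Y1 <= y <= Y2 -> X1 <= x1 -> x2 <= X2 ->
  cintble leb `[x1, x2] (fun x => G (x +i* y)).
Proof.
move=> hx h1 h2; apply: cintble_cont => x /andP[? ?].
by apply: continuous_horiz; apply: cG => //; rewrite (le_trans h1)//= (le_trans _ h2).
Qed.

Lemma bdry_int_splitx x1 xm x2 y1 y2 : X1 <= x1 -> x1 <= xm -> xm <= x2 -> x2 <= X2 ->
  Y1 <= y1 -> y1 <= y2 -> y2 <= Y2 ->
  bdry_int x1 x2 y1 y2 = bdry_int x1 xm y1 y2 + bdry_int xm x2 y1 y2.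
Proof.
move=> h1 h2 h3 h4 h5 h6 h7; rewrite /bdry_int.
rewrite (@sInt_split _ x1 xm x2)//; last first.
  by apply: cintbleB => //; apply: ih => //; rewrite ?h5 ?h7 ?(le_trans h5)// (le_trans h6).
have q1 : X1 <= x1 <= X2 by rewrite h1/= (le_trans h2)// (le_trans h3).
have q2 : X1 <= xm <= X2 by rewrite (le_trans h1)//= (le_trans h3).
have q3 : X1 <= x2 <= X2 by rewrite h4 (le_trans h1)// (le_trans h2).
rewrite (_ : sInt y1 y2 (fun y => G (x2 +i* y) - G (x1 +i* y)) =
  sInt y1 y2 (fun y => G (x2 +i* y) - G (xm +i* y)) +
  sInt y1 y2 (fun y => G (xm +i* y) - G (x1 +i* y))).
  by rewrite mulrDr; ring.
rewrite /sInt -cInt_add//; try by apply: cintbleB => //; exact: iv.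
by apply: eq_cInt => y _; rewrite addrA subrK.
Qed.

Lemma bdry_int_splity x1 x2 y1 ym y2 : X1 <= x1 -> x1 <= x2 -> x2 <= X2 ->
  Y1 <= y1 -> y1 <= ym -> ym <= y2 -> y2 <= Y2 ->
  bdry_int x1 x2 y1 y2 = bdry_int x1 x2 y1 ym + bdry_int x1 x2 ym y2.
Proof.
move=> h1 h2 h3 h5 h6 h7 h8; rewrite /bdry_int.
rewrite (@sInt_split _ y1 ym y2)//; last first.
  by apply: cintbleB => //; apply: iv => //; rewrite ?h1 ?h3 ?(le_trans h1)// (le_trans h2).
have q1 : Y1 <= y1 <= Y2 by rewrite h5/= (le_trans h6)// (le_trans h7).
have q2 : Y1 <= ym <= Y2 by rewrite (le_trans h5)//= (le_trans h7).
have q3 : Y1 <= y2 <= Y2 by rewrite h8 (le_trans h5)// (le_trans h6).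
rewrite (_ : sInt x1 x2 (fun x => G (x +i* y2) - G (x +i* y1)) =
  sInt x1 x2 (fun x => G (x +i* y2) - G (x +i* ym)) +
  sInt x1 x2 (fun x => G (x +i* ym) - G (x +i* y1))).
  by rewrite mulrDr; ring.
rewrite /sInt -cInt_add//; try by apply: cintbleB => //; exact: ih.
by apply: eq_cInt => y _; rewrite addrA subrK.
Qed.

(** The affine part of G contributes nothing: with sides w and h, both pairs of sides give i c w h.
    Only the remainder, bounded by [M], survives; of the factor 4, one 2 comes from [sInt_bound] and
    one from the two sides in a pair. *)
Lemma bdry_int_local (p c : C) (x1 x2 y1 y2 M : R) :
  X1 <= x1 -> x1 <= x2 -> x2 <= X2 -> Y1 <= y1 -> y1 <= y2 -> y2 <= Y2 ->
  (forall x y, x1 <= x <= x2 -> y1 <= y <= y2 ->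
     cabs (G (x +i* y) - G p - c * ((x +i* y) - p)) <= M) ->
  cabs (bdry_int x1 x2 y1 y2) <= 4 * (M * ((x2 - x1) + (y2 - y1))).
Proof.
move=> h1 h2 h3 h5 h6 h7 hM.
have x1I : x1 <= x1 <= x2 by rewrite lexx.
have x2I : x1 <= x2 <= x2 by rewrite lexx andbT.
have y1I : y1 <= y1 <= y2 by rewrite lexx.
have y2I : y1 <= y2 <= y2 by rewrite lexx andbT.
have X1I : X1 <= x1 <= X2 by rewrite h1 (le_trans h2).
have X2I : X1 <= x2 <= X2 by rewrite h3 (le_trans h1).
have Y1I : Y1 <= y1 <= Y2 by rewrite h5 (le_trans h6).
have Y2I : Y1 <= y2 <= Y2 by rewrite h7 (le_trans h5).
pose w := (x2 - x1)%:C : C; pose h := (y2 - y1)%:C : C.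
have cc (a b : R) (k : C) : cintble leb `[a, b] (fun=> k).
  by apply: (@cintble_cont _ a b (cst (k : Co))) => x _; exact: cst_continuous.
have b1 : cabs (sInt y1 y2 (fun y => G (x2 +i* y) - G (x1 +i* y)) - c * w * h)
    <= 2 * ((M + M) * (y2 - y1)).
  rewrite -sInt_cst// /sInt -cIntB//; last by apply: cintbleB => //; exact: iv.
  apply: sInt_bound => //; first by do 2![apply: cintbleB => //]; exact: iv.
  move=> y yI.
  have -> : G (x2 +i* y) - G (x1 +i* y) - c * w =
    (G (x2 +i* y) - G p - c * ((x2 +i* y) - p)) -
    (G (x1 +i* y) - G p - c * ((x1 +i* y) - p)).
    have -> : w = (x2 +i* y) - (x1 +i* y) by apply: complex_ext => //=; rewrite subrr.
    ring.
  by apply: (le_trans (cabsD _ _)); rewrite cabsN lerD// hM.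
have b2 : cabs (sInt x1 x2 (fun x => G (x +i* y2) - G (x +i* y1)) - c * ('i * h) * w)
    <= 2 * ((M + M) * (x2 - x1)).
  rewrite -sInt_cst// /sInt -cIntB//; last by apply: cintbleB => //; exact: ih.
  apply: sInt_bound => //; first by do 2![apply: cintbleB => //]; exact: ih.
  move=> x xI.
  have -> : G (x +i* y2) - G (x +i* y1) - c * ('i * h) =
    (G (x +i* y2) - G p - c * ((x +i* y2) - p)) -
    (G (x +i* y1) - G p - c * ((x +i* y1) - p)).
    have -> : 'i * h = (x +i* y2) - (x +i* y1).
      by apply: complex_ext; rewrite ?cReM ?cImM /=; ring.
    ring.
  by apply: (le_trans (cabsD _ _)); rewrite cabsN lerD// hM.
rewrite /bdry_int.
set S1 := sInt y1 y2 _ in b1 *; set S2 := sInt x1 x2 _ in b2 *.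
have -> : 'i * S1 - S2 = 'i * (S1 - c * w * h) - (S2 - c * ('i * h) * w) by ring.
apply: le_trans (cabsD _ _) _; rewrite cabsN cabsM.
have -> : cabs 'i = 1 by rewrite /cabs /= expr0n /= add0r expr1n sqrtr1.
by rewrite mul1r; apply: le_trans (lerD b1 b2) _; apply: le_of_eq; ring.
Qed.

Lemma ler_quarter (a b c d : C) (r : R) : r <= cabs (a + b + (c + d)) ->
  [\/ r / 4 <= cabs a, r / 4 <= cabs b, r / 4 <= cabs c | r / 4 <= cabs d].
Proof.
move=> h; have := cabsD (a + b) (c + d); have := cabsD a b; have := cabsD c d.
move: h; set A := cabs a; set B := cabs b; set D := cabs c; set E := cabs d => h1 h2 h3 h4.
case: (leP (r / 4) A) => hA; first exact: Or41.
case: (leP (r / 4) B) => hB; first exact: Or42.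
case: (leP (r / 4) D) => hD; first exact: Or43.
by apply: Or44; lra.
Qed.

Hypothesis (X12 : X1 <= X2) (Y12 : Y1 <= Y2).

(** Repeated quartering: some quarter always retains a fourth of the integral. Near the common point
    of the nested rectangles, differentiability bounds the integral by any [e] times the squared
    size, which decreases like 4^-k as well. *)
Theorem goursat : bdry_int X1 X2 Y1 Y2 = 0.
Proof.
pose W k := (X2 - X1) / 2 ^+ k; pose H k := (Y2 - Y1) / 2 ^+ k.
have W0 k : 0 <= W k by rewrite divr_ge0 ?subr_ge0// exprn_ge0.
have H0 k : 0 <= H k by rewrite divr_ge0 ?subr_ge0// exprn_ge0.
have half (v : R) k : v / 2 ^+ k = v / 2 ^+ k.+1 + v / 2 ^+ k.+1.
  have h2 : (2 : R) ^+ k != 0 by rewrite expf_neq0// pnatr_eq0.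
  by rewrite exprS; field.
have WS k : W k = W k.+1 + W k.+1 by exact: half.
have HS k : H k = H k.+1 + H k.+1 by exact: half.
pose e0 := cabs (bdry_int X1 X2 Y1 Y2).
pose ok k (p : R * R) := [/\ X1 <= p.1, p.1 + W k <= X2, Y1 <= p.2, p.2 + H k <= Y2 &
  e0 / 4 ^+ k <= cabs (bdry_int p.1 (p.1 + W k) p.2 (p.2 + H k))].
(* The hypothesis [ok k p] stands below the quantifier so that a choice function defined for all [p]
   can be extracted. *)
have step k p : exists q, ok k p -> ok k.+1 q /\
    [/\ p.1 <= q.1, q.1 + W k.+1 <= p.1 + W k, p.2 <= q.2 & q.2 + H k.+1 <= p.2 + H k].
  case: (pselect (ok k p)) => [|nok]; last by exists p => /nok.
  case: p => x y [/= h1 h2 h3 h4 h5].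
  have xm : x <= x + W k.+1 by rewrite lerDl.
  have xM : x + W k.+1 <= x + W k by rewrite (WS k) addrA lerDl.
  have ym : y <= y + H k.+1 by rewrite lerDl.
  have yM : y + H k.+1 <= y + H k by rewrite (HS k) addrA lerDl.
  have Wx : x + W k.+1 + W k.+1 = x + W k by rewrite (WS k) addrA.
  have Hy : y + H k.+1 + H k.+1 = y + H k by rewrite (HS k) addrA.
  have xX := le_trans xM h2; have yY := le_trans yM h4.
  have Xx := le_trans h1 xm; have Yy := le_trans h3 ym.
  have e4 : e0 / 4 ^+ k / 4 = e0 / 4 ^+ k.+1 by rewrite exprSr invfM mulrA.
  move: h5; rewrite (@bdry_int_splitx _ (x + W k.+1))//; last exact: le_trans ym yM.
  rewrite (@bdry_int_splity x _ _ (y + H k.+1))// (@bdry_int_splity (x + W k.+1) _ _ (y + H k.+1))//.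
  move=> /ler_quarter; rewrite e4; case=> h.
  - by exists (x, y) => _; split=> //; split.
  - by exists (x, y + H k.+1) => _; split=> //; split => //=; rewrite Hy.
  - by exists (x + W k.+1, y) => _; split=> //; split => //=; rewrite Wx.
  - by exists (x + W k.+1, y + H k.+1) => _; split=> //; split => //=; rewrite ?Wx ?Hy.
have [f hf] : {f : nat -> R * R -> R * R | forall k p, ok k p -> ok k.+1 (f k p) /\
    [/\ p.1 <= (f k p).1, (f k p).1 + W k.+1 <= p.1 + W k,
      p.2 <= (f k p).2 & (f k p).2 + H k.+1 <= p.2 + H k]}.
  exists (fun k p => xget p [set q | ok k p -> ok k.+1 q /\
    [/\ p.1 <= q.1, q.1 + W k.+1 <= p.1 + W k, p.2 <= q.2 & q.2 + H k.+1 <= p.2 + H k]]).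
  by move=> k p; have [q hq] := step k p; case: xgetP => [r _ /=|/(_ q)//]; apply.
pose s := fix s k := if k is k'.+1 then f k' (s k') else (X1, Y1).
have sok k : ok k (s k).
  elim: k => [|k IH /=]; last by have [] := hf _ _ IH.
  by split=> //=; rewrite /W /H expr0 !divr1 1?addrC ?subrK// [Y1 + _]addrC subrK.
have mono k j : (k <= j)%N -> [/\ (s k).1 <= (s j).1, (s j).1 + W j <= (s k).1 + W k,
    (s k).2 <= (s j).2 & (s j).2 + H j <= (s k).2 + H k].
  elim: j => [|j IH]; first by rewrite leqn0 => /eqP ->.
  rewrite leq_eqVlt => /predU1P[->//|]; rewrite ltnS => /IH[a1 a2 a3 a4].
  have [_ [b1 b2 b3 b4]] := hf _ _ (sok j).
  by split; [exact: le_trans a1 b1|exact: le_trans b2 a2|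
    exact: le_trans a3 b3|exact: le_trans b4 a4].
have cross k j : (s j).1 <= (s k).1 + W k /\ (s j).2 <= (s k).2 + H k.
  have [/mono[a1 a2 a3 a4]|/ltnW/mono[a1 a2 a3 a4]] := leqP k j.
    by split; [apply: le_trans a2|apply: le_trans a4]; rewrite lerDl.
  by split; [apply: (le_trans a1)|apply: (le_trans a3)]; rewrite lerDl.
(* The lower left corners increase and stay below every upper right corner, so their supremum lies
   in all the rectangles. *)
pose px := sup (range (fun k => (s k).1)); pose py := sup (range (fun k => (s k).2)).
have pxI k : (s k).1 <= px <= (s k).1 + W k.
  apply/andP; split; last by apply: ge_sup; [exists (s 0%N).1, 0%N|move=> _ [j _ <-]; have [] := cross k j].
  by apply: ub_le_sup; [exists ((s k).1 + W k) => _ [j _ <-]; have [] := cross k j|exists k].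
have pyI k : (s k).2 <= py <= (s k).2 + H k.
  apply/andP; split; last by apply: ge_sup; [exists (s 0%N).2, 0%N|move=> _ [j _ <-]; have [] := cross k j].
  by apply: ub_le_sup; [exists ((s k).2 + H k) => _ [j _ <-]; have [] := cross k j|exists k].
have sX k x : (s k).1 <= x <= (s k).1 + W k -> X1 <= x <= X2.
  by have [a1 a2 _ _ _] := sok k => /andP[? ?]; rewrite (le_trans a1)//= (le_trans _ a2).
have sY k x : (s k).2 <= x <= (s k).2 + H k -> Y1 <= x <= Y2.
  by have [_ _ a1 a2 _] := sok k => /andP[? ?]; rewrite (le_trans a1)//= (le_trans _ a2).
have /differentiable_cabsP[c hc] := dG (sX _ _ (pxI 0%N)) (sY _ _ (pyI 0%N)).
apply/eqP; rewrite -cabs_eq0 -/e0 eq_le cabs_ge0 andbT.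
pose L := (X2 - X1) + (Y2 - Y1).
have L0 : 0 <= L by rewrite addr_ge0 ?subr_ge0.
suff main e : 0 < e -> e0 <= 4 * (e * L * L).
  apply/ler_addgt0Pr => e ep; rewrite add0r.
  have q : 0 < 4 * (L * L) + 1 by rewrite ltr_wpDl ?mulr_ge0.
  apply: le_trans (main _ (divr_gt0 ep q)) _.
  rewrite -[leRHS](divfK (lt0r_neq0 q)).
  set r := _ / _; have -> : 4 * (r * L * L) = r * (4 * (L * L)) by ring.
  by rewrite ler_wpM2l ?lerDl// ltW// divr_gt0.
move=> ep; have [dl dl0 hd] := hc _ ep.
have [k hk] : exists k, L / 2 ^+ k < dl.
  have Ld : 0 <= L / dl by rewrite divr_ge0// ltW.
  exists (Num.bound (L / dl)); rewrite ltr_pdivrMr ?exprn_gt0// -ltr_pdivrMl// mulrC.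
  apply: (lt_trans (archi_boundP Ld)); rewrite -natrX ltr_nat.
  exact: ltn_expl.
have [a1 a2 a3 a4 a5] := sok k.
have Lk : W k + H k = L / 2 ^+ k by rewrite -mulrDl.
have := @bdry_int_local (px +i* py) c (s k).1 ((s k).1 + W k) (s k).2 ((s k).2 + H k)
  (e * (L / 2 ^+ k)) a1 _ a2 a3 _ a4.
rewrite !lerDl => /(_ (W0 k) (H0 k)) h.
have /h {}h : forall x y, (s k).1 <= x <= (s k).1 + W k -> (s k).2 <= y <= (s k).2 + H k ->
    cabs (G (x +i* y) - G (px +i* py) - c * ((x +i* y) - (px +i* py))) <= e * (L / 2 ^+ k).
  move=> x y xI yI.
  have small : cabs ((x +i* y) - (px +i* py) : C) <= L / 2 ^+ k.
    apply: (le_trans (cabs_ReIm _)); rewrite -Lk /=.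
    move: xI yI (pxI k) (pyI k).
    move: (W k) (H k) => Wk Hk /andP[? ?] /andP[? ?] /andP[? ?] /andP[? ?].
    by apply: lerD; rewrite ler_norml; apply/andP; split; lra.
  have := hd _ (le_lt_trans small hk); rewrite subrKC => /le_trans; apply.
  by rewrite ler_wpM2l// ltW.
have {h} : e0 / 4 ^+ k <= 4 * (e * (L / 2 ^+ k) * (L / 2 ^+ k)).
  apply: (le_trans a5); apply: le_trans h _.
  have -> : (s k).1 + W k - (s k).1 + ((s k).2 + H k - (s k).2) = L / 2 ^+ k.
    by rewrite -Lk; move: (W k) (H k) => Wk Hk; ring.
  by rewrite mulrA.
have p4 : (0 : R) < 4 ^+ k by rewrite exprn_gt0.
rewrite ler_pdivrMr// => /le_trans; apply; apply: le_of_eq.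
have -> : (4 : R) ^+ k = 2 ^+ k * 2 ^+ k by rewrite -exprMn -natrM.
have h2 : (2 : R) ^+ k != 0 by rewrite expf_neq0// pnatr_eq0.
by field.
Qed.

End Goursat.

(** * Circle integrals in exponential coordinates *)

Section Cauchy.
Context {R : realType}.
Local Notation C := R[i].
Local Notation Co := R[i]^o.
Local Notation leb := (@lebesgue_measure R).
Local Notation Re := (@complex.Re R).
Local Notation Im := (@complex.Im R).
Local Notation tau := (@pi R *+ 2).

Lemma tau_ge0 : 0 <= tau. Proof. by rewrite mulrn_wge0// pi_ge0. Qed.

Lemma cexp_real_imag x (t : R) : cexp (x +i* t) = (expR x)%:C * cexp (0 +i* t).
Proof. by rewrite -cexp_real -cexpD; congr cexp; apply: complex_ext => /=; rewrite ?addr0 ?add0r. Qed.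

Lemma continuous_polar (p : R * R) :
  {for p, continuous (fun p : R * R => p.1%:C * cexp (0 +i* p.2) : Co)}.
Proof.
have h1 : {for p, continuous (fun p : R * R => p.1%:C : Co)}.
  have c1 : {for p, continuous (fun p : R * R => p.1)} by exact: cvg_fst.
  exact: (continuous_comp c1 (@continuous_real_complex R _)).
have h2 : {for p, continuous (fun p : R * R => 0 +i* p.2 : Co)}.
  by apply: cvg_ReIm; [exact: cvg_cst|exact: cvg_snd].
exact: (cvgM h1 (continuous_comp h2 (@continuous_cexp R _))).
Qed.

(** The closed disc is the polar image of a compact rectangle, and the bound is stated in the
    coordinates used by circle integrals. *)
Lemma disc_bounded (q : Co -> Co) (r : R) : 0 <= r ->
  (forall z, cabs z <= r -> {for z, continuous q}) ->
  exists2 M, 0 <= M & forall s t : R, 0 <= s <= r -> 0 <= t <= tau ->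
    cabs (q (s%:C * cexp (0 +i* t))) <= M.
Proof.
move=> r0 cq.
pose K := (`[0, r]%classic : set R) `*` (`[0, tau]%classic : set R).
have cK : compact K by apply: compact_setX; exact: segment_compact.
have K0 : K !=set0 by exists (0, 0); split => /=; rewrite in_itv /= lexx ?r0 ?tau_ge0.
pose phi (p : R * R) := cabs (q (p.1%:C * cexp (0 +i* p.2))).
have cphi : {within K, continuous phi}.
  apply: continuous_in_subspaceT => p /set_mem[/= p1 p2].
  have cq' : {for (p.1%:C * cexp (0 +i* p.2) : Co), continuous q}.
    apply: cq; rewrite cabsM cabs_real cabs_cexp /= expR0 mulr1.
    by move: p1; rewrite in_itv /= => /andP[? ?]; rewrite ger0_norm.
  have h1 := continuous_comp (@continuous_polar p) cq'.
  have h2 := continuous_comp h1 (@continuous_cabs R _).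
  exact: h2.
have [c _ hc] := compact_EVT_max K0 cK cphi.
exists (phi c); first exact: cabs_ge0.
by move=> s t hs ht; apply: (hc (s, t)); apply/mem_set; split => /=; rewrite in_itv.
Qed.

(* In the coordinate z = exp u the circle |z| = exp x is the segment Re u = x,
   0 <= Im u <= 2 pi, so that Cauchy's theorem on annuli is Goursat's on
   rectangles. *)
Definition circ (G : C -> C) (x : R) : C := sInt 0 tau (fun t => G (x +i* t)).

(** Periodicity cancels the horizontal sides, so that Goursat's theorem leaves the difference of the
    two vertical ones. *)
Lemma circ_const (G : Co -> Co) (x1 x2 : R) : x1 <= x2 ->
  (forall x t, x1 <= x <= x2 -> differentiable G (x +i* t : Co)) ->
  (forall x, G (x +i* tau) = G (x +i* 0)) -> circ G x1 = circ G x2.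
Proof.
move=> x12 dG per.
have := @goursat _ G x1 x2 0 tau (fun x y hx _ => dG x y hx) x12 tau_ge0.
rewrite /bdry_int; set S2 := sInt x1 x2 _.
have -> : S2 = 0.
  rewrite -[RHS](cInt0 leb (measurable_itv `[x1, x2])).
  by apply: eq_cInt => x _; rewrite per subrr.
rewrite subr0 => /eqP; rewrite mulf_eq0 => /orP[/eqP[/eqP]|]; first by rewrite oner_eq0.
have cG x : x1 <= x <= x2 -> cintble leb `[0, tau] (fun t => G (x +i* t)).
  move=> hx; apply: cintble_cont => t _; apply: continuous_vert.
  by apply: differentiable_continuous; exact: dG.
rewrite /sInt cIntB//; [|by apply: cG; rewrite lexx andbT|by apply: cG; rewrite lexx].
by rewrite subr_eq0 => /eqP.
Qed.

(** Dominated convergence with a constant bound. It serves to cross the radius |w|, where the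
    integrand is only known to be continuous. *)
Lemma circ_continuous (G : Co -> Co) (u v a M : R) : u < a < v ->
  (forall x t, u < x < v -> {for (x +i* t : Co), continuous G}) ->
  (forall x t, u < x < v -> 0 <= t <= tau -> cabs (G (x +i* t)) <= M) ->
  {for a, continuous (circ G : R -> Co)}.
Proof.
move=> uav cG bG.
have aI : a \in (`]u, v[%classic : set R) by apply/mem_set; rewrite /= in_itv.
have iG x : u < x < v -> cintble leb `[0, tau] (fun t => G (x +i* t)).
  by move=> hx; apply: cintble_cont => t _; apply: continuous_vert; exact: cG.
have key (p : C -> R) : (forall z, `|p z| <= cabs z) -> continuous (p : Co -> R) ->
    (forall x, u < x < v -> leb.-integrable `[0, tau] (fun t => (p (G (x +i* t)))%:E)) ->
    {for a, continuous (fun x => \int[leb]_(t in `[0, tau]) p (G (x +i* t)))}.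
  move=> pb cp ip.
  apply: (@continuity_under_integral R _ _ leb (fun x t => p (G (x +i* t))) `[0, tau]
    (measurable_itv _) u v _ _ (cst M)) => //.
  - apply: (@aeW _ _ _ leb) => t _ x /set_mem /=; rewrite in_itv /= => hx.
    exact: (continuous_comp (continuous_horiz (cG _ _ hx)) (cp _)).
  - exact: integrable_cst_segment.
  - move=> x /=; rewrite in_itv /= => hx; apply: (@aeW _ _ _ leb) => t /=; rewrite in_itv /= => ht.
    by apply: le_trans (pb _) _; exact: bG.
apply: cvg_ReIm.
  apply: (key Re cabs_Re (@continuous_Re R)).
  by move=> x /iG[].
apply: (key Im cabs_Im (@continuous_Im R)).
by move=> x /iG[].
Qed.

Lemma differentiable_idC (z : Co) : differentiable (fun v : Co => v : Co) z.
Proof. exact: (proj1 (derivable1_diffP _ _) (@derivable_id _ _ z 1)). Qed.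

Lemma differentiable_expc (f : Co -> Co) (u : Co) : differentiable f (cexp u : Co) ->
  differentiable (fun v : Co => f (cexp v) : Co) u.
Proof. exact: (@differentiable_comp _ _ _ _ _ _ _ (differentiable_cexp u)). Qed.

Section at_point.
Variables (f : Co -> Co) (rho : R) (w c0 : C).
Hypothesis df : forall z : Co, cabs z < rho -> differentiable f z.
Hypothesis wrho : cabs w < rho.
Hypothesis hc0 : forall e : R, 0 < e -> exists2 d : R, 0 < d & forall h, cabs h < d ->
      cabs (f (w + h) - f w - c0 * h) <= e * cabs h.

Let q (z : C) : C := if z == w then c0 else (f z - f w) / (z - w).

Let q_diff (z : Co) : cabs z < rho -> z != w -> differentiable (q : Co -> Co) z.
Proof.
move=> zr zw.
have zw0 : 0 < cabs (z - w) by rewrite cabs_gt0 subr_eq0.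
have d1 : differentiable (fun z : Co => (f z - f w) / (z - w) : Co) z.
  apply: differentiableM.
    apply: differentiableB; first exact: df.
    exact: differentiable_cst.
  apply: differentiableV; last by rewrite subr_eq0.
  by apply: differentiableB; [exact: differentiable_idC|exact: differentiable_cst].
apply/derivable1_diffP; move/derivable1_diffP : d1.
apply: near_eq_derivable.
apply: (proj2 (nbhs_cabsP z _)); exists (cabs (z - w)) => // v vz.
by rewrite /q; case: eqP => // vw; move: vz; rewrite vw cabsB ltxx.
Qed.

Let q_cont (z : Co) : cabs z < rho -> {for z, continuous (q : Co -> Co)}.
Proof.
move=> zr; have [->|zw] := eqVneq z w; last first.
  by apply: differentiable_continuous; exact: q_diff.
apply: (proj2 (@cvg_cabsP _ _ (nbhs (w : Co)) _ q (q w))) => e e0.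
have -> : q w = c0 by rewrite /q eqxx.
have e2 : 0 < e / 2 by rewrite divr_gt0.
have [d d0 hd] := hc0 e2.
apply: (proj2 (nbhs_cabsP (w : Co) _)); exists d => // v vw; rewrite /q.
have [_|nvw] := eqVneq v w; first by rewrite subrr cabs0.
have vw0 : v - w != 0 by rewrite subr_eq0.
have := hd _ vw; rewrite subrKC.
have -> : f v - f w - c0 * (v - w) = ((f v - f w) / (v - w) - c0) * (v - w).
  by rewrite mulrBl divfK.
rewrite cabsM ler_pM2r ?cabs_gt0// => /le_lt_trans; apply.
by rewrite gtr_pMr// invf_lt1// ltr1n.
Qed.

(** The substitution z = exp u turns q(z) dz into q(exp u) exp u du. *)
Let G (u : C) : C := q (cexp u) * cexp u.

Let G_per x : G (x +i* tau) = G (x +i* 0).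
Proof.
rewrite /G (_ : x +i* tau = (x +i* 0) + (0 +i* tau)) ?cexp_periodic//.
by apply: complex_ext; rewrite /= ?addr0 ?add0r.
Qed.

Let G_cont (u : Co) : expR (Re u) < rho -> {for u, continuous (G : Co -> Co)}.
Proof.
move=> ur; have ce := @continuous_cexp R u.
have cq : {for (cexp u : Co), continuous (q : Co -> Co)} by apply: q_cont; rewrite cabs_cexp.
exact: (cvgM (continuous_comp ce cq) ce).
Qed.

Let G_diff (u : Co) : expR (Re u) < rho -> expR (Re u) != cabs w ->
  differentiable (G : Co -> Co) u.
Proof.
move=> ur uw; apply: differentiableM; last exact: differentiable_cexp.
apply: differentiable_expc; apply: q_diff; rewrite ?cabs_cexp//.
by apply: contraNneq uw => <-; rewrite cabs_cexp.
Qed.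

Let J_const x1 x2 : x1 <= x2 -> expR x2 < rho ->
  (forall x, x1 <= x <= x2 -> expR x != cabs w) -> circ G x1 = circ G x2.
Proof.
move=> x12 x2r hw; apply: circ_const => // x t xI; apply: G_diff => /=; last exact: hw.
by apply: le_lt_trans x2r; rewrite ler_expR; case/andP: xI.
Qed.

Let J_bound r : 0 < r < rho -> exists2 M, 0 <= M & forall x t, expR x <= r -> 0 <= t <= tau ->
  cabs (G (x +i* t)) <= M * expR x.
Proof.
move=> /andP[r0 rr].
have [|M M0 hM] := @disc_bounded (q : Co -> Co) r (ltW r0).
  by move=> z zr; apply: q_cont; exact: le_lt_trans rr.
exists M => // x t xr tI; rewrite /G cabsM cabs_cexp ler_wpM2r ?expR_ge0//.
by rewrite cexp_real_imag hM// expR_ge0.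
Qed.

Let J_cont a : expR a < rho -> {for a, continuous (circ G : R -> Co)}.
Proof.
move=> ar; have [v av vr] : exists2 v, a < v & expR v < rho.
  have [r ar' rr] : exists2 r, expR a < r & r < rho.
    by exists ((expR a + rho) / 2); rewrite ?midf_lt.
  have r0 : 0 < r by apply: lt_trans ar'; exact: expR_gt0.
  exists (ln r); first by rewrite -ltr_expR lnK.
  by rewrite lnK.
have [|M M0 hM] := @J_bound (expR v); first by rewrite expR_gt0 vr.
apply: (@circ_continuous _ (a - 1) v a (M * expR v)).
- by rewrite av andbT ltrBlDr ltrDl.
- by move=> x t /andP[_ xv]; apply: G_cont => /=; apply: lt_trans vr; rewrite ltr_expR.
- move=> x t /andP[_ /ltW xv] tI; rewrite -ler_expR in xv.
  by apply: le_trans (hM _ _ xv tI) _; rewrite ler_wpM2l.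
Qed.

Let J_below x : expR x < rho -> (forall y, y <= x -> expR y != cabs w) -> circ G x = 0.
Proof.
move=> xr hw; apply/eqP; rewrite -cabs_eq0 eq_le cabs_ge0 andbT.
have [|M M0 hM] := @J_bound (expR x); first by rewrite expR_gt0 xr.
have bound y : y <= x -> cabs (circ G x) <= 2 * (M * tau) * expR y.
  move=> yx; rewrite -(@J_const y x)//; last by move=> z /andP[_]; exact: hw.
  have -> : 2 * (M * tau) * expR y = 2 * (M * expR y * (tau - 0)) by ring.
  apply: sInt_bound; first exact: tau_ge0.
    apply: cintble_cont => t _; apply: continuous_vert; apply: G_cont => /=.
    by apply: le_lt_trans xr; rewrite ler_expR.
  by move=> t tI; apply: hM => //; rewrite ler_expR.
apply/ler_addgt0Pr => e ep; rewrite add0r.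
set K := 2 * (M * tau) in bound.
have K0 : 0 <= K by rewrite !mulr_ge0// tau_ge0.
have e1 : 0 < e / (K + 1) by rewrite divr_gt0// ltr_wpDl.
(* The radius exp y is so small that K exp y <= e; the minimum with [x] keeps [y] in the range where
   the integral is constant. *)
pose y := Num.min x (ln (e / (K + 1))).
apply: le_trans (bound y _) _; first by rewrite ge_min lexx.
have : expR y <= e / (K + 1) by rewrite -[leRHS](@lnK R) ?posrE// ler_expR ge_min lexx orbT.
move=> /(ler_wpM2l K0)/le_trans; apply.
by rewrite mulrA ler_pdivrMr ?ltr_wpDl// [leLHS]mulrC ler_wpM2l ?lerDl// ltW.
Qed.

(* The circle integral of the difference quotient is constant in the radius on
   both sides of |w|, continuous at |w|, and tends to 0 with the radius. *)
Lemma circ_quotient x : cabs w < expR x -> expR x < rho -> circ G x = 0.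
Proof.
move=> wx xr; have [w0|w0] := eqVneq (cabs w) 0.
  by apply: J_below => // y _; rewrite w0 gt_eqF// expR_gt0.
have {}w0 : 0 < cabs w by rewrite lt_def w0 cabs_ge0.
pose a := ln (cabs w); have ea : expR a = cabs w by rewrite lnK.
have ax : a < x by rewrite -ltr_expR ea.
have ca : {for a, continuous (circ G : R -> Co)} by apply: J_cont; rewrite ea.
have near_a e : 0 < e -> exists2 d, 0 < d & forall y, `|a - y| < d -> cabs (circ G y - circ G a) < e.
  move=> e0; have H := proj1 (@cvg_cabsP _ _ (nbhs a) _ (circ G : R -> Co) (circ G a)) ca _ e0.
  have [d d0 hd] := proj1 (@nbhs_normP _ (R : normedModType R) a
    (fun y => cabs (circ G y - circ G a) < e)) (H _).
  by exists d.
have below y : y < a -> circ G y = 0.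
  move=> ya; apply: J_below; first by rewrite (lt_trans _ xr)// ltr_expR (lt_trans ya).
  by move=> z zy; rewrite -ea lt_eqF// ltr_expR (le_lt_trans zy).
have above y : a < y -> y <= x -> circ G y = circ G x.
  move=> ay yx; apply: J_const => // z /andP[yz _].
  by rewrite -ea gt_eqF// ltr_expR (lt_le_trans ay).
apply/eqP; rewrite -cabs_eq0 eq_le cabs_ge0 andbT; apply/ler_addgt0Pr => e ep; rewrite add0r.
have e2 : 0 < e / 2 by rewrite divr_gt0.
have [d d0 hd] := near_a _ e2.
have dh : d / 2 < d by rewrite gtr_pMr// invf_lt1// ltr1n.
have dh0 : 0 < d / 2 by rewrite divr_gt0.
have b1 := hd (a - d / 2); rewrite subKr gtr0_norm// below ?ltrBlDr ?ltrDl// in b1.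
pose y := Num.min x (a + d / 2).
have ay : a < y by rewrite lt_min ax ltrDl.
have := hd y; rewrite above ?ge_min ?lexx// distrC gtr0_norm ?subr_gt0//.
have yd : y - a < d by rewrite ltrBlDl (le_lt_trans _ (_ : a + d / 2 < _)) ?ge_min ?lexx ?orbT ?ltrD2l.
move=> /(_ yd) b2; have {}b1 := b1 dh.
rewrite -[circ G x](subrK (circ G a)) -[X in _ + X]opprK -[X in _ - X]add0r.
rewrite [X in cabs (_ - X)](_ : _ = 0 - circ G a)//.
by apply: (le_trans (cabsD _ _)); rewrite cabsN [leRHS]splitr lerD// ltW.
Qed.

End at_point.
End Cauchy.

(** * Power series expansion of holomorphic functions on a disc *)

Section CauchySeries.
Context {R : realType}.
Local Notation C := R[i].
Local Notation Co := R[i]^o.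
Local Notation leb := (@lebesgue_measure R).
Local Notation Re := (@complex.Re R).
Local Notation tau := (@pi R *+ 2).

Lemma cexp_tau x : cexp (x +i* tau) = cexp (x +i* 0).
Proof.
rewrite (_ : x +i* tau = (x +i* 0) + (0 +i* tau)) ?cexp_periodic//.
by apply: complex_ext; rewrite /= ?addr0 ?add0r.
Qed.

Lemma continuous_arc (f : Co -> Co) (x t : R) : {for (cexp (x +i* t) : Co), continuous f} ->
  {for t, continuous (fun t => f (cexp (x +i* t)) : Co)}.
Proof.
move=> cf; have h1 := continuous_comp (@continuous_cexp R (x +i* t)) cf.
exact: (continuous_vert h1).
Qed.

Lemma differentiable_pow (V : normedModType C) (g : V -> Co) (k : nat) (v : V) :
  differentiable g v -> differentiable (fun v => g v ^+ k : Co) v.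
Proof.
move=> dg; elim: k => [|k IH].
  by under eq_fun do rewrite expr0; exact: differentiable_cst.
by under eq_fun do rewrite exprS; exact: differentiableM.
Qed.

Lemma differentiable_cexpV (k : nat) (z : Co) :
  differentiable (fun v : Co => (cexp v)^-1 ^+ k : Co) z.
Proof.
apply: differentiable_pow.
by apply: differentiableV; [exact: differentiable_cexp|exact: cexp_neq0].
Qed.

(** The integral does not depend on the radius exp x, yet it scales like exp(- k x); for k > 0 both
    can hold only if it is zero. *)
Lemma sInt_expV (k : nat) (x : R) : (0 < k)%N -> sInt 0 tau (fun t => (cexp (x +i* t))^-1 ^+ k) = 0.
Proof.
move=> k0; pose G (u : C) : C := (cexp u)^-1 ^+ k.
have JE y : circ G y = (expR y)^-1%:C ^+ k * circ G 0.
  rewrite /circ /sInt -cIntZ//; last first.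
    apply: cintble_cont => t _; apply: continuous_vert.
    by apply: differentiable_continuous; exact: differentiable_cexpV.
  apply: eq_cInt => t _; rewrite /G -exprMn; congr (_ ^+ _).
  by rewrite cexp_real_imag invfM fmorphV.
have : circ G 0 = circ G 1.
  apply: circ_const => // [y t _|y]; first exact: differentiable_cexpV.
  by rewrite /G cexp_tau.
rewrite (JE 1) -{1}[circ G 0]mul1r => /eqP; rewrite -subr_eq0 -mulrBl mulf_eq0.
case/orP => [|/eqP J0]; last by have := JE x; rewrite J0 mulr0.
rewrite subr_eq0 eq_sym -rmorphXn -(rmorph1 (real_complex R)) (inj_eq (@complexI R)).
by rewrite pexpr_eq1// ?invr_ge0 ?expR_ge0// invr_eq1 gt_eqF// expR_gt1.
Qed.

(** Cauchy's formula for the k-th Taylor coefficient, the integral of f(z) z^(-k-1) dz / (2 pi i)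
    over the circle |z| = exp x. *)
Definition coef (f : C -> C) (x : R) (k : nat) : C :=
  (tau)^-1%:C * sInt 0 tau (fun t => f (cexp (x +i* t)) * (cexp (x +i* t))^-1 ^+ k).

Variables (f : Co -> Co) (rho x : R).
Hypothesis df : forall z : Co, cabs z < rho -> differentiable f z.
Hypothesis xrho : expR x < rho.

Let z t : C := cexp (x +i* t).
Let zabs t : cabs (z t) = expR x. Proof. by rewrite cabs_cexp. Qed.

Let M := projT1 (cid2 (@disc_bounded R f (expR x) (expR_ge0 x)
  (fun z zr => differentiable_continuous (df (le_lt_trans zr xrho))))).

Let M0 : 0 <= M.
Proof. by rewrite /M; case: cid2. Qed.

Let hM t : 0 <= t <= tau -> cabs (f (z t)) <= M.
Proof.
rewrite /M; case: cid2 => m /= m0 hm tI; rewrite /z cexp_real_imag; apply: hm => //.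
by rewrite expR_ge0 lexx.
Qed.

Let iz (g : Co -> Co) : (forall t, {for (z t : Co), continuous g}) ->
  cintble leb `[0, tau] (fun t => g (z t)).
Proof. by move=> cg; apply: cintble_cont => t _; exact: (continuous_arc (@cg t)). Qed.

Let cf t : {for (z t : Co), continuous f}.
Proof. by apply: differentiable_continuous; apply: df; rewrite zabs. Qed.

Let cV k t : {for (z t : Co), continuous (fun v : Co => v^-1 ^+ k : Co)}.
Proof.
apply: differentiable_continuous; apply: differentiable_pow.
by apply: differentiableV; [exact: differentiable_idC|exact: cexp_neq0].
Qed.

Lemma coef_bound k : cabs (coef f x k) * expR x ^+ k <= 2 * M.
Proof.
have t0 : 0 < tau by rewrite mulrn_wgt0// pi_gt0.
have xk : 0 < expR x ^+ k by rewrite exprn_gt0// expR_gt0.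
have H := @sInt_bound R 0 tau (fun t => f (z t) * (z t)^-1 ^+ k) (M * (expR x)^-1 ^+ k) (tau_ge0) .
rewrite /coef cabsM cabs_real ger0_norm ?invr_ge0 ?tau_ge0//.
rewrite -ler_pdivlMr// ler_pdivrMl//; apply: le_trans (H _ _) _.
- by apply: (iz (g := fun v => f v * v^-1 ^+ k)) => t; exact: (cvgM (@cf t) (@cV k t)).
- by move=> t tI; rewrite cabsM cabsX cabsV zabs ler_wpM2r ?exprn_ge0 ?invr_ge0 ?expR_ge0// hM.
rewrite subr0 exprVn; set E := (_ ^+ k)^-1.
by rewrite (_ : 2 * (M * E * tau) = tau * (2 * M * E))//; ring.
Qed.

(** The vanishing integral of (f(z) - f(w)) z / (z - w) is expanded by a finite geometric sum in w /
    z. Its k-th term integrates to 2 pi times c_k w^k, minus f(w) when k = 0, and the remainder is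
    of order (|w| / exp x)^N. *)
Theorem cauchy_series (w : C) : cabs w < expR x ->
  ((fun N => \sum_(k < N) coef f x k * w ^+ k) : nat -> Co) @ \oo --> (f w : Co).
Proof.
move=> wx; have wr : cabs w < rho by exact: lt_trans xrho.
have t0 : 0 < tau by rewrite mulrn_wgt0// pi_gt0.
have /differentiable_cabsP[c0 hc0] := df wr.
have zw t : z t != w by apply: contraTneq wx => <-; rewrite zabs ltxx.
have zw' t : z t - w != 0 by rewrite subr_eq0.
have z0 t : z t != 0 by exact: cexp_neq0.
have H0 : sInt 0 tau (fun t => (f (z t) - f w) / (z t - w) * z t) = 0.
  rewrite -[RHS](circ_quotient df wr hc0 wx xrho); apply: eq_cInt => t _.
  by rewrite -/(z t) (negbTE (zw t)).
pose ka t := z t / (z t - w).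
have czw t : {for (z t : Co), continuous (fun v : Co => v / (v - w) : Co)}.
  apply: differentiable_continuous; apply: differentiableM; first exact: differentiable_idC.
  apply: differentiableV; last exact: zw'.
  by apply: differentiableB; [exact: differentiable_idC|exact: differentiable_cst].
have cfw t : {for (z t : Co), continuous (fun v : Co => f v - f w : Co)}.
  exact: (cvgB (@cf t) (cvg_cst (f w : Co))).
pose F k t := (f (z t) - f w) * (w ^+ k * (z t)^-1 ^+ k).
have iF k : cintble leb `[0, tau] (F k).
  apply: (iz (g := fun v => (f v - f w) * (w ^+ k * v^-1 ^+ k))) => t.
  exact: (cvgM (@cfw t) (cvgM (cvg_cst (w ^+ k : Co)) (@cV k t))).
pose E N t := (f (z t) - f w) * (w ^+ N * (z t)^-1 ^+ N) * ka t.
have iE N : cintble leb `[0, tau] (E N).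
  apply: (iz (g := fun v => (f v - f w) * (w ^+ N * v^-1 ^+ N) * (v / (v - w)))) => t.
  exact: (cvgM (cvgM (@cfw t) (cvgM (cvg_cst (w ^+ N : Co)) (@cV N t))) (@czw t)).
have expand N t : (f (z t) - f w) / (z t - w) * z t = \sum_(k < N) F k t + E N t.
  elim: N => [|N ->]; first by rewrite big_ord0 add0r /E /ka !expr0; ring.
  rewrite big_ord_recr/= -addrA; congr (_ + _); rewrite /E /F /ka !exprS.
  by field; rewrite zw' z0.
have IF k : sInt 0 tau (F k) = tau%:C * (coef f x k * w ^+ k - f w *+ (k == 0)%N).
  have -> : sInt 0 tau (F k) = w ^+ k * (sInt 0 tau (fun t => f (z t) * (z t)^-1 ^+ k) -
      f w * sInt 0 tau (fun t => (z t)^-1 ^+ k)).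
    have i1 : cintble leb `[0, tau] (fun t => f (z t) * (z t)^-1 ^+ k).
      by apply: (iz (g := fun v => f v * v^-1 ^+ k)) => t; exact: (cvgM (@cf t) (@cV k t)).
    have i2 : cintble leb `[0, tau] (fun t => (z t)^-1 ^+ k).
      by apply: (iz (g := fun v => v^-1 ^+ k)) => t; exact: (@cV k t).
    rewrite /sInt -(cIntZ _ (f w))// -cIntB//; last exact: cintbleZ.
    rewrite -cIntZ//; last by apply: cintbleB => //; exact: cintbleZ.
    by apply: eq_cInt => t _; rewrite /F; ring.
  have tt : tau%:C * tau^-1%:C = 1 :> C by rewrite -rmorphM mulfV ?gt_eqF.
  rewrite [RHS]mulrBr /coef !mulrA tt mul1r mulrBr; congr (_ - _); first by rewrite mulrC.
  case: k {iF iE expand} => [|k]; last by rewrite sInt_expV ?mulr0// mulr0.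
  by rewrite expr0 mul1r mulr1n [RHS]mulrC sInt_cst ?tau_ge0// mul1r subr0.
(* The condition on [N] ensures that the term k = 0, which carries f(w), belongs to the sum. *)
have sumF N : (0 < N)%N -> tau%:C * (f w - \sum_(k < N) coef f x k * w ^+ k) = sInt 0 tau (E N).
  move=> N0; have : sInt 0 tau (fun t => \sum_(k < N) F k t + E N t) = 0.
    by rewrite -[RHS]H0; apply: eq_cInt => t _; rewrite (expand N).
  rewrite /sInt cInt_add// ?cInt_sum//; last by apply: cintble_sum.
  under eq_bigr do rewrite -/(sInt 0 tau _) IF.
  rewrite -mulr_sumr sumrB; case: N N0 => // N _; rewrite [in X in _ - X]big_ord_recl /=.
  rewrite [X in _ - (_ + X)]big1// addr0 mulr1n -/(sInt 0 tau _) => /eqP.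
  by rewrite addr_eq0 => /eqP h; rewrite -opprB mulrN h opprK.
pose K := (M + cabs (f w)) * (expR x / (expR x - cabs w)).
have K0 : 0 <= K by rewrite mulr_ge0 ?addr_ge0 ?cabs_ge0// divr_ge0 ?expR_ge0// subr_ge0 ltW.
pose q := cabs w / expR x.
have q0 : 0 <= q by rewrite divr_ge0 ?cabs_ge0 ?expR_ge0.
have q1 : q < 1 by rewrite ltr_pdivrMr ?expR_gt0// mul1r.
have bE N : (0 < N)%N -> cabs (f w - \sum_(k < N) coef f x k * w ^+ k) <= 2 * K * q ^+ N.
  move=> N0; have : cabs (sInt 0 tau (E N)) <= 2 * (K * q ^+ N * (tau - 0)).
    apply: sInt_bound => //; first exact: tau_ge0.
    move=> t tI; rewrite /E !cabsM !cabsX cabsV zabs.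
    have zwx : expR x - cabs w <= cabs (z t - w).
      by rewrite lerBlDr -(zabs t) -{1}(subrK w (z t)) cabsD.
    have zwp : 0 < expR x - cabs w by rewrite subr_gt0.
    have -> : K * q ^+ N = (M + cabs (f w)) * (cabs w ^+ N * (expR x)^-1 ^+ N) * (expR x / (expR x - cabs w)).
      by rewrite /K /q exprMn; ring.
    apply: ler_pM; rewrite ?mulr_ge0 ?exprn_ge0 ?invr_ge0 ?cabs_ge0 ?expR_ge0//.
      rewrite ler_wpM2r ?mulr_ge0 ?exprn_ge0 ?invr_ge0 ?cabs_ge0 ?expR_ge0//.
      by apply: (le_trans (cabsD _ _)); rewrite cabsN lerD2r hM.
    rewrite -cabsM -[X in cabs X * _]/(z t) zabs cabsV ler_wpM2l ?expR_ge0// lef_pV2 ?posrE//.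
    exact: lt_le_trans zwx.
  rewrite -sumF// cabsM cabs_real gtr0_norm// subr0.
  have -> : 2 * (K * q ^+ N * tau) = tau * (2 * K * q ^+ N) by ring.
  by rewrite ler_pM2l.
apply: (proj2 (cvg_cabs0P _ _ _)).
apply: (@squeeze_cvgr _ _ _ _ (cst 0) (fun N => 2 * K * q ^+ N)).
- near=> N; rewrite cabs_ge0/= cabsB; apply: bE; near: N; exact: nbhs_infty_gt.
- exact: cvg_cst.
- rewrite -[X in _ --> X](mulr0 (2 * K)); apply: cvgM; first exact: cvg_cst.
  by apply: cvg_expr; rewrite ger0_norm.
Unshelve. all: by end_near. Qed.

End CauchySeries.

(** * Power series *)

Section PowerSeries.
Context {R : realType}.
Local Notation C := R[i].
Local Notation Co := R[i]^o.
Implicit Types (a : nat -> C) (rho r : R).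

Definition psum a (t : C) : C := limn ((fun N => \sum_(k < N) a k * t ^+ k) : nat -> Co).

(** This says that the radius of convergence is at least [rho], in a form that passes to derived
    series without any upper limit. *)
Definition pbounded a rho := forall r, 0 < r < rho -> exists M, forall k, cabs (a k) * r ^+ k <= M.

Definition has_pseries a rho (f : C -> C) := pbounded a rho /\
  forall t : C, cabs t < rho -> ((fun N => \sum_(k < N) a k * t ^+ k) : nat -> Co) @ \oo --> (f t : Co).

Lemma geometric_sum_le (q : R) n : 0 <= q < 1 -> \sum_(k < n) q ^+ k <= (1 - q)^-1.
Proof.
move=> /andP[q0 q1]; have q1' : 0 < 1 - q by rewrite subr_gt0.
rewrite -[leRHS]mul1r ler_pdivlMr// mulrC -[X in X * _]opprB mulNr -subrX1 opprB.
by rewrite lerBlDr lerDl exprn_ge0.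
Qed.

(** Bernoulli's inequality for 1/q = 1 + x bounds q^k by 1 / (1 + k x), which absorbs the linear
    factor. *)
Lemma linear_geometric_bounded (q : R) : 0 < q < 1 -> exists M, forall k, k.+1%:R * q ^+ k <= M.
Proof.
move=> /andP[q0 q1]; pose x := q^-1 - 1.
have x0 : 0 < x by rewrite subr_gt0 invf_gt1.
exists (1 + x^-1) => k.
have bern : 1 + k%:R * x <= q^-1 ^+ k.
  have -> : q^-1 = 1 + x by rewrite addrC subrK.
  elim: k => [|k IH]; first by rewrite mul0r addr0 expr0.
  rewrite exprS; have : (1 + x) * (1 + k%:R * x) <= (1 + x) * (1 + x) ^+ k.
    by apply: ler_wpM2l => //; rewrite addr_ge0 ?ltW.
  apply: le_trans; rewrite -natr1.
  have : 0 <= k%:R * x * x by rewrite !mulr_ge0 ?(ltW x0).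
  by move: (k%:R) => K; nra.
have qk : 0 < q ^+ k by rewrite exprn_gt0.
rewrite exprVn -(ler_pM2r qk) mulVf ?gt_eqF// in bern.
have e1 : (1 + x^-1) * ((1 + k%:R * x) * q ^+ k) <= (1 + x^-1) * 1.
  by rewrite ler_wpM2l// addr_ge0// invr_ge0 ltW.
apply: le_trans (le_trans _ e1) _; last by rewrite mulr1.
rewrite mulrA ler_wpM2r ?(ltW qk)// -natr1.
have -> : (1 + x^-1) * (1 + k%:R * x) = k%:R + 1 + (k%:R * x + x^-1).
  by move: (k%:R) => K; field; rewrite gt_eqF.
by rewrite lerDl addr_ge0// ?mulr_ge0 ?invr_ge0 ?(ltW x0).
Qed.

(** A radius [s] strictly between [r] and [rho] leaves a factor (r / s)^k, which dominates the new
    factor k + 1. *)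
Lemma pbounded_deriv a rho : pbounded a rho -> pbounded (fun k => k.+1%:R * a k.+1) rho.
Proof.
move=> ba r /andP[r0 rr]; have [s rs srho] : exists2 s, r < s & s < rho by exists ((r + rho) / 2); rewrite midf_lt.
have s0 : 0 < s by exact: lt_trans rs.
have [M hM] := ba s (introT andP (conj s0 srho)).
have [|L hL] := @linear_geometric_bounded (r / s).
  by rewrite divr_gt0//= ltr_pdivrMr// mul1r.
have M0 : 0 <= M by apply: le_trans (hM 0%N); rewrite mulr_ge0 ?cabs_ge0// exprn_ge0// ltW.
exists (L * (M / s)) => k; rewrite cabsM cabs_nat.
have := hM k.+1; rewrite -ler_pdivlMr ?exprn_gt0// => h.
apply: le_trans (_ : k.+1%:R * (M / s ^+ k.+1) * r ^+ k <= _).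
  by rewrite ler_wpM2r ?exprn_ge0 ?(ltW r0)// ler_wpM2l.
have -> : k.+1%:R * (M / s ^+ k.+1) * r ^+ k = k.+1%:R * (r / s) ^+ k * (M / s).
  rewrite expr_div_n exprS; have sk : s ^+ k != 0 by rewrite expf_neq0// gt_eqF.
  have sn0 : s != 0 by rewrite gt_eqF.
  by move: (k.+1%:R : R) (s ^+ k) (r ^+ k) sk => K S T sk; field; rewrite sn0 sk.
by rewrite ler_wpM2r// divr_ge0// ltW.
Qed.

Lemma pbounded_natM a rho : pbounded a rho -> pbounded (fun k => k%:R * a k) rho.
Proof.
move=> ba r rr; have [M hM] := pbounded_deriv ba rr; case/andP: rr => r0 _.
exists (M * r) => -[|k].
  rewrite mul0r cabs0 mul0r mulr_ge0 ?(ltW r0)//.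
  by apply: le_trans (hM 0%N); rewrite mulr_ge0 ?cabs_ge0// exprn_ge0// ltW.
by rewrite exprSr mulrA ler_wpM2r ?hM// ltW.
Qed.

Lemma pbounded_sum a rho r : pbounded a rho -> 0 <= r < rho ->
  exists K, forall n, \sum_(k < n) cabs (a k) * r ^+ k <= K.
Proof.
move=> ba /andP[r0 rr]; have [s rs srho] : exists2 s, r < s & s < rho by exists ((r + rho) / 2); rewrite midf_lt.
have s0 : 0 < s by exact: le_lt_trans rs.
have [M hM] := ba s (introT andP (conj s0 srho)).
have M0 : 0 <= M by apply: le_trans (hM 0%N); rewrite mulr_ge0 ?cabs_ge0// exprn_ge0// ltW.
have q01 : 0 <= r / s < 1 by rewrite divr_ge0 ?(ltW s0)//= ltr_pdivrMr// mul1r.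
exists (M * (1 - r / s)^-1) => n.
apply: le_trans (_ : \sum_(k < n) M * (r / s) ^+ k <= _).
  apply: ler_sum => k _; have := hM k; rewrite -ler_pdivlMr ?exprn_gt0// => h.
  apply: le_trans (ler_wpM2r (exprn_ge0 _ r0) h) _.
  by rewrite expr_div_n mulrAC mulrA.
by rewrite -mulr_sumr ler_wpM2l// geometric_sum_le.
Qed.

Lemma real_series_cvg (u : nat -> R) K : (forall n, \sum_(k < n) `|u k| <= K) ->
  cvgn (fun n => \sum_(k < n) u k).
Proof.
move=> hK; have : cvgn (fun n => \sum_(k < n) `|u k|).
  apply: nondecreasing_is_cvgn; last by exists K => _ [n _ <-].
  by apply/nondecreasing_seqP => n; rewrite big_ord_recr/= lerDl normr_ge0.
have -> : (fun n => \sum_(k < n) `|u k|) = [normed series u].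
  by apply/funext => n; rewrite /normed_series_of seriesEord.
by move=> /normed_cvg; rewrite seriesEord.
Qed.

Lemma psum_cvg a rho t : pbounded a rho -> cabs t < rho ->
  ((fun N => \sum_(k < N) a k * t ^+ k) : nat -> Co) @ \oo --> (psum a t : Co).
Proof.
move=> ba tr; have [|K hK] := @pbounded_sum _ _ (cabs t) ba; first by rewrite cabs_ge0.
have Rc : cvgn (fun n => \sum_(k < n) complex.Re (a k * t ^+ k)).
  apply: (@real_series_cvg (fun k => complex.Re (a k * t ^+ k)) K) => n.
  apply: le_trans (hK n); apply: ler_sum => k _.
  by apply: le_trans (cabs_Re _) _; rewrite cabsM cabsX.
have Ic : cvgn (fun n => \sum_(k < n) complex.Im (a k * t ^+ k)).
  apply: (@real_series_cvg (fun k => complex.Im (a k * t ^+ k)) K) => n.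
  apply: le_trans (hK n); apply: ler_sum => k _.
  by apply: le_trans (cabs_Im _) _; rewrite cabsM cabsX.
have [lr Rl] := proj1 (cvg_ex _) Rc; have [li Il] := proj1 (cvg_ex _) Ic.
have H : ((fun N => \sum_(k < N) a k * t ^+ k) : nat -> Co) @ \oo --> (lr +i* li : Co).
  apply: cvg_ReIm => /=.
    move: Rl; apply: cvg_trans; apply: near_eq_cvg; apply: nearW => n /=.
    by elim: n => [|n IH]; rewrite ?big_ord0// !big_ord_recr/= cReD IH.
  move: Il; apply: cvg_trans; apply: near_eq_cvg; apply: nearW => n /=.
  by elim: n => [|n IH]; rewrite ?big_ord0// !big_ord_recr/= cImD IH.
exact: (cvgP _ H).
Qed.

Lemma has_pseries_psum a rho : pbounded a rho -> has_pseries a rho (psum a).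
Proof. by move=> ba; split => // t tr; exact: psum_cvg tr. Qed.

Lemma cvg_cabs_le (u : nat -> Co) (l : Co) (K : R) : u @ \oo --> l ->
  (forall n, cabs (u n) <= K) -> cabs l <= K.
Proof.
move=> ul uK; have h : cabs (u n) @[n --> \oo] --> cabs l.
  exact: (continuous_cvg _ (@continuous_cabs R l) ul).
by rewrite -(cvg_lim _ h)//; apply: limr_le; [apply/cvg_ex; exists (cabs l)|exact: nearW].
Qed.

(** The constant is twice the sharp one, so that it is exactly the coefficient created by
    differentiating a power series twice; [pseries_taylor] sums these bounds. *)
Lemma pow_taylor1 (t h : C) (s : R) k : cabs t <= s -> cabs (t + h) <= s ->
  cabs ((t + h) ^+ k.+2 - t ^+ k.+2 - k.+2%:R * t ^+ k.+1 * h) <=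
  k.+2%:R * k.+1%:R * s ^+ k * cabs h ^+ 2.
Proof.
move=> ts ths; have s0 : 0 <= s := le_trans (cabs_ge0 _) ts.
elim: k => [|k IH].
  have -> : (t + h) ^+ 2 - t ^+ 2 - 2 * t ^+ 1 * h = h ^+ 2 by ring.
  by rewrite cabsX expr0 mulr1 ler_peMl ?exprn_ge0 ?cabs_ge0// mulr1 ler1n.
have -> : (t + h) ^+ k.+3 - t ^+ k.+3 - k.+3%:R * t ^+ k.+2 * h =
  (t + h) * ((t + h) ^+ k.+2 - t ^+ k.+2 - k.+2%:R * t ^+ k.+1 * h) +
  k.+2%:R * t ^+ k.+1 * h ^+ 2.
  rewrite (exprS (t + h)) (exprS t k.+2) (exprS t k.+1) -[k.+3%:R]natr1.
  by move: ((t + h) ^+ k.+2) (t ^+ k.+1) (k.+2%:R : C) => A B D; ring.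
apply: (le_trans (cabsD _ _)); rewrite !cabsM !cabsX cabs_nat.
have h2 : 0 <= cabs h ^+ 2 by rewrite exprn_ge0// cabs_ge0.
have e1 := ler_pM (cabs_ge0 _) (cabs_ge0 _) ths IH.
have e2 : k.+2%:R * cabs t ^+ k.+1 * cabs h ^+ 2 <= k.+2%:R * s ^+ k.+1 * cabs h ^+ 2.
  by rewrite ler_wpM2r// ler_wpM2l// lerXn2r// ?nnegrE ?cabs_ge0.
apply: le_trans (lerD e1 e2) _.
rewrite [s ^+ k.+1]exprS.
have -> : s * (k.+2%:R * k.+1%:R * s ^+ k * cabs h ^+ 2) + k.+2%:R * (s * s ^+ k) * cabs h ^+ 2 =
  k.+2%:R * (s * s ^+ k) * cabs h ^+ 2 * k.+2%:R.
  have -> : k.+2%:R = k.+1%:R + 1 :> R by rewrite natr1.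
  by move: (k.+1%:R : R) (s ^+ k) => B D; ring.
have -> : k.+3%:R * k.+2%:R * (s * s ^+ k) * cabs h ^+ 2 =
  k.+2%:R * (s * s ^+ k) * cabs h ^+ 2 * k.+3%:R by ring.
by apply: ler_wpM2l; rewrite ?ler_nat// !mulr_ge0// ?exprn_ge0 ?cabs_ge0.
Qed.

Lemma derive1_cabs (f : Co -> Co) (z : Co) (c : C) : (forall e : R, 0 < e ->
    exists2 d : R, 0 < d & forall h, cabs h < d ->
      cabs (f (z + h) - f z - c * h) <= e * cabs h) -> derive1 f z = c.
Proof.
move=> hc; apply: cvg_lim; first exact: norm_hausdorff.
apply: (proj2 (@cvg_cabsP _ _ _ _ _ _)) => e e0.
have e2 : 0 < e / 2 by rewrite divr_gt0.
have [d d0 hd] := hc _ e2.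
apply: (proj2 (nbhs_cabsP (0 : Co) _)); exists d => // h; rewrite subr0 => hlt h0 /=.
rewrite /GRing.scale/=.
have -> : h^-1 * (f (h + z) - f z) - c = h^-1 * (f (z + h) - f z - c * h).
  by apply/esym; rewrite mulrBr [c * h]mulrC mulKf// [z + h]addrC.
rewrite cabsM cabsV ltr_pdivrMl ?cabs_gt0//.
apply: le_lt_trans (hd _ hlt) _; rewrite mulrC ltr_pM2l ?cabs_gt0//.
by rewrite gtr_pMr// invf_lt1// ltr1n.
Qed.

(** Termwise differentiation: summing [pow_taylor1] bounds the remainder by K |h|^2, where [K]
    dominates the absolute series of second derivatives at an intermediate radius [s]. *)
Lemma pseries_taylor a rho f t : has_pseries a rho f -> cabs t < rho ->
  forall e : R, 0 < e -> exists2 d : R, 0 < d & forall h, cabs h < d ->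
    cabs (f (t + h) - f t - psum (fun k => k.+1%:R * a k.+1) t * h) <= e * cabs h.
Proof.
move=> [ba fa] tr e e0; have [s ts srho] : exists2 s, cabs t < s & s < rho by exists ((cabs t + rho) / 2); rewrite midf_lt.
have s0 : 0 < s by apply: le_lt_trans ts; exact: cabs_ge0.
have ba' := pbounded_deriv ba; have ba2 := pbounded_deriv ba'.
have [|K hK] := @pbounded_sum _ _ s ba2; first by rewrite ltW.
have K0 : 0 <= K by have := hK 0%N; rewrite big_ord0.
have eK : 0 < e / (K + 1) by rewrite divr_gt0// ltr_wpDl.
exists (Num.min (s - cabs t) (e / (K + 1))); first by rewrite lt_min subr_gt0 ts eK.
move=> h; rewrite lt_min => /andP[h1 h2].
have ths : cabs (t + h) <= s.
  by apply: le_trans (cabsD _ _) _; rewrite addrC -lerBrDr ltW.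
have thr := le_lt_trans ths srho.
suff : cabs (f (t + h) - f t - psum (fun k => k.+1%:R * a k.+1) t * h) <= K * cabs h ^+ 2.
  move=> /le_trans; apply; rewrite expr2 mulrA ler_wpM2r ?cabs_ge0//.
  apply: le_trans (ler_wpM2l K0 (ltW h2)) _.
  by rewrite mulrA ler_pdivrMr ?ltr_wpDl// [leLHS]mulrC ler_wpM2l ?lerDl// ltW.
(* The sums for the function have one term more than the one for the derivative, which aligns the
   powers with their derivatives. *)
pose u N := \sum_(k < N.+1) a k * (t + h) ^+ k - \sum_(k < N.+1) a k * t ^+ k -
  (\sum_(k < N) k.+1%:R * a k.+1 * t ^+ k) * h.
apply: (@cvg_cabs_le u).
  apply: cvgB; first apply: cvgB.
  - by have := fa _ thr; rewrite -(cvg_shiftS _).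
  - by have := fa _ tr; rewrite -(cvg_shiftS _).
  - by apply: cvgM; [exact: psum_cvg tr|exact: cvg_cst].
move=> N; rewrite /u !big_ord_recl/= !expr0.
have -> : a 0%N * 1 + \sum_(i < N) a (bump 0 i) * (t + h) ^+ bump 0 i -
  (a 0%N * 1 + \sum_(i < N) a (bump 0 i) * t ^+ bump 0 i) -
  (\sum_(k < N) k.+1%:R * a k.+1 * t ^+ k) * h =
  \sum_(k < N) a k.+1 * ((t + h) ^+ k.+1 - t ^+ k.+1 - k.+1%:R * t ^+ k * h).
  rewrite opprD addrACA subrr add0r mulr_suml -!sumrB; apply: eq_bigr => k _.
  by rewrite /bump /= add1n !mulrBr; congr (_ - _); ring.
case: N => [|N]; first by rewrite big_ord0 cabs0 mulr_ge0 ?exprn_ge0 ?cabs_ge0.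
rewrite big_ord_recl/= [X in cabs (X + _)](_ : _ = 0) ?add0r; last by rewrite !expr1 expr0; ring.
apply: (le_trans (cabs_sum _ _ _)); apply: le_trans (ler_wpM2r _ (hK N)); last first.
  by rewrite exprn_ge0// cabs_ge0.
rewrite mulr_suml; apply: ler_sum => k _; rewrite /bump /= add1n !cabsM !cabs_nat.
have := ler_wpM2l (cabs_ge0 (a k.+2)) (@pow_taylor1 t h s k (ltW ts) ths).
move=> /le_trans; apply; apply: le_of_eq; ring.
Qed.

Lemma has_pseries_derive a rho f : has_pseries a rho f ->
  has_pseries (fun k => k.+1%:R * a k.+1) rho (derive1 (f : Co -> Co)).
Proof.
move=> fa; split; first exact: pbounded_deriv fa.1.
move=> t tr; rewrite (derive1_cabs (pseries_taylor fa tr)).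
exact: (psum_cvg (pbounded_deriv fa.1) tr).
Qed.

Lemma has_pseries_differentiable a rho f (t : Co) : has_pseries a rho f -> cabs t < rho ->
  differentiable (f : Co -> Co) t.
Proof.
by move=> fa tr; apply/differentiable_cabsP; eexists; exact: (pseries_taylor fa tr).
Qed.

Lemma has_pseries_derive1n a rho f m : has_pseries a rho f ->
  has_pseries (fun k => ((k + m) ^_ m)%:R * a (k + m)%N) rho (derive1n m (f : Co -> Co)).
Proof.
elim: m a f => [|m IH] a f fa.
  rewrite derive1n0; case: fa => ba fa; split => [r rr|t tr].
    by have [M hM] := ba r rr; exists M => k; rewrite ffactn0 mul1r addn0.
  have := fa t tr; apply: cvg_trans; apply: near_eq_cvg; near=> N.
  by apply: eq_bigr => k _; rewrite ffactn0 mul1r addn0.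
rewrite derive1Sn; have := IH _ _ (has_pseries_derive fa).
have E k : ((k + m) ^_ m)%:R * ((k + m).+1%:R * a (k + m).+1) =
    ((k + m.+1) ^_ m.+1)%:R * a (k + m.+1)%N.
  rewrite addnS mulrA; congr (_ * _); rewrite -natrM; congr (_%:R).
  by rewrite mulnC -ffactnS.
by under eq_fun do rewrite E.
Unshelve. all: by end_near. Qed.

Lemma has_pseries0 a rho f : 0 < rho -> has_pseries a rho f -> f 0 = a 0%N.
Proof.
move=> r0 [_ fa]; have := fa 0; rewrite cabs0 => /(_ r0) h.
have h2 : ((fun N => \sum_(k < N) a k * 0 ^+ k) : nat -> Co) @ \oo --> (a 0%N : Co).
  rewrite -(cvg_shiftS _).
  have -> : (fun n => \sum_(k < n.+1) a k * 0 ^+ k) = cst (a 0%N); last exact: cvg_cst.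
  apply/funext => n; rewrite big_ord_recl/= expr0 mulr1 big1 ?addr0// => k _.
  by rewrite /bump/= expr0n mulr0.
exact: (cvg_unique (@norm_hausdorff _ _) h h2).
Qed.

(** The m-th derivative at 0 is m! times the m-th coefficient for either series. The radii may
    differ, as coefficients obtained on different circles are compared. *)
Lemma has_pseries_unique a b r s f : 0 < r -> 0 < s -> has_pseries a r f -> has_pseries b s f ->
  a = b.
Proof.
move=> r0 s0 fa fb; apply/funext => m.
have := has_pseries0 r0 (has_pseries_derive1n m fa).
rewrite (has_pseries0 s0 (has_pseries_derive1n m fb)) add0n ffactnn => /mulfI -> //.
Qed.

End PowerSeries.

(** * Power series of polylogarithms and of their derivatives *)

Section Polylog.
Context {R : realType}.
Local Notation C := R[i].
Local Notation Co := R[i]^o.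

Lemma has_pseries_eq (a : nat -> C) (r : R) (f g : C -> C) : has_pseries a r f ->
  (forall t, cabs t < r -> f t = g t) -> has_pseries a r g.
Proof. move=> [ba fa] fg; split; first exact: ba.
by move=> t tr; rewrite -(fg t tr); exact: fa. Qed.

Lemma has_pseriesE (a : nat -> C) (r : R) (f : C -> C) t :
  has_pseries a r f -> cabs t < r -> f t = psum a t.
Proof.
by move=> [ba fa] tr; exact: (cvg_unique (@norm_hausdorff _ _) (fa t tr) (psum_cvg ba tr)).
Qed.

Lemma has_pseries_scale (a : nat -> C) (c : C) (f : C -> C) : c != 0 -> has_pseries a 1 f ->
  has_pseries (fun k => c ^+ k * a k) (cabs c)^-1 (fun t => f (c * t)).
Proof.
move=> c0 [ba fa]; have c0' : 0 < cabs c by rewrite cabs_gt0.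
split=> [r /andP[r0 rc]|t tc].
  have [|M hM] := ba (cabs c * r).
    by rewrite mulr_gt0//= -ltr_pdivlMl// mulr1.
  exists M => k; have := hM k; rewrite exprMn cabsM cabsX; congr (_ <= _); ring.
have tc1 : cabs (c * t) < 1 by rewrite cabsM -ltr_pdivlMl// mulr1.
have -> : (fun N => \sum_(k < N) c ^+ k * a k * t ^+ k) = (fun N => \sum_(k < N) a k * (c * t) ^+ k).
  by apply/funext => N; apply: eq_bigr => k _; rewrite exprMn; ring.
exact: fa.
Qed.

(** As the constant term vanishes, division by t shifts the series. The shifted series is continuous
    at 0, so its value there is the limit taken by [quot_by_id]. *)
Lemma has_pseries_quot (a : nat -> C) (r : R) (f : C -> C) : 0 < r -> a 0%N = 0 ->
  has_pseries a r f -> has_pseries (fun k => a k.+1) r (quot_by_id f).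
Proof.
move=> r0 a0 fa; have ba : pbounded (fun k => a k.+1) r.
  move=> s /andP[s0 sr]; have [M hM] := fa.1 s (introT andP (conj s0 sr)).
  exists (M / s) => k; rewrite ler_pdivlMr// -mulrA -exprSr; exact: hM.
have E t : cabs t < r -> t != 0 -> f t / t = psum (fun k => a k.+1) t.
  move=> tr t0.
  apply: (cvg_unique (@norm_hausdorff _ _) _ (psum_cvg ba tr)).
  have := fa.2 t tr; rewrite -(cvg_shiftS _) => h.
  have h2 := cvgM h (cvg_cst (t^-1 : Co)).
  have <- : (fun N => (\sum_(k < N.+1) a k * t ^+ k) * t^-1) = (fun N => \sum_(k < N) a k.+1 * t ^+ k).
    apply/funext => N; rewrite mulr_suml big_ord_recl/= a0 !mul0r add0r; apply: eq_bigr => k _.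
    by rewrite /bump/= add1n exprSr mulrA mulfK.
  exact: h2.
apply: (has_pseries_eq (has_pseries_psum ba)) => t tr.
rewrite /quot_by_id; case: eqVneq => [->|t0]; last by rewrite E.
apply/esym; apply: (@cvg_lim Co); first exact: norm_hausdorff.
have r00 : cabs (0 : C) < r by rewrite cabs0.
have c0 := differentiable_continuous (has_pseries_differentiable (has_pseries_psum ba) r00).
have c1 : (psum (fun k => a k.+1) : Co -> Co) @ (0 : Co)^' --> (psum (fun k => a k.+1) 0 : Co).
  by apply: cvg_trans c0; apply: cvg_app; exact: nbhs_dnbhs.
apply: cvg_trans c1; apply: near_eq_cvg.
apply: (proj2 (nbhs_cabsP (0 : Co) _)); exists r => // u; rewrite subr0 => ur u0 /=.
by rewrite E.
Qed.

(** The coefficients of Li_{-n}. For n > 0 the entry at k = 0 is zero, so the sum may start at 0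
    instead of 1. *)
Definition polyk n (k : nat) : C := k%:R ^+ n.

Lemma pbounded_polyk n : pbounded (polyk n) 1.
Proof.
elim: n => [|n IH].
  move=> r /andP[r0 r1]; exists 1 => k; rewrite /polyk expr0 cabs1 mul1r.
  by rewrite exprn_ile1// ltW.
by have := pbounded_natM IH; rewrite /polyk; under eq_fun do rewrite -exprS.
Qed.

Lemma cexp_ln (n k : nat) : (0 < k)%N -> cexp (n%:R * (ln (k%:R : R))%:C) = k%:R ^+ n.
Proof.
move=> k0; rewrite cexp_natM cexp_real lnK ?posrE ?ltr0n//.
by rewrite rmorph_nat.
Qed.

Lemma has_pseries_polylog n : (0 < n)%N -> has_pseries (polyk n) 1 (polylog (- n%:R)).
Proof.
move=> n0; have E : (polylog (- n%:R) : C -> C) = psum (polyk n).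
  apply/funext => t; rewrite /polylog /psum.
  have -> // : (fun N => \sum_(1 <= k < N) cexp (- (- n%:R) * (ln k%:R)%:C) * t ^+ k : Co) =
    (fun N => \sum_(k < N) polyk n k * t ^+ k).
  apply/funext => -[|N].
    by rewrite big_ord0 big_geq.
  rewrite -(big_mkord xpredT (fun k => polyk n k * t ^+ k)) big_ltn//.
  rewrite [X in _ = X + _](_ : _ = 0) ?add0r; last by rewrite /polyk expr0n gtn_eqF// mul0r.
  by apply: eq_big_nat => k /andP[k0 _]; rewrite opprK cexp_ln.
by rewrite E; apply: has_pseries_psum; exact: pbounded_polyk.
Qed.

(** The Taylor coefficients at 0 of the m-th derivative of Li_{-n}. *)
Definition bcoef n m (k : nat) : C := ((k + m) ^_ m)%:R * (k + m)%:R ^+ n.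

Lemma has_pseries_bcoef n m : (0 < n)%N ->
  has_pseries (bcoef n m) 1 (derive1n m (polylog (- n%:R) : Co -> Co)).
Proof. by move=> n0; exact: (has_pseries_derive1n m (has_pseries_polylog n0)). Qed.

(** Coefficients are compared: on the left stands the falling factorial of k + m - 1 of length m - 1
    times c^(k+m) (k + m)^(n+1), and one of the factors k + m completes it to the falling factorial
    of length m in [bcoef]. *)
Lemma polylog_quotE n m (c t : C) : (0 < m)%N -> c != 0 -> (0 < n)%N -> cabs (c * t) < 1 ->
  derive1n m.-1 (quot_by_id (fun t => polylog (- n.+1%:R) (c * t)) : Co -> Co) t =
  c ^+ m * psum (bcoef n m) (c * t).
Proof.
move=> m0 c0 n0 ct; have c0' : 0 < cabs c by rewrite cabs_gt0.
have tr : cabs t < (cabs c)^-1 by rewrite -[ltRHS]mulr1 ltr_pdivlMl// -cabsM.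
have h1 := has_pseries_scale c0 (has_pseries_polylog (ltn0Sn n)).
have r0 : 0 < (cabs c)^-1 by rewrite invr_gt0.
have h2 := has_pseries_quot r0 _ h1.
have h3 := has_pseries_derive1n m.-1 (h2 _).
have b1 : pbounded (bcoef n m) 1 by exact: (has_pseries_bcoef m n0).1.
have h4 := psum_cvg b1 ct.
have h5 := cvgM (cvg_cst (c ^+ m : Co)) h4.
have a0 : c ^+ 0 * polyk n.+1 0 = 0 by rewrite /polyk expr0n mulr0.
have H := (h3 a0).2 t tr.
have E : (fun N => \sum_(k < N) ((k + m.-1) ^_ m.-1)%:R * (c ^+ (k + m.-1).+1 *
    polyk n.+1 (k + m.-1).+1) * t ^+ k) =
  (fun N => c ^+ m * (\sum_(k < N) bcoef n m k * (c * t) ^+ k)); last first.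
  rewrite E in H.
  have H5 : ((fun N => c ^+ m * (\sum_(k < N) bcoef n m k * (c * t) ^+ k)) : nat -> Co) @ \oo
    --> (c ^+ m * psum (bcoef n m) (c * t) : Co) by exact: h5.
  have := @cvg_unique Co (@norm_hausdorff _ Co) _ _ _ _ H H5.
  by apply.
apply/funext => N; rewrite mulr_sumr; apply: eq_bigr => k _.
case: m m0 {h3 b1 h4 h5 H} => // m _ /=; rewrite /bcoef /polyk !addnS exprMn.
rewrite ffactnS /= natrM !exprS exprD.
by ring.
Qed.

End Polylog.

(** * Lebesgue measure on complex space *)

Section AffineLebesgue.
Context {R : realType}.
Local Open Scope ereal_scope.
Local Notation RR := (measurableTypeR R).
Local Notation leb := (@lebesgue_measure R).
Variables (c a : R).
Hypothesis c0 : c != 0%R.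

Let phi (x : RR) : RR := (c * x + a)%R.

Lemma measurable_affine : measurable_fun setT (phi : RR -> RR).
Proof. by apply: measurable_funD => //; exact: measurable_funM. Qed.

Let push : {measure set RR -> \bar R} :=
  measure_function_pushforward__canonical__measure_function_Measure leb measurable_affine.

Let nu : {measure set RR -> \bar R} := mscale (NngNum (normr_ge0 c)) push.

(** Both measures agree on half-open intervals. For c < 0 the preimage is closed at the other end,
    which does not change its length. *)
Let nuE A : measurable A -> leb A = nu A.
Proof.
apply: lebesgue_measure_unique => X [[u v] _ <-].
rewrite /nu /mscale /push /pushforward /=.
have dE : ((v - a) / c - (u - a) / c = (v - u) / c)%R by rewrite -mulrBl; congr (_ * _)%R; ring.
have dE' : ((u - a) / c - (v - a) / c = (u - v) / c)%R by rewrite -mulrBl; congr (_ * _)%R; ring.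
have [c_gt0|c_lt0|/esym/eqP] := ltgtP 0%R c; last by rewrite (negbTE c0).
  rewrite [X in _ = _ * leb X](_ : _ = `]((u - a) / c)%R, ((v - a) / c)%R]%classic); last first.
    apply/seteqP; split => x /=; rewrite !in_itv /= /phi ltr_pdivrMr// ler_pdivlMr//.
      by rewrite ltrBlDr lerBrDr [(x * c)%R]mulrC.
    by rewrite ltrBlDr lerBrDr [(x * c)%R]mulrC.
  rewrite [X in _ = _ * X]lebesgue_measure_itv lebesgue_measure_itv /= !lte_fin.
  rewrite ltr_pM2r ?invr_gt0// ltrD2r; case: ifP => _; last by rewrite mule0.
  by rewrite -!EFinB dE -EFinM gtr0_norm// mulrC divfK.
rewrite [X in _ = _ * leb X](_ : _ = `[((v - a) / c)%R, ((u - a) / c)%R[%classic); last first.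
  apply/seteqP; split => x /=; rewrite !in_itv /= /phi ltr_ndivlMr// ler_ndivrMr//.
    by rewrite ltrBlDr lerBrDr [(x * c)%R]mulrC andbC.
  by rewrite ltrBlDr lerBrDr [(x * c)%R]mulrC andbC.
rewrite [X in _ = _ * X]lebesgue_measure_itv lebesgue_measure_itv /= !lte_fin.
rewrite ltr_nM2r ?invr_lt0// ltrD2r; case: ifP => _; last by rewrite mule0.
by rewrite -!EFinB dE' -EFinM ltr0_norm// mulrC mulrN divfK// opprB.
Qed.

Lemma ge0_integral_affine (f : RR -> \bar R) : measurable_fun setT f -> (forall x, 0 <= f x) ->
  \int[leb]_x f x = (`|c|%R)%:E * \int[leb]_x f (c * x + a)%R.
Proof.
move=> mf f0; rewrite (@eq_measure_integral _ _ _ _ nu leb)//; last by move=> A mA _; exact: nuE.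
rewrite ge0_integral_mscale//=; congr (_ * _).
by rewrite (@ge0_integral_pushforward _ _ _ _ _ _ measurable_affine) ?preimage_setT.
Qed.

End AffineLebesgue.

Section ComplexMeasurable.
Context d (T : measurableType d) {R : realType}.
Local Notation C := R[i].
Implicit Types (f g : T -> C).

Definition cmeas f := measurable_fun setT (fun x => complex.Re (f x)) /\
  measurable_fun setT (fun x => complex.Im (f x)).

Lemma cmeas_cst (c : C) : cmeas (fun=> c).
Proof. by split; exact: measurable_cst. Qed.

Lemma cmeasD f g : cmeas f -> cmeas g -> cmeas (fun x => f x + g x).
Proof.
move=> [f1 f2] [g1 g2]; split.
  by under eq_fun do rewrite cReD; exact: measurable_funD.
by under eq_fun do rewrite cImD; exact: measurable_funD.
Qed.

Lemma cmeasM f g : cmeas f -> cmeas g -> cmeas (fun x => f x * g x).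
Proof.
move=> [f1 f2] [g1 g2]; split.
  by under eq_fun do rewrite cReM; apply: measurable_funB; exact: measurable_funM.
by under eq_fun do rewrite cImM; apply: measurable_funD; exact: measurable_funM.
Qed.

Lemma cmeasX f n : cmeas f -> cmeas (fun x => f x ^+ n).
Proof.
move=> mf; elim: n => [|n IH]; first by under eq_fun do rewrite expr0; exact: cmeas_cst.
by under eq_fun do rewrite exprS; exact: cmeasM.
Qed.

Lemma cmeas_conj f : cmeas f -> cmeas (fun x => (f x)^*).
Proof.
move=> [f1 f2]; split; first by under eq_fun do rewrite cReJ.
by under eq_fun do rewrite cImJ; exact: measurable_funN.
Qed.

Lemma cmeas_cexp f : cmeas f -> cmeas (fun x => cexp (f x)).
Proof.
have mcos : measurable_fun [set: R] cos.
  by apply: continuous_measurable_fun => x; exact: continuous_cos.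
have msin : measurable_fun [set: R] sin.
  by apply: continuous_measurable_fun => x; exact: continuous_sin.
move=> [f1 f2]; split.
  under eq_fun do rewrite Re_cexp; apply: measurable_funM.
    by apply: measurableT_comp => //; exact: measurable_expR.
  exact: measurableT_comp.
under eq_fun do rewrite Im_cexp; apply: measurable_funM.
  by apply: measurableT_comp => //; exact: measurable_expR.
exact: measurableT_comp.
Qed.

Lemma cmeas_sum n (F : 'I_n -> T -> C) : (forall i, cmeas (F i)) ->
  cmeas (fun x => \sum_(i < n) F i x).
Proof.
elim: n F => [|n IH] F hF; first by under eq_fun do rewrite big_ord0; exact: cmeas_cst.
under eq_fun do rewrite big_ord_recl; apply: cmeasD; first exact: hF.
by apply: IH => i; exact: hF.
Qed.

Lemma cmeas_cabs f : cmeas f -> measurable_fun setT (fun x => cabs (f x)).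
Proof.
move=> [f1 f2]; have msqrt : measurable_fun [set: R] (@Num.sqrt R).
  by apply: continuous_measurable_fun => x; exact: sqrt_continuous.
apply: (@measurableT_comp _ _ _ _ _ _ (@Num.sqrt R)) => //.
by apply: measurable_funD; exact: measurable_funX.
Qed.

Lemma cmeas_real (f : T -> R) : measurable_fun setT f -> cmeas (fun x => (f x)%:C).
Proof. by move=> mf; split => //; exact: measurable_cst. Qed.

Definition vmeas N (L : T -> 'rV[C]_N) := forall j, cmeas (fun x => L x 0 j).

End ComplexMeasurable.

Section CvecMeasurable.
Context {R : realType}.
Local Notation C := R[i].
Local Notation Co := R[i]^o.
Local Notation PL := (measurableTypeR R * measurableTypeR R)%type.

Definition cpt (p : PL) : C := p.1 +i* p.2.

Definition ccons N (x : C) (v : 'rV[C]_N) : 'rV[C]_N.+1 :=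
  \row_j (if unlift ord0 j is Some i then v 0 i else x).

Lemma ccons0 N x (v : 'rV[C]_N) : ccons x v 0 ord0 = x.
Proof. by rewrite mxE unlift_none. Qed.

Lemma cconsS N x (v : 'rV[C]_N) i : ccons x v 0 (lift ord0 i) = v 0 i.
Proof. by rewrite mxE liftK. Qed.

Lemma cvec_cons N (p : PL) (t : N.-tuple PL) :
  cvec (tuple_cons (p, t)) = ccons (cpt p) (cvec t).
Proof.
apply/rowP => j; case: (unliftP ord0 j) => [i ->|->]; rewrite ?cconsS ?ccons0 !mxE//.
by rewrite tnthS.
Qed.

Lemma rV_ccons N (w : 'rV[C]_N.+1) : w = ccons (w 0 ord0) (\row_i w 0 (lift ord0 i)).
Proof.
by apply/rowP => j; case: (unliftP ord0 j) => [i ->|->]; rewrite ?cconsS ?ccons0 ?mxE.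
Qed.

(** A right inverse of [cvec]: maps into vectors factor through tuples, where composition of
    measurable functions applies. *)
Definition untup N (v : 'rV[C]_N) : N.-tuple PL :=
  [tuple (complex.Re (v 0 j), complex.Im (v 0 j)) | j < N].

Lemma untupK N (v : 'rV[C]_N) : cvec (untup v) = v.
Proof. by apply/rowP => j; rewrite mxE tnth_mktuple /=; case: (v 0 j). Qed.

Lemma cmeas_cpt : cmeas (cpt : PL -> C).
Proof. by split; [exact: measurable_fst|exact: measurable_snd]. Qed.

Lemma vmeas_cvec N : vmeas (@cvec R N).
Proof.
move=> j; split.
  rewrite (_ : (fun x => _) = fst \o (fun t : N.-tuple PL => tnth t j)); last first.
    by apply/funext => t; rewrite /= mxE.
  by apply: measurableT_comp; [exact: measurable_fst|exact: measurable_tnth].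
rewrite (_ : (fun x => _) = snd \o (fun t : N.-tuple PL => tnth t j)); last first.
  by apply/funext => t; rewrite /= mxE.
by apply: measurableT_comp; [exact: measurable_snd|exact: measurable_tnth].
Qed.

Definition mfun d' (V : measurableType d') N (P : 'rV[C]_N -> V) :=
  measurable_fun setT (fun t : N.-tuple PL => P (cvec t)).

Lemma measurable_untup d (T : measurableType d) N (L : T -> 'rV[C]_N) : vmeas L ->
  measurable_fun setT (fun x => untup (L x)).
Proof.
move=> mL; apply/measurable_fun_tnthP => j.
rewrite (_ : _ \o _ = fun x => (complex.Re (L x 0 j), complex.Im (L x 0 j))); last first.
  by apply/funext => x /=; rewrite tnth_mktuple.
by have [? ?] := mL j; exact: measurable_fun_pair.
Qed.

Lemma mfun_comp d (T : measurableType d) d' (V : measurableType d') N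
    (P : 'rV[C]_N -> V) (L : T -> 'rV[C]_N) :
  mfun P -> vmeas L -> measurable_fun setT (fun x => P (L x)).
Proof.
move=> mP mL; rewrite (_ : (fun x => _) = (fun t => P (cvec t)) \o (fun x => untup (L x))).
  by apply: measurableT_comp => //; exact: measurable_untup.
by apply/funext => x /=; rewrite untupK.
Qed.

Lemma cmeas_comp d (T : measurableType d) d' (T' : measurableType d') (f : T -> C) (g : T' -> T) :
  cmeas f -> measurable_fun setT g -> cmeas (fun x => f (g x)).
Proof.
by move=> [f1 f2] mg; split; [exact: (measurableT_comp f1)|exact: (measurableT_comp f2)].
Qed.

Lemma vmeas_comp d (T : measurableType d) d' (T' : measurableType d') N (f : T -> 'rV[C]_N) (g : T' -> T) :
  vmeas f -> measurable_fun setT g -> vmeas (fun x => f (g x)).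
Proof. by move=> mf mg j; exact: (cmeas_comp (mf j)). Qed.

Lemma vmeas_ccons d (T : measurableType d) N (x : T -> C) (v : T -> 'rV[C]_N) :
  cmeas x -> vmeas v -> vmeas (fun t => ccons (x t) (v t)).
Proof.
move=> mx mv j; case: (unliftP ord0 j) => [i ->|->].
  by under eq_fun do rewrite cconsS; exact: mv.
by under eq_fun do rewrite ccons0.
Qed.

End CvecMeasurable.

Section CvecIntegral.
Context {R : realType}.
Local Open Scope ereal_scope.
Local Notation C := R[i].
Local Notation PL := (measurableTypeR R * measurableTypeR R)%type.
Local Notation plane := (@lebesgue_plane R).

(* Integrals of functions of a vector and of a complex number, hiding the real
   coordinates over which Lebesgue measure is defined. *)
Definition LI N (P : 'rV[C]_N -> \bar R) := \int[lebesgue_cvec N]_t P (cvec t).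

Definition PI (f : C -> \bar R) := \int[plane]_p f (cpt p).

Lemma eq_LI N (P Q : 'rV[C]_N -> \bar R) : (forall v, P v = Q v) -> LI P = LI Q.
Proof. by move=> PQ; apply: eq_integral => t _; rewrite PQ. Qed.

Lemma eq_PI (f g : C -> \bar R) : (forall v, f v = g v) -> PI f = PI g.
Proof. by move=> PQ; apply: eq_integral => t _; rewrite PQ. Qed.

Lemma LI_ge0 N (P : 'rV[C]_N -> \bar R) : (forall v, 0 <= P v) -> 0 <= LI P.
Proof. by move=> P0; apply: integral_ge0. Qed.

Lemma measurable_pair_ccons N d (V : measurableType d) (P : 'rV[C]_N.+1 -> V) : mfun P ->
  measurable_fun setT (fun z : PL * N.-tuple PL => P (ccons (cpt z.1) (cvec z.2))).
Proof.
move=> mP; apply: (mfun_comp mP); apply: vmeas_ccons.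
  exact: (cmeas_comp cmeas_cpt measurable_fst).
exact: (vmeas_comp (@vmeas_cvec R N) measurable_snd).
Qed.

Lemma integral_tuple_cons N (F : N.+1.-tuple PL -> \bar R) : measurable_fun setT F ->
  (forall t, 0 <= F t) ->
  \int[lebesgue_cvec N.+1]_t F t =
  \int[(plane \x lebesgue_cvec N)%E]_z F (tuple_cons z).
Proof.
move=> mF F0.
rewrite -[RHS](@ge0_integral_pushforward _ _ _ _ _ _ (@measurable_tuple_cons _ _ N) _ setT F)//.
Qed.

Lemma LI_cons N (P : 'rV[C]_N.+1 -> \bar R) : mfun P -> (forall v, 0 <= P v) ->
  LI P = PI (fun x => LI (fun v => P (ccons x v))).
Proof.
move=> mP P0; rewrite /LI (integral_tuple_cons mP (fun t => P0 _)).
have mP' := measurableT_comp mP (@measurable_tuple_cons _ _ N).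
rewrite (fubini_tonelli1 _ mP' (fun z => P0 _)).
by apply: eq_integral => p _; apply: eq_integral => t _ /=; rewrite cvec_cons.
Qed.

(** This order of integration is needed when the first coordinate is moved by an amount depending on
    the others, as in [LI_shear0]. *)
Lemma LI_consC N (P : 'rV[C]_N.+1 -> \bar R) : mfun P -> (forall v, 0 <= P v) ->
  LI P = LI (fun v => PI (fun x => P (ccons x v))).
Proof.
move=> mP P0; rewrite LI_cons//.
exact: (fubini_tonelli (fun z : PL * N.-tuple PL => P (ccons (cpt z.1) (cvec z.2)))
  (measurable_pair_ccons mP) (fun z => P0 _)).
Qed.

Lemma LI_nil (P : 'rV[C]_0 -> \bar R) : mfun P -> LI P = P 0%R.
Proof.
move=> mP; rewrite /LI integral_dirac//.
by rewrite diracT mul1e; congr (P _); apply/rowP => -[].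
Qed.

Definition pfun d (V : measurableType d) (f : C -> V) := measurable_fun setT (fun p : PL => f (cpt p)).

Lemma pfun_comp d (V : measurableType d) d' (T : measurableType d') (f : C -> V) (g : T -> C) :
  pfun f -> cmeas g -> measurable_fun setT (fun x => f (g x)).
Proof.
move=> mf [g1 g2].
rewrite (_ : (fun x => _) = (fun p => f (cpt p)) \o (fun x => (complex.Re (g x), complex.Im (g x)))).
  by apply: measurableT_comp => //; exact: measurable_fun_pair.
by apply/funext => x /=; rewrite /cpt; case: (g x).
Qed.

Lemma PIE (f : C -> \bar R) : pfun f -> (forall x, 0 <= f x) ->
  PI f = \int[lebesgue_measure]_x \int[lebesgue_measure]_y f (x +i* y)%C.
Proof. by move=> mf f0; rewrite /PI [LHS]fubini_tonelli1. Qed.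

Lemma PIEC (f : C -> \bar R) : pfun f -> (forall x, 0 <= f x) ->
  PI f = \int[lebesgue_measure]_y \int[lebesgue_measure]_x f (x +i* y)%C.
Proof. by move=> mf f0; rewrite (PIE mf f0) -(fubini_tonelli (fun p : PL => f (cpt p)) mf (fun p => f0 _)). Qed.

Lemma cmeas_line (a : R) : cmeas (fun y : measurableTypeR R => (a +i* y)%C) /\
  cmeas (fun x : measurableTypeR R => (x +i* a)%C).
Proof. by split; split => /=; first [exact: measurable_cst|exact: measurable_id]. Qed.

Lemma PI_translate (f : C -> \bar R) (b : C) : pfun f -> (forall x, 0 <= f x) ->
  PI (fun x => f (x + b)%R) = PI f.
Proof.
move=> mf f0.
have mfb : pfun (fun x => f (x + b)%R).
  by apply: (pfun_comp mf); apply: cmeasD; [exact: cmeas_cpt|exact: cmeas_cst].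
rewrite (PIEC mfb (fun x => f0 _)) (PIEC mf f0).
rewrite [RHS](ge0_integral_affine (complex.Im b) (oner_neq0 R)); first last.
- by move=> x; exact: integral_ge0.
- exact: (measurable_fun_fubini_tonelli_G (fun p : PL => f (cpt p))).
rewrite normr1 mul1e.
under [RHS]eq_integral => y _.
  rewrite (ge0_integral_affine (complex.Re b) (oner_neq0 R))//; last first.
    by apply: (pfun_comp mf); exact: (cmeas_line _).2.
  rewrite normr1 mul1e.
  over.
apply: eq_integral => y _; apply: eq_integral => x _; congr (f _).
by case: b {mfb} => b1 b2; rewrite !mul1r.
Qed.

Let integralZl_norm (k : R) (g : measurableTypeR R -> \bar R) : measurable_fun setT g ->
  (forall x, 0 <= g x) ->
  \int[lebesgue_measure]_x (`|k|%:E * g x) = `|k|%:E * \int[lebesgue_measure]_x g x.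
Proof. by move=> mg g0; rewrite ge0_integralZl// lee_fin. Qed.

(** Let c = al + i be and r = |c|^2. For be <> 0, multiplication by c is, up to exchanging the two
    variables, composed of a substitution of the second coordinate with slope r / be for fixed first
    coordinate and one of the first with slope - be for fixed second coordinate; the slopes multiply
    to r in absolute value. For be = 0 both coordinates are scaled by al. *)
Lemma PI_scale (f : C -> \bar R) (c : C) : c != 0%R -> pfun f -> (forall x, 0 <= f x) ->
  (cabs c ^+ 2)%:E * PI (fun x => f (c * x)%R) = PI f.
Proof.
move=> c0 mf f0.
have mfc : pfun (fun x => f (c * x)%R).
  by apply: (pfun_comp mf); apply: cmeasM; [exact: cmeas_cst|exact: cmeas_cpt].
rewrite cabs_sq; case: c c0 mfc => al be /= c0 mfc.
have mh (X : R) : measurable_fun setT (fun y : measurableTypeR R => f (X +i* y)%C).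
  by apply: (pfun_comp mf); exact: (cmeas_line _).1.
have mv (X : R) : measurable_fun setT (fun y : measurableTypeR R => f (y +i* X)%C).
  by apply: (pfun_comp mf); exact: (cmeas_line _).2.
have [be0|be0] := eqVneq be 0%R.
  have al0 : al != 0%R by move: c0; rewrite eq_complex /= be0 eqxx andbT.
  rewrite (PIE mfc (fun x => f0 _)) (PIE mf f0).
  rewrite [RHS](ge0_integral_affine 0 al0); first last.
  - by move=> x; exact: integral_ge0.
  - exact: (measurable_fun_fubini_tonelli_F (fun p : PL => f (cpt p))).
  under [in RHS]eq_integral => x _ do rewrite (ge0_integral_affine 0 al0 (mh _))//.
  have mG : measurable_fun setT (fun p : PL => f ((al * p.1 + 0)%R +i* (al * p.2 + 0)%R)%C).
    apply: (pfun_comp mf); split => /=.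
      by apply: measurable_funD => //; apply: measurable_funM => //; exact: measurable_fst.
    by apply: measurable_funD => //; apply: measurable_funM => //; exact: measurable_snd.
  rewrite [in RHS](integralZl_norm _ (measurable_fun_fubini_tonelli_F _ mG (fun p => f0 _))); last first.
    by move=> x; exact: integral_ge0.
  rewrite muleA; congr (_ * _).
    by rewrite -EFinM -normrM be0 expr0n /= addr0 -expr2 ger0_norm ?sqr_ge0.
  apply: eq_integral => x _; apply: eq_integral => y _; congr f.
  by apply: complex_ext => /=; rewrite be0; ring.
pose r := (al ^+ 2 + be ^+ 2)%R.
have r0 : r != 0%R.
  by rewrite gt_eqF// ltr_wpDl ?sqr_ge0// lt_def sqr_ge0 andbT sqrf_eq0.
have rb0 : (r / be)%R != 0%R by rewrite mulf_neq0// invr_neq0.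
have mbe0 : (- be)%R != 0%R by rewrite oppr_eq0.
rewrite (PIE mfc (fun x => f0 _)) (PIE mf f0).
under [in RHS]eq_integral => x _ do
  rewrite (ge0_integral_affine (- (al / be) * x)%R rb0 (mh _))//.
have mG : measurable_fun setT (fun p : PL => f (p.1 +i* (r / be * p.2 + - (al / be) * p.1)%R)%C).
  apply: (pfun_comp mf); split => /=; first exact: measurable_fst.
  by apply: measurable_funD; apply: measurable_funM;
    first [exact: measurable_cst|exact: measurable_snd|exact: measurable_fst].
rewrite [in RHS](integralZl_norm _ (measurable_fun_fubini_tonelli_F _ mG (fun p => f0 _))); last first.
  by move=> x; exact: integral_ge0.
rewrite (fubini_tonelli _ mG (fun p => f0 _)).
under [in RHS]eq_integral => y _.
  rewrite (ge0_integral_affine (al * y)%R mbe0 (measurable_fun_pair1 y mG))//.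
  over.
have mG2 : measurable_fun setT (fun p : PL =>
    f ((- be * p.1 + al * p.2)%R +i* (r / be * p.2 + - (al / be) * (- be * p.1 + al * p.2))%R)%C).
  have m1 : measurable_fun setT (fun p : PL => - be * p.1 + al * p.2)%R.
    by apply: measurable_funD; apply: measurable_funM;
      first [exact: measurable_cst|exact: measurable_snd|exact: measurable_fst].
  apply: (pfun_comp mf); split => //=.
  apply: measurable_funD; apply: measurable_funM => //; exact: measurable_snd.
rewrite [in RHS](integralZl_norm _ (measurable_fun_fubini_tonelli_G _ mG2 (fun p => f0 _))); last first.
  by move=> x; exact: integral_ge0.
rewrite muleA; congr (_ * _).
  by rewrite -EFinM -normrM mulrN divfK// normrN ger0_norm ?addr_ge0 ?sqr_ge0.
apply: eq_integral => x _; apply: eq_integral => y _; congr f.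
by apply: complex_ext => /=; rewrite /r; field.
Qed.

End CvecIntegral.

(** * Translations, diagonal maps and products in several complex variables *)

Section LIinvariance.
Context {R : realType}.
Local Open Scope ereal_scope.
Local Notation C := R[i].
Local Notation PL := (measurableTypeR R * measurableTypeR R)%type.

Lemma measurable_LI_param d (T : measurableType d) N (Q : T -> 'rV[C]_N -> \bar R) :
  measurable_fun setT (fun z : T * N.-tuple PL => Q z.1 (cvec z.2)) ->
  (forall s v, 0 <= Q s v) -> measurable_fun setT (fun s => LI (Q s)).
Proof.
move=> mQ Q0.
exact: (measurable_fun_fubini_tonelli_F (fun z : T * N.-tuple PL => Q z.1 (cvec z.2)) mQ
  (fun z => Q0 _ _)).
Qed.

Lemma mfun_ccons N d (V : measurableType d) (P : 'rV[C]_N.+1 -> V) (x : C) :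
  mfun P -> mfun (fun v => P (ccons x v)).
Proof.
move=> mP; apply: (mfun_comp mP); apply: vmeas_ccons; first exact: cmeas_cst.
exact: vmeas_cvec.
Qed.

Lemma pfun_LI_ccons N (P : 'rV[C]_N.+1 -> \bar R) : mfun P -> (forall v, 0 <= P v) ->
  pfun (fun x => LI (fun v => P (ccons x v))).
Proof.
move=> mP P0; apply: (measurable_LI_param (Q := fun p v => P (ccons (cpt p) v))) => //.
exact: measurable_pair_ccons.
Qed.

Lemma vmeasD d (T : measurableType d) N (f g : T -> 'rV[C]_N) : vmeas f -> vmeas g ->
  vmeas (fun x => f x + g x)%R.
Proof. by move=> mf mg j; under eq_fun do rewrite mxE; exact: cmeasD. Qed.

Lemma vmeas_cst d (T : measurableType d) N (v : 'rV[C]_N) : vmeas (fun _ : T => v).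
Proof. by move=> j; exact: cmeas_cst. Qed.

Lemma vmeasZ d (T : measurableType d) N (c : T -> C) (f : T -> 'rV[C]_N) : cmeas c -> vmeas f ->
  vmeas (fun x => c x *: f x)%R.
Proof. by move=> mc mf j; under eq_fun do rewrite mxE; exact: cmeasM. Qed.

Lemma cconsD N (x y : C) (u v : 'rV[C]_N) : (ccons x u + ccons y v = ccons (x + y) (u + v))%R.
Proof.
by apply/rowP => j; rewrite !mxE; case: unliftP => [i ji|ji]; rewrite ?mxE.
Qed.

Lemma LI_translate N (P : 'rV[C]_N -> \bar R) (b : 'rV[C]_N) : mfun P -> (forall v, 0 <= P v) ->
  LI (fun v => P (v + b)%R) = LI P.
Proof.
elim: N P b => [|N IH] P b mP P0.
  rewrite !LI_nil//; first by congr P; rewrite [LHS]thinmx0.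
  by apply: (mfun_comp mP); apply: vmeasD; [exact: vmeas_cvec|exact: vmeas_cst].
have mPb : mfun (fun v => P (v + b)%R).
  by apply: (mfun_comp mP); apply: vmeasD; [exact: vmeas_cvec|exact: vmeas_cst].
rewrite (LI_cons mP P0) (LI_cons mPb (fun v => P0 _)).
rewrite -(PI_translate (b 0%R ord0) (pfun_LI_ccons mP P0)); last by move=> x; exact: LI_ge0.
apply: eq_PI => x; rewrite -[RHS](IH _ (\row_i b 0%R (lift ord0 i))%R)//.
  by apply: eq_LI => v; rewrite {1}(rV_ccons b) cconsD.
exact: mfun_ccons.
Qed.

Definition dscale N (d v : 'rV[C]_N) : 'rV[C]_N := (\row_j (d 0 j * v 0 j))%R.

Lemma vmeas_dscale d (T : measurableType d) N (f g : T -> 'rV[C]_N) : vmeas f -> vmeas g ->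
  vmeas (fun x => dscale (f x) (g x)).
Proof. by move=> mf mg j; under eq_fun do rewrite mxE; exact: cmeasM. Qed.

Lemma LI_dscale N (P : 'rV[C]_N -> \bar R) (d : 'rV[C]_N) : (forall j, d 0%R j != 0%R) ->
  mfun P -> (forall v, 0 <= P v) ->
  (\prod_(j < N) cabs (d 0%R j) ^+ 2)%R%:E * LI (fun v => P (dscale d v)) = LI P.
Proof.
elim: N P d => [|N IH] P d d0 mP P0.
  rewrite big_ord0 mul1e !LI_nil//; first by congr P; rewrite [LHS]thinmx0.
  by apply: (mfun_comp mP); apply: vmeas_dscale; [exact: vmeas_cst|exact: vmeas_cvec].
have mPd : mfun (fun v => P (dscale d v)).
  by apply: (mfun_comp mP); apply: vmeas_dscale; [exact: vmeas_cst|exact: vmeas_cvec].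
pose d' : 'rV[C]_N := (\row_i d 0 (lift ord0 i))%R.
have dE x v : dscale d (ccons x v) = ccons (d 0%R ord0 * x)%R (dscale d' v).
  apply/rowP => j; rewrite mxE; case: (unliftP ord0 j) => [i ->|->].
    by rewrite !cconsS !mxE.
  by rewrite !ccons0.
have mLP := pfun_LI_ccons mP P0.
rewrite (LI_cons mP P0) (LI_cons mPd (fun v => P0 _)).
rewrite -(PI_scale (d0 ord0) mLP); last by move=> x; exact: LI_ge0.
rewrite big_ord_recl EFinM -muleA; congr (_ * _).
rewrite -ge0_integralZl//=; first last.
- by rewrite lee_fin; apply: prodr_ge0 => j _; rewrite exprn_ge0// cabs_ge0.
- by move=> x _; exact: LI_ge0.
- exact: (pfun_LI_ccons mPd (fun v => P0 _)).
apply: eq_integral => p _; rewrite -[RHS](IH _ d')//.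
- congr (_%:E * _); first by apply: eq_bigr => j _; rewrite mxE.
  by apply: eq_LI => v; rewrite dE.
- by move=> j; rewrite mxE.
- exact: mfun_ccons.
Qed.

Lemma row_mx_ccons n m x (z : 'rV[C]_n) (ze : 'rV[C]_m) :
  row_mx (ccons x z) ze = ccons x (row_mx z ze) :> 'rV[C]_(n + m).+1.
Proof.
apply/rowP => j; case: (unliftP ord0 j) => [i ->|->].
  rewrite cconsS -(@fintype.splitK n m i); case: (@fintype.split n m i) => k /=.
    have -> : lift ord0 (lshift m k) = lshift m (lift ord0 k) :> 'I_(n.+1 + m) by exact: val_inj.
    rewrite [RHS]row_mxEl; apply: etrans (row_mxEl (ccons x z) ze 0%R (lift ord0 k)) _.
    exact: cconsS.
  have -> : lift ord0 (rshift n k) = rshift n.+1 k :> 'I_(n.+1 + m) by exact: val_inj.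
  by rewrite [RHS]row_mxEr; exact: (row_mxEr (ccons x z) ze 0%R k).
have -> : ord0 = lshift m ord0 :> 'I_(n.+1 + m) by exact: val_inj.
apply: etrans (row_mxEl (ccons x z) ze 0%R ord0) _; rewrite ccons0.
by rewrite (_ : lshift m ord0 = ord0 :> 'I_(n + m).+1) ?ccons0//; exact: val_inj.
Qed.

Lemma vmeas_row_mx d (T : measurableType d) n m (f : T -> 'rV[C]_n) (g : T -> 'rV[C]_m) :
  vmeas f -> vmeas g -> vmeas (fun x => row_mx (f x) (g x)).
Proof.
move=> mf mg j; rewrite -(@fintype.splitK n m j); case: (@fintype.split n m j) => k /=.
  by under eq_fun do rewrite row_mxEl; exact: mf.
by under eq_fun do rewrite row_mxEr; exact: mg.
Qed.

Lemma LI_cat n m (P : 'rV[C]_(n + m) -> \bar R) : mfun P -> (forall v, 0 <= P v) ->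
  LI P = LI (fun z => LI (fun ze => P (row_mx z ze))).
Proof.
elim: n P => [|n IH] P mP P0.
  rewrite LI_nil; last first.
    by rewrite /mfun; under eq_fun do rewrite [cvec _]thinmx0; exact: measurable_cst.
  apply: eq_LI => v; congr P; apply/rowP => j.
  have -> : j = rshift 0 j :> 'I_(0 + m) by exact: val_inj.
  by rewrite row_mxEr; congr (v _ _); exact: val_inj.
have mQ : measurable_fun setT (fun z : (n.+1.-tuple PL) * m.-tuple PL =>
    P (row_mx (cvec z.1) (cvec z.2))).
  apply: (mfun_comp mP); apply: vmeas_row_mx.
    exact: (vmeas_comp (@vmeas_cvec R n.+1) measurable_fst).
  exact: (vmeas_comp (@vmeas_cvec R m) measurable_snd).
have mL : mfun (fun z : 'rV[C]_n.+1 => LI (fun ze => P (row_mx z ze))).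
  exact: (measurable_LI_param (Q := fun t ze => P (row_mx (cvec t) ze)) mQ (fun _ _ => P0 _)).
rewrite (LI_cons (N := n + m) mP P0) (LI_cons mL (fun z => LI_ge0 (fun _ => P0 _))).
apply: eq_PI => x; rewrite (IH (fun v => P (ccons x v)) (mfun_ccons (N := n + m) x mP) (fun v => P0 _)).
by apply: eq_LI => z; apply: eq_LI => ze; rewrite row_mx_ccons.
Qed.

End LIinvariance.

(** * Unitary maps that preserve Lebesgue measure *)

Section Isometry.
Context {R : realType}.
Local Notation C := R[i].

Lemma hermE N (u w : 'rV[C]_N) : herm u w = \sum_(j < N) u 0 j * conjc (w 0 j).
Proof. by []. Qed.

Lemma hermDl N (u v w : 'rV[C]_N) : herm (u + v) w = herm u w + herm v w.
Proof. by rewrite !hermE -big_split; apply: eq_bigr => j _; rewrite mxE mulrDl. Qed.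

Lemma hermZl N a (u w : 'rV[C]_N) : herm (a *: u) w = a * herm u w.
Proof. by rewrite !hermE mulr_sumr; apply: eq_bigr => j _; rewrite mxE mulrA. Qed.

Lemma hermC N (u w : 'rV[C]_N) : herm w u = conjc (herm u w).
Proof. by rewrite !hermE rmorph_sum; apply: eq_bigr => j _; rewrite rmorphM/= conjcK mulrC. Qed.

Lemma hermDr N (u v w : 'rV[C]_N) : herm w (u + v) = herm w u + herm w v.
Proof. by rewrite hermC hermDl rmorphD/= -!hermC. Qed.

Lemma hermZr N a (u w : 'rV[C]_N) : herm w (a *: u) = conjc a * herm w u.
Proof. by rewrite hermC hermZl rmorphM/= -hermC. Qed.

Lemma herm_deltar N (w : 'rV[C]_N) j : herm w (delta_mx 0 j) = w 0 j.
Proof.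
rewrite !hermE (bigD1 j)//= big1 ?addr0; first by rewrite mxE !eqxx conjc_nat mulr1.
by move=> i /negbTE ij; rewrite mxE eqxx ij conjc_nat mulr0.
Qed.

Lemma herm_deltal N (w : 'rV[C]_N) j : herm (delta_mx 0 j) w = conjc (w 0 j).
Proof. by rewrite hermC herm_deltar. Qed.

Lemma herm_ccons N x y (u v : 'rV[C]_N) : herm (ccons x u) (ccons y v) = x * conjc y + herm u v.
Proof.
rewrite !hermE big_ord_recl !ccons0; congr (_ + _).
by apply: eq_bigr => i _; rewrite !cconsS.
Qed.

(* Invariance of Lebesgue measure is a field because it is only established for
   the unitary maps obtained as products of transvections. *)
Record isometry N (L : 'rV[C]_N -> 'rV[C]_N) : Prop := Isometry {
  isoP : forall a u v, L (a *: u + v) = a *: L u + L v;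
  iso_herm : forall u v, herm (L u) (L v) = herm u v;
  iso_vmeas : vmeas (fun t => L (cvec t));
  iso_LI : forall P : 'rV[C]_N -> \bar R, mfun P -> (forall v, 0 <= P v)%E ->
     LI (fun v => P (L v)) = LI P }.

Lemma isometry_id N : isometry (fun v : 'rV[C]_N => v).
Proof. by split => //; exact: vmeas_cvec. Qed.

Lemma mfun_iso N L d (V : measurableType d) (P : 'rV[C]_N -> V) : isometry L -> mfun P ->
  mfun (fun v => P (L v)).
Proof. by move=> iL mP; exact: (mfun_comp mP (iso_vmeas iL)). Qed.

Lemma isometry_comp N (L K : 'rV[C]_N -> 'rV[C]_N) : isometry L -> isometry K ->
  isometry (fun v => L (K v)).
Proof.
move=> iL iK; split.
- by move=> a u v; rewrite (isoP iK) (isoP iL).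
- by move=> u v; rewrite (iso_herm iL) (iso_herm iK).
- move=> j; have mK := measurable_untup (iso_vmeas iK).
  have := cmeas_comp (iso_vmeas iL j) mK.
  by under eq_fun do rewrite untupK.
- move=> P mP P0; rewrite -[RHS](iso_LI iL mP P0).
  exact: (iso_LI iK (mfun_iso iL mP) (fun v => P0 _)).
Qed.

Lemma cconsZ N a (x : C) (u : 'rV[C]_N) : a *: ccons x u = ccons (a * x) (a *: u).
Proof.
by apply/rowP => j; case: (unliftP ord0 j) => [i ->|->]; rewrite ?mxE ?liftK ?unlift_none ?mxE.
Qed.

Definition tailv N (w : 'rV[C]_N.+1) : 'rV[C]_N := \row_i w 0 (lift ord0 i).

Lemma tailv_ccons N (x : C) (u : 'rV[C]_N) : tailv (ccons x u) = u.
Proof. by apply/rowP => i; rewrite mxE cconsS. Qed.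

Lemma isometry_cons N (L : 'rV[C]_N -> 'rV[C]_N) : isometry L ->
  isometry (fun w : 'rV[C]_N.+1 => ccons (w 0 ord0) (L (tailv w))).
Proof.
move=> iL.
have mL : vmeas (fun t : N.+1.-tuple _ => L (tailv (@cvec R _ t))).
  move=> j; have mt : vmeas (fun t : N.+1.-tuple _ => tailv (@cvec R _ t)).
    by move=> k; under eq_fun do rewrite mxE; exact: vmeas_cvec.
  have := cmeas_comp (iso_vmeas iL j) (measurable_untup mt).
  by under eq_fun do rewrite untupK.
have mV : vmeas (fun t : N.+1.-tuple _ => ccons ((@cvec R _ t) 0 ord0) (L (tailv (@cvec R _ t)))).
  by apply: vmeas_ccons => //; exact: vmeas_cvec.
split => //.
- move=> a u v; rewrite cconsZ cconsD -(isoP iL) !mxE; congr (ccons _ (L _)).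
  by apply/rowP => i; rewrite !mxE.
- move=> u v; rewrite herm_ccons (iso_herm iL) -herm_ccons.
  by rewrite -!rV_ccons.
- move=> P mP P0.
  have mP' := mfun_comp mP mV.
  rewrite (LI_cons mP' (fun v => P0 _)) (LI_cons mP P0); apply: eq_PI => x.
  rewrite -[RHS](iso_LI iL (mfun_ccons x mP) (fun v => P0 _)).
  by apply: eq_LI => v; rewrite ccons0 tailv_ccons.
Qed.

(** With the other coordinates fixed, the shear is a translation of the first coordinate, which is
    therefore integrated innermost. *)
Lemma LI_shear0 N (c : C) (P : 'rV[C]_N.+2 -> \bar R) : mfun P -> (forall v, 0 <= P v)%E ->
  LI (fun w => P (w + (c * w 0 ord_max) *: delta_mx 0 ord0)) = LI P.
Proof.
move=> mP P0.
have mV : vmeas (fun t : N.+2.-tuple _ => @cvec R _ t + (c * (@cvec R _ t) 0 ord_max) *: delta_mx 0 ord0).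
  apply: vmeasD; first exact: vmeas_cvec.
  apply: vmeasZ; last exact: vmeas_cst.
  by apply: cmeasM; [exact: cmeas_cst|exact: vmeas_cvec].
rewrite (LI_consC (mfun_comp mP mV) (fun v => P0 _)) (LI_consC mP P0); apply: eq_LI => v.
have mp : pfun (fun x => P (ccons x v)).
  by apply: (mfun_comp mP); apply: vmeas_ccons; [exact: cmeas_cpt|exact: vmeas_cst].
rewrite -[RHS](PI_translate (c * v 0 ord_max) mp (fun x => P0 _)); apply: eq_PI => x; congr P.
have -> : delta_mx 0 ord0 = ccons 1 0 :> 'rV[C]_N.+2.
  by apply/rowP => j; case: (unliftP ord0 j) => [i ->|->]; rewrite ?cconsS ?ccons0 !mxE.
have -> : ccons x v 0 ord_max = v 0 ord_max.
  by rewrite (_ : ord_max = lift ord0 ord_max) ?cconsS//; exact: val_inj.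
by rewrite cconsZ cconsD scaler0 addr0 mulr1.
Qed.

(** With the first coordinate fixed, the shear translates the remaining vector by a constant. *)
Lemma LI_shear1 N (c : C) (P : 'rV[C]_N.+2 -> \bar R) : mfun P -> (forall v, 0 <= P v)%E ->
  LI (fun w => P (w + (c * w 0 ord0) *: delta_mx 0 ord_max)) = LI P.
Proof.
move=> mP P0.
have mV : vmeas (fun t : N.+2.-tuple _ => @cvec R _ t + (c * (@cvec R _ t) 0 ord0) *: delta_mx 0 ord_max).
  apply: vmeasD; first exact: vmeas_cvec.
  apply: vmeasZ; last exact: vmeas_cst.
  by apply: cmeasM; [exact: cmeas_cst|exact: vmeas_cvec].
rewrite (LI_cons (mfun_comp mP mV) (fun v => P0 _)) (LI_cons mP P0); apply: eq_PI => x.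
rewrite -[RHS](LI_translate ((c * x) *: delta_mx 0 ord_max) (mfun_ccons x mP) (fun v => P0 _)).
apply: eq_LI => v; congr P.
have -> : delta_mx 0 ord_max = ccons 0 (delta_mx 0 ord_max) :> 'rV[C]_N.+2.
  by apply/rowP => j; case: (unliftP ord0 j) => [i ->|->]; rewrite ?cconsS ?ccons0 !mxE.
by rewrite ccons0 cconsZ cconsD mulr0 addr0.
Qed.

Lemma vmeas_shear N (c : C) i j :
  vmeas (fun t : N.-tuple _ => @cvec R _ t + (c * (@cvec R _ t) 0 i) *: delta_mx 0 j).
Proof.
apply: vmeasD; first exact: vmeas_cvec.
apply: vmeasZ; last exact: vmeas_cst.
by apply: cmeasM; [exact: cmeas_cst|exact: vmeas_cvec].
Qed.

(* A unitary 2x2 matrix with q <> 0 is a product of three transvections. *)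
Lemma isometry_givens N (p q : C) : q != 0 -> p * conjc p + q * conjc q = 1 ->
  isometry (fun w : 'rV[C]_N.+2 => w +
    ((p - 1) * w 0 ord0 - conjc q * w 0 ord_max) *: delta_mx 0 ord0 +
    (q * w 0 ord0 + (conjc p - 1) * w 0 ord_max) *: delta_mx 0 ord_max).
Proof.
(* The diagonal entries of the product of the three shears are 1 + d q and 1 + q c; equating them
   with p and conj p determines [c] and [d], and the last entry follows from [pq]. *)
move=> q0 pq; pose c := (conjc p - 1) / q; pose d := (p - 1) / q.
set g := (X in isometry X).
pose A (k : C) (w : 'rV[C]_N.+2) := w + (k * w 0 ord_max) *: delta_mx 0 ord0.
pose B (k : C) (w : 'rV[C]_N.+2) := w + (k * w 0 ord0) *: delta_mx 0 ord_max.
have m0 : (ord_max == ord0 :> 'I_N.+2) = false by [].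
have gE w : g w = A d (B q (A c w)).
  rewrite /g /A /B !mxE /= eqxx ?mulr1 ?mulr0 ?addr0.
  set x := w 0 ord0; set y := w 0 ord_max.
  have e1 : (p - 1) * x - conjc q * y = c * y + d * (y + q * (x + c * y)).
    have qE : conjc q = (1 - p * conjc p) / q by rewrite -pq addrAC subrr add0r mulrC mulKf.
    by rewrite /c /d qE; field.
  have e2 : q * x + (conjc p - 1) * y = q * (x + c * y).
    by rewrite /c; field.
  by rewrite e1 e2 scalerDl -!addrA; congr (_ + (_ + _)); rewrite addrC.
have iV : vmeas (fun t : N.+2.-tuple _ => g (@cvec R _ t)).
  move=> j; under eq_fun do rewrite gE.
  have h1 := cmeas_comp (vmeas_shear d ord_max ord0 j) (measurable_untup (vmeas_shear q ord0 ord_max)).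
  have := cmeas_comp h1 (measurable_untup (vmeas_shear c ord_max ord0)).
  by under eq_fun do rewrite !untupK.
split => //.
- by move=> a u v; rewrite /g; apply/rowP => j; rewrite !mxE; ring.
- move=> u v; rewrite /g !(hermDl, hermDr, hermZl, hermZr) !herm_deltal !herm_deltar.
  rewrite !mxE !eqxx !m0 (eq_sym ord0) m0 /= !(rmorphB, rmorphD, rmorphM, rmorph1)/= !conjcK.
  have -> : Complex 1 (- 0) = 1 :> C by rewrite oppr0.
  have -> : Complex 0 (- 0) = 0 :> C by rewrite oppr0.
  apply/eqP; rewrite -subr_eq0; apply/eqP.
  transitivity ((u 0 ord0 * conjc (v 0 ord0) + u 0 ord_max * conjc (v 0 ord_max)) * (p * conjc p + q * conjc q - 1)).
    by ring.
  by rewrite pq subrr mulr0.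
- move=> P mP P0.
  have mA : mfun (fun w => P (A d w)) by apply: (mfun_comp mP); exact: vmeas_shear.
  have mB : mfun (fun w => P (A d (B q w))) by apply: (mfun_comp mA); exact: vmeas_shear.
  rewrite -[RHS](LI_shear0 d mP P0) -[RHS](LI_shear1 q mA (fun v => P0 _)).
  rewrite -[RHS](LI_shear0 c mB (fun v => P0 _)).
  by apply: eq_LI => w; rewrite gE.
Qed.

(** By induction the tail of v is the image of s times its own last axis vector. A rotation in the
    first and last coordinates then distributes a vector of length sqrt(|x|^2 + |s|^2) on the last
    axis over x and s. For x = 0 the rotation would have q = 0, and none is required. *)
Lemma isometry_to_last N (v : 'rV[C]_N.+1) :
  exists L s, isometry L /\ L (s *: delta_mx 0 ord_max) = v.
Proof.
elim: N v => [|N IH] v.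
  exists (fun w => w), (v 0 ord0); split; first exact: isometry_id.
  apply/rowP => j; by rewrite !mxE (ord1 j) /= mulr1; congr (v _ _); exact: val_inj.
have [L [s [iL Lv]]] := IH (tailv v); set x := v 0 ord0.
have iL1 := isometry_cons iL.
have dE : delta_mx 0 ord_max = ccons 0 (delta_mx 0 ord_max) :> 'rV[C]_N.+2.
  by apply/rowP => j; case: (unliftP ord0 j) => [i ->|->]; rewrite ?cconsS ?ccons0 !mxE.
have [x0|x0] := eqVneq x 0.
  exists (fun w : 'rV[C]_N.+2 => ccons (w 0 ord0) (L (tailv w))), s; split => //.
  rewrite dE cconsZ ccons0 tailv_ccons Lv mulr0 -x0; exact/esym/rV_ccons.
pose S := Num.sqrt (cabs x ^+ 2 + cabs s ^+ 2).
have S2 : S ^+ 2 = cabs x ^+ 2 + cabs s ^+ 2.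
  by rewrite sqr_sqrtr// addr_ge0// exprn_ge0// cabs_ge0.
have S0 : S != 0.
  by rewrite -sqrf_eq0 S2 gt_eqF// ltr_wpDr ?exprn_gt0 ?cabs_gt0// exprn_ge0 ?cabs_ge0.
(* [Sc] is [S] as a complex number; hiding its definition makes it an atom for [field]. *)
have [Sc [S0' cS Sc2]] : exists Sc : C,
    [/\ Sc != 0, conjc Sc^-1 = Sc^-1 & Sc ^+ 2 = (cabs x ^+ 2 + cabs s ^+ 2)%:C].
  exists S%:C; split; last by rewrite -rmorphXn S2.
    by rewrite -(rmorph0 (real_complex R)) (inj_eq (@complexI R)).
  by rewrite -fmorphV conjc_real.
(* These are the entries for which the image of [Sc] times the last axis vector, (- conj q Sc, conj
   p Sc), equals (x, s). *)
pose q : C := - conjc x / Sc; pose p : C := conjc s / Sc.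
have q0 : q != 0 by rewrite mulf_neq0 ?invr_neq0// oppr_eq0 conjc_eq0.
have pq : p * conjc p + q * conjc q = 1.
  rewrite /p /q !rmorphM rmorphN /= !conjcK cS.
  have -> : conjc s / Sc * (s * Sc^-1) + - conjc x / Sc * (- x * Sc^-1) =
    (s * conjc s + x * conjc x) / Sc ^+ 2 by field.
  have e : (cabs s ^+ 2)%:C + (cabs x ^+ 2)%:C = Sc ^+ 2 by rewrite Sc2 addrC rmorphD.
  by rewrite !mulcJ e divff// expf_neq0.
exists (fun w : 'rV[C]_N.+2 => (fun w : 'rV[C]_N.+2 => ccons (w 0 ord0) (L (tailv w)))
  (w + ((p - 1) * w 0 ord0 - conjc q * w 0 ord_max) *: delta_mx 0 ord0 +
    (q * w 0 ord0 + (conjc p - 1) * w 0 ord_max) *: delta_mx 0 ord_max)), Sc.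
split; first exact: (isometry_comp iL1 (isometry_givens N q0 pq)).
set w := Sc *: delta_mx 0 ord_max.
have w0 : w 0 ord0 = 0 by rewrite !mxE mulr0.
have w1 : w 0 ord_max = Sc by rewrite !mxE !eqxx mulr1.
rewrite w0 w1 !mulr0 sub0r add0r.
have -> : w + - (conjc q * Sc) *: delta_mx 0 ord0 + ((conjc p - 1) * Sc) *: delta_mx 0 ord_max =
    ccons x (s *: delta_mx 0 ord_max).
  have -> : - (conjc q * Sc) = x.
    by rewrite /q rmorphM rmorphN /= conjcK cS divfK ?opprK.
  have -> : (conjc p - 1) * Sc = s - Sc.
    by rewrite /p rmorphM /= conjcK cS mulrBl mul1r divfK.
  rewrite /w addrAC -scalerDl subrKC dE cconsZ mulr0.
  have -> : delta_mx 0 ord0 = ccons 1 0 :> 'rV[C]_N.+2.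
    by apply/rowP => j; case: (unliftP ord0 j) => [i ->|->]; rewrite ?cconsS ?ccons0 !mxE.
  by rewrite cconsZ cconsD mulr1 scaler0 ?addr0 ?add0r.
by rewrite ccons0 tailv_ccons Lv; exact/esym/rV_ccons.
Qed.

End Isometry.

(** * Norms of monomials *)

Section Radial.
Context {R : realType}.
Local Open Scope ereal_scope.
Local Notation C := R[i].
Local Notation RR := (measurableTypeR R).
Local Notation PL := (measurableTypeR R * measurableTypeR R)%type.
Local Notation plane := (@lebesgue_plane R).
Local Notation leb := (@lebesgue_measure R).

Let sqm (p : PL) : RR := (cabs (cpt p) ^+ 2)%R.

Let msqm : measurable_fun setT sqm.
Proof. by apply: measurable_funX; apply: cmeas_cabs; exact: cmeas_cpt. Qed.

(* By scaling, the push-forward of Lebesgue measure under |x|^2 is a multiple of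
   Lebesgue measure on [0, +oo[; the Gaussian integral identifies the factor. *)
Let rho : {measure set RR -> \bar R} :=
  measure_function_pushforward__canonical__measure_function_Measure plane msqm.

Let disc (v : R) : set RR := [set s | (s <= v)%R].

Let mdisc v : measurable (disc v).
Proof. by rewrite (_ : disc v = `]-oo, v]%classic) //; apply/seteqP; split => x /=; rewrite in_itv. Qed.

Let a1 : \bar R := rho (disc 1%R).

Let rhoE (A : set RR) : measurable A -> rho A = PI (fun x : C => (\1_A (cabs x ^+ 2)%R : R)%:E).
Proof.
move=> mA; rewrite /rho /= /pushforward.
rewrite -[RHS](_ : \int[plane]_p (\1_(sqm @^-1` A) p : R)%:E = _); last by apply: eq_integral.
by rewrite integral_indic ?setIT// -[X in measurable X]setTI; exact: msqm.
Qed.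

Let mind (A : set RR) : measurable A -> pfun (fun x : C => (\1_A (cabs x ^+ 2)%R : R)%:E).
Proof.
move=> mA; apply/measurable_EFinP.
by apply: (@measurableT_comp _ _ _ _ _ _ (\1_A : RR -> R)) => //; exact: measurable_indic.
Qed.

Let disc_scale (v : R) : (0 < v)%R -> rho (disc v) = v%:E * a1.
Proof.
move=> v0; rewrite /a1 !rhoE//.
have s0 : Num.sqrt v != 0%R by rewrite gt_eqF// sqrtr_gt0.
have s0' : (Num.sqrt v)%:C%C != 0%R by rewrite -(rmorph0 (real_complex R)) (inj_eq (@complexI R)).
rewrite -(PI_scale s0' (mind (mdisc v))); last by move=> x; rewrite lee_fin.
rewrite cabs_real ger0_norm ?sqrtr_ge0// sqr_sqrtr ?ltW//; congr (_ * _).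
apply: eq_PI => x; rewrite cabsM exprMn cabs_real ger0_norm ?sqrtr_ge0// sqr_sqrtr ?ltW//.
by congr (_%:E); rewrite !indicE; congr (nat_of_bool _)%:R;
  apply/idP/idP => /set_mem /= h; apply/mem_set; move: h; rewrite /disc/= ?ler_pMr// -{2}(mulr1 v) ler_pM2l.
Qed.

Let a1_fin : a1 \is a fin_num.
Proof.
rewrite ge0_fin_numE ?measure_ge0//.
have mI : measurable (`[(- 1)%R, 1%R]%classic : set RR) by exact: measurable_itv.
apply: (@le_lt_trans _ _ (plane (`[(- 1)%R, 1%R]%classic `*` `[(- 1)%R, 1%R]%classic))).
  change (plane (sqm @^-1` disc 1%R) <= plane (`[(- 1)%R, 1%R]%classic `*` `[(- 1)%R, 1%R]%classic)).
  apply: le_measure; rewrite ?inE.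
  - by rewrite -[X in measurable X]setTI; exact: msqm.
  - exact: measurableX.
  - move=> [x y] /=; rewrite /disc/= /sqm cabs_sq /= => h.
    rewrite !in_itv /= -!ler_norml; split.
      rewrite -(@ler_pXn2r _ 2)// ?nnegrE// expr1n real_normK ?num_real//.
      by apply: le_trans h; rewrite lerDl sqr_ge0.
    rewrite -(@ler_pXn2r _ 2)// ?nnegrE// expr1n real_normK ?num_real//.
    by apply: le_trans h; rewrite lerDr sqr_ge0.
rewrite [plane _]product_measure1E//= lebesgue_measure_itv /=.
by case: ifP => _; rewrite ?mule0 -?EFinB -?EFinM ?ltry.
Qed.

Let c0 : {nonneg R} := NngNum (fine_ge0 (measure_ge0 rho (disc 1%R))).

Let c0E : (c0%:num)%:E = a1.
Proof. by rewrite /c0 /= fineK. Qed.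

Let disc_le0 (v : R) : (v <= 0)%R -> rho (disc v) = 0.
Proof.
move=> v0; apply/eqP; rewrite eq_le measure_ge0 andbT.
apply/lee_addgt0Pr => e e0; rewrite add0e.
pose c1 := (c0%:num + 1)%R; have c10 : (0 < c1)%R by rewrite ltr_wpDl.
have ec : (0 < e / c1)%R by rewrite divr_gt0.
apply: (@le_trans _ _ (rho (disc (e / c1)%R))).
  apply: le_measure; [by apply: mem_set; exact: mdisc|by apply: mem_set; exact: mdisc|].
  by move=> s /= /le_trans; apply; rewrite (le_trans v0)// ltW.
rewrite disc_scale// -c0E -EFinM lee_fin mulrAC ler_pdivrMr//.
by rewrite ler_wpM2l ?lerDl// ltW.
Qed.

Let discE (v : R) : rho (disc v) = (Num.max v 0 * c0%:num)%:E.
Proof.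
have [v0|v0] := leP v 0%R; first by rewrite disc_le0// mul0r.
by rewrite disc_scale// EFinM c0E.
Qed.

Let mI : measurable (`[0%R, +oo[%classic : set RR).
Proof. exact: measurable_itv. Qed.

Let m2 : {measure set RR -> \bar R} := mscale c0 (mrestr leb mI).

Let rho_itv (u v : R) : (u < v)%R -> rho `]u, v]%classic = ((Num.max v 0 - Num.max u 0) * c0%:num)%:E.
Proof.
move=> uv.
have -> : `]u, v]%classic = disc v `\` disc u.
  apply/seteqP; split => x /=; rewrite in_itv /= /disc /=.
    by move=> /andP[ux xv]; split => //; apply/negP; rewrite -ltNge.
  by move=> [xv /negP]; rewrite -ltNge => ->.
have h := @measureD _ _ _ rho _ _ (mdisc v) (mdisc u); rewrite {}h; last by rewrite [X in X < _](discE v) ltry.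
rewrite (_ : disc v `&` disc u = disc u); last first.
  apply/seteqP; split => x /=; first by case.
  by move=> xu; split => //; apply: (le_trans xu); exact: ltW.
by rewrite [X in X - _](discE v) [X in _ - X](discE u) -EFinB mulrBl.
Qed.

Let m2_itv (u v : R) : (u < v)%R -> m2 `]u, v]%classic = ((Num.max v 0 - Num.max u 0) * c0%:num)%:E.
Proof.
move=> uv; rewrite /m2 /= /mscale /= /mrestr mulrC EFinM; congr (_ * _).
have [v0|v0] := ltP v 0%R.
  rewrite (_ : _ `&` _ = set0) ?measure0; last first.
    apply/seteqP; split => x //=; rewrite !in_itv /= andbT => -[/andP[_ xv] x0].
    by have := le_lt_trans (le_trans x0 xv) v0; rewrite ltxx.
  by rewrite [Num.max u 0%R]max_r ?subrr// ltW// (lt_trans uv).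
have [u0|u0] := ltP u 0%R.
  rewrite (_ : _ `&` _ = `[0%R, v]%classic); last first.
    apply/seteqP; split => x /=; rewrite !in_itv /= andbT.
      by move=> [/andP[_ ->] ->].
    by move=> /andP[x0 ->]; rewrite x0 (lt_le_trans u0).
  rewrite lebesgue_measure_itv /= lte_fin subr0; case: ltP => // h.
    by rewrite sube0.
  by congr (_%:E); apply/eqP; rewrite eq_le h v0.
rewrite (_ : _ `&` _ = `]u, v]%classic); last first.
  apply/seteqP; split => x /=; rewrite !in_itv /= andbT; first by case.
  by move=> /andP[ux xv]; rewrite ux xv (le_trans u0)// ltW.
by rewrite lebesgue_measure_itv /= lte_fin uv EFinB.
Qed.

Let rho_m2 (A : set RR) : measurable A -> rho A = m2 A.
Proof.
move=> mA; refine (@measure_unique _ R RR (@ocitv R) (fun k => `](- k%:R)%R, k%:R]%classic) _ _ _ _ rho m2 _ _ A mA) => //.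
- exact: ocitvI.
- by move=> i; exists ((- i%:R)%R, i%:R).
- apply/seteqP; split => // x _; exists (Num.bound `|x|%R) => //=.
  have := archi_boundP (normr_ge0 x); rewrite ltr_norml => /andP[h1 h2].
  by rewrite in_itv /= h1 ltW.
- move=> X /ocitvP[->|[[u v] /= uv ->]]; first by rewrite !measure0.
  by rewrite rho_itv// m2_itv.
- move=> k; apply: (@le_lt_trans _ _ (rho (disc k%:R))); last by rewrite discE ltry.
  apply: le_measure; [by apply: mem_set; exact: measurable_itv|by apply: mem_set; exact: mdisc|].
  by move=> x /=; rewrite in_itv /= => /andP[].
Qed.

Let PI_radial0 (phi : RR -> \bar R) : measurable_fun setT phi -> (forall s, 0 <= phi s) ->
  PI (fun x => phi (cabs x ^+ 2)%R) = (c0%:num)%:E * \int[leb]_(s in `[0%R, +oo[) phi s.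
Proof.
move=> mphi phi0.
rewrite -(ge0_integral_mscale _ mI c0 (measurable_funTS mphi))//.
rewrite (@eq_measure_integral _ _ _ _ rho); last first.
  by move=> A mA AI; rewrite [RHS]rho_m2// /m2 /= /mscale /= /mrestr setIidl.
rewrite (@ge0_integral_pushforward _ _ _ _ _ _ msqm)//; last exact: measurable_funTS.
rewrite (_ : sqm @^-1` _ = setT)//; apply/seteqP; split => // p _ /=.
by rewrite in_itv /= andbT /sqm sqr_ge0.
Qed.

Lemma integral_expR_neg (nu : R) : (0 < nu)%R ->
  \int[leb]_(s in `[0%R, +oo[) (expR (- nu * s))%:E = (nu^-1)%:E.
Proof.
move=> nu0; have := integral_exponential_pdf nu0.
have mE : measurable_fun setT (fun x : RR => (expR (- nu * x))%:E).
  apply/measurable_EFinP.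
  apply: (@measurableT_comp _ _ _ _ _ _ (@expR R) _ (fun x : RR => - nu * x)%R).
    exact: measurable_expR.
  by apply: measurable_funM => //.
rewrite (_ : (fun x => (exponential_pdf nu x)%:E) =
  (fun x => (nu * expR (- nu * x))%:E) \_ `[0%R, +oo[); last first.
  by apply/funext => x; rewrite /exponential_pdf !patchE; case: ifP.
rewrite -integral_mkcond.
rewrite -[X in X = _](_ : nu%:E * \int[leb]_(s in `[0%R, +oo[) (expR (- nu * s))%:E = _); last first.
  by rewrite -ge0_integralZl//; first [exact: measurable_funTS|
    by move=> x _; rewrite lee_fin expR_ge0|by rewrite lee_fin ltW].
move=> h; rewrite -[LHS]mul1e -(mulVf (lt0r_neq0 nu0)) EFinM -muleA h mule1.
by [].
Qed.

(** The function exp(- |x|^2) integrates radially to the unknown factor, and by Tonelli's theorem to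
    the square of the Gaussian integral. *)
Let c0pi : c0%:num = pi.
Proof.
have mE : measurable_fun setT (fun s : RR => (expR (- s))%:E).
  apply/measurable_EFinP.
  apply: (@measurableT_comp _ _ _ _ _ _ (@expR R) _ (fun x : RR => - x)%R).
    exact: measurable_expR.
  exact: measurable_funN.
have := PI_radial0 mE (fun s => _); rewrite /=.
move=> /(_ (fun s => expR_ge0 _)).
have -> : \int[leb]_(s in `[0%R, +oo[) (expR (- s))%:E = 1.
  rewrite -[RHS](_ : (1^-1)%:E = _); last by rewrite invr1.
  by rewrite -integral_expR_neg//; apply: eq_integral => s _; rewrite mulN1r.
rewrite mule1 PIE; first last.
- by move=> x; exact: expR_ge0.
- rewrite /pfun; apply: (@measurableT_comp _ _ _ _ _ _ (fun s : RR => (expR (- s))%:E)) => //.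
have gE (x y : R) : (expR (- (cabs (x +i* y)%C ^+ 2))%R)%:E = (gauss_fun x)%:E * (gauss_fun y)%:E.
  by rewrite cabs_sq /= -EFinM /gauss_fun -expRD opprD.
have mg : measurable_fun setT (fun y : RR => (gauss_fun y)%:E).
  by apply/measurable_EFinP; exact: measurable_gauss_fun.
have g0 (y : R) : 0 <= (gauss_fun y)%:E by apply: gauss_fun_ge0.
under eq_integral => x _.
  under eq_integral => y _ do rewrite gE.
  rewrite ge0_integralZl//.
  rewrite integralT_gauss.
  over.
rewrite [X in X = _ -> _](_ : _ = (\int[leb]_x (gauss_fun x)%:E) * (Num.sqrt pi)%:E); last first.
  by rewrite -ge0_integralZr// lee_fin sqrtr_ge0.
rewrite integralT_gauss -EFinM -expr2 sqr_sqrtr ?pi_ge0// => -[].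
by move=> ->.
Qed.

Lemma PI_radial (phi : RR -> \bar R) : measurable_fun setT phi -> (forall s, 0 <= phi s) ->
  PI (fun x => phi (cabs x ^+ 2)%R) = pi%:E * \int[leb]_(s in `[0%R, +oo[) phi s.
Proof. by move=> mphi phi0; rewrite PI_radial0// c0pi. Qed.

End Radial.

Section PowerIntegral.
Context {R : realType}.

Lemma integral_pow (k : nat) (A : R) : 0 < A ->
  (\int[@lebesgue_measure R]_(s in `[0%R, A]) (s ^+ k)%:E = (A ^+ k.+1 / k.+1%:R)%:E)%E.
Proof.
move=> A0; pose F (s : R) : R := (k.+1%:R^-1 * s ^+ k.+1).
have dF (s : R) : is_derive s 1 F (s ^+ k).
  rewrite (_ : F = k.+1%:R^-1 \*: ((id : R -> R) ^+ k.+1)); last first.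
    by apply/funext => x; rewrite /F fctE.
  apply: is_derive_eq; rewrite /GRing.scale/= mulr1.
  by rewrite mulrA mulVf ?mul1r// pnatr_eq0.
have cF (s : R) : {for s, continuous F}.
  by apply/differentiable_continuous/derivable1_diffP; exact: ex_derive.
rewrite (@continuous_FTC2 _ (fun s => s ^+ k)%R F)//.
- by rewrite /F expr0n /= mulr0 sube0 mulrC.
- by apply: continuous_subspaceT => x; exact: exprn_continuous.
- split => [x _||]; [exact: ex_derive|exact/cvg_at_right_filter/cF|exact/cvg_at_left_filter/cF].
- by move=> x _; rewrite derive1E; exact: derive_val.
Qed.

End PowerIntegral.

Section NormIntegrals.
Context {R : realType}.
Local Notation C := R[i].
Local Notation RR := (measurableTypeR R).
Local Notation leb := (@lebesgue_measure R).

Lemma integral_ltpow (k : nat) (A : R) :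
  (\int[leb]_(s in `[0%R, +oo[) (s ^+ k * (s < A)%R%:R)%R%:E = (Num.max A 0 ^+ k.+1 / k.+1%:R)%R%:E)%E.
Proof.
have [A0|A0] := leP A 0%R.
  rewrite expr0n /= mul0r; rewrite -[RHS](@integral0 _ _ _ leb `[0%R, +oo[%classic).
  apply: eq_integral => s; rewrite inE /= in_itv /= andbT => s0.
  by rewrite ltNge (le_trans A0 s0) /= mulr0.
rewrite -integral_pow//.
rewrite -[RHS]integral_itv_bndo_bndc; last first.
  by apply: measurable_funTS; apply/measurable_EFinP; exact: measurable_funX.
rewrite [RHS]integral_mkcond [LHS]integral_mkcond; apply: eq_integral => s _.
rewrite !patchE.
have e1 : (s \in `[0%R, +oo[%classic) = (0 <= s).
  by apply/idP/idP; rewrite inE/= in_itv/= andbT.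
have e2 : (s \in `[0%R, A[%classic) = (0 <= s) && (s < A).
  by apply/idP/idP; rewrite inE/= in_itv/=.
by rewrite e1 e2; case: (leP 0 s) => //= s0; case: (ltP s A) => sA; rewrite ?mulr1 ?mulr0.
Qed.

(** The reflection s -> A - s leads back to a power. Truncation at 0 keeps the formula valid for A
    <= 0, as the induction in [LI_ball_pow] requires when A - |x|^2 becomes negative. *)
Lemma integral_maxsub (e : nat) (A : R) :
  (\int[leb]_(s in `[0%R, +oo[) (Num.max (A - s) 0 ^+ e.+1)%R%:E =
  (Num.max A 0 ^+ e.+2 / e.+2%:R)%R%:E)%E.
Proof.
have [A0|A0] := leP A 0%R.
  rewrite expr0n /= mul0r; rewrite -[RHS](@integral0 _ _ _ leb `[0%R, +oo[%classic).
  apply: eq_integral => s; rewrite inE /= in_itv /= andbT => s0.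
  by rewrite max_r ?expr0n// subr_le0 (le_trans A0 s0).
rewrite -integral_pow//.
have N1 : (-1 : R)%R != 0%R by rewrite oppr_eq0 oner_eq0.
have mI : measurable (`[0%R, A]%classic : set RR) by exact: measurable_itv.
rewrite [RHS]integral_mkcond [LHS]integral_mkcond.
rewrite [RHS](ge0_integral_affine A N1); first last.
- by move=> s; rewrite patchE; case: ifPn => //; rewrite inE/= in_itv/= => /andP[s0 _]; rewrite lee_fin exprn_ge0.
- apply/(measurable_restrictT _ _).1 => //.
  by apply: measurable_funTS; apply/measurable_EFinP; exact: measurable_funX.
rewrite normrN1 mul1e; apply: eq_integral => s _.
rewrite !patchE; have -> : ((-1 * s + A)%R = A - s)%R by ring.
have e1 : (s \in `[0%R, +oo[%classic) = (0 <= s)%R.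
  by apply/idP/idP; rewrite inE/= in_itv/= andbT.
have e2 : (A - s \in `[0%R, A]%classic)%R = ((0 <= s) && (s <= A))%R.
  by apply/idP/idP; rewrite inE/= in_itv/= subr_ge0 lerBlDr lerDl andbC.
rewrite e1 e2; case: (leP 0%R s) => //= s0; case: (leP s A) => sA.
  by rewrite max_l ?subr_ge0.
by rewrite max_r ?expr0n// subr_le0 ltW.
Qed.

Lemma normsq_ccons N (x : C) (v : 'rV[C]_N) : (normsq (ccons x v) = cabs x ^+ 2 + normsq v)%R.
Proof. by rewrite /normsq herm_ccons cReD mulcJ. Qed.

Lemma herm_normsq N (v : 'rV[C]_N) : herm v v = (normsq v)%:C%C.
Proof.
elim: N v => [|N IH] v; first by rewrite /normsq hermE big_ord0.
by rewrite (rV_ccons v) herm_ccons IH mulcJ normsq_ccons rmorphD.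
Qed.

Lemma normsq_ge0 N (v : 'rV[C]_N) : (0 <= normsq v)%R.
Proof.
elim: N v => [|N IH] v; first by rewrite /normsq hermE big_ord0.
by rewrite (rV_ccons v) normsq_ccons addr_ge0 ?exprn_ge0 ?cabs_ge0.
Qed.

Lemma normsq_nil (v : 'rV[C]_0) : normsq v = 0%R.
Proof. by rewrite /normsq hermE big_ord0. Qed.

Lemma cmeas_herm d (T : measurableType d) N (f g : T -> 'rV[C]_N) : vmeas f -> vmeas g ->
  cmeas (fun x => herm (f x) (g x)).
Proof.
move=> mf mg; under eq_fun do rewrite hermE; apply: cmeas_sum => j.
by apply: cmeasM => //; exact: cmeas_conj.
Qed.

Lemma measurable_normsq d (T : measurableType d) N (f : T -> 'rV[C]_N) : vmeas f ->
  measurable_fun setT (fun x => normsq (f x)).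
Proof. by move=> mf; exact: (cmeas_herm mf mf).1. Qed.

Lemma measurable_ltn d (T : measurableType d) (f g : T -> R) :
  measurable_fun setT f -> measurable_fun setT g -> measurable_fun setT (fun x => (f x < g x)%R%:R : R).
Proof.
move=> mf mg; have mlt := measurable_fun_ltr mf mg.
rewrite (_ : (fun x => _) = (fun b : bool => b%:R : R) \o (fun x => f x < g x)%R)//.
by apply: measurableT_comp.
Qed.

Lemma mfun_ball_pow N (k : nat) (A : R) :
  mfun (fun v : 'rV[C]_N.+1 => (cabs (v 0%R ord_max) ^+ (k.*2) * (normsq v < A)%R%:R)%:E).
Proof.
apply/measurable_EFinP; apply: measurable_funM.
  by apply: measurable_funX; apply: cmeas_cabs; exact: vmeas_cvec.
by apply: measurable_ltn => //; apply: measurable_normsq; exact: vmeas_cvec.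
Qed.

(** Splitting off the first coordinate x leaves the same integral over the ball of squared radius A
    - |x|^2, and the radial integral over x contributes pi / (k + N + 2). The monomial is in the
    last coordinate, so it survives until dimension one. *)
Lemma LI_ball_pow N k (A : R) :
  LI (fun v : 'rV[C]_N.+1 => (cabs (v 0%R ord_max) ^+ (k.*2) * (normsq v < A)%R%:R)%:E) =
  (pi ^+ N.+1 * k`!%:R / (k + N).+1`!%:R * Num.max A 0%R ^+ (k + N).+1)%:E.
Proof.
have P0 M (B : R) (v : 'rV[C]_M.+1) : (0 <= (cabs (v 0%R ord_max) ^+ (k.*2) * (normsq v < B)%R%:R)%R%:E)%E.
  by rewrite lee_fin mulr_ge0 ?exprn_ge0 ?cabs_ge0.
elim: N A => [|N IH] A.
  rewrite (LI_cons (@mfun_ball_pow 0 k A) (P0 _ _)).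
  (* The absolute value makes [psi] nonnegative on the whole line, as [PI_radial] demands, and is
     immaterial at s = |x|^2. *)
  pose psi (s : RR) := (`|s| ^+ k * (s < A)%R%:R)%:E.
  rewrite -[LHS](_ : PI (fun x => psi (cabs x ^+ 2)) = _); last first.
    apply: eq_PI => x; rewrite LI_nil; last exact: (mfun_ccons x (@mfun_ball_pow 0 k A)).
    rewrite normsq_ccons normsq_nil addr0 /psi ger0_norm ?exprn_ge0 ?cabs_ge0// -exprM mul2n.
    by rewrite (_ : ord_max = ord0) ?ccons0//; exact: val_inj.
  have mpsi : measurable_fun setT psi.
    apply/measurable_EFinP; apply: measurable_funM; last exact: (@measurable_ltn _ RR (fun s => s) (fun=> A)).
    by apply: measurable_funX; exact: normr_measurable.
  rewrite (PI_radial mpsi); last by move=> s; rewrite lee_fin mulr_ge0 ?exprn_ge0.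
  rewrite (_ : integral _ _ _ = (Num.max A 0 ^+ k.+1 / k.+1%:R)%:E); last first.
    rewrite -integral_ltpow; apply: eq_integral => s; rewrite inE/= in_itv/= andbT => s0.
    by rewrite /psi ger0_norm.
  rewrite -EFinM; congr _%:E; rewrite addn0 factS natrM expr1.
  by field; rewrite nat1r !pnatr_eq0 -lt0n fact_gt0.
have E x v : (normsq (ccons x v) < A) = (normsq v < A - cabs x ^+ 2).
  by rewrite normsq_ccons ltrBrDl.
pose c : R := pi ^+ N.+1 * k`!%:R / (k + N).+1`!%:R.
have c0 : 0 <= c by rewrite /c !mulr_ge0 ?invr_ge0 ?exprn_ge0 ?pi_ge0.
pose phi (s : RR) := (Num.max (A - s) 0 ^+ (k + N).+1)%:E.
have mphi : measurable_fun setT phi.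
  apply/measurable_EFinP; apply: measurable_funX.
  by apply: measurable_maxr => //; apply: measurable_funB.
have phi0 s : (0 <= phi s)%E by rewrite lee_fin exprn_ge0// le_max lexx orbT.
rewrite (LI_cons (@mfun_ball_pow N.+1 k A) (P0 _ _)).
rewrite -[LHS](_ : PI (fun x => (fun s : RR => c%:E * phi s)%E (cabs x ^+ 2)) = _); last first.
  apply: eq_PI => x; rewrite -EFinM -(IH (A - cabs x ^+ 2)); apply: eq_LI => v.
  rewrite E; congr (cabs _ ^+ _ * _)%:E.
  by rewrite (_ : ord_max = lift ord0 ord_max) ?cconsS//; exact: val_inj.
rewrite (@PI_radial _ (fun s : RR => c%:E * phi s)%E).
- rewrite ge0_integralZl//=; last exact: measurable_funTS.
  rewrite integral_maxsub -!EFinM; congr _%:E.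
  rewrite addnS [in RHS]factS natrM [pi ^+ N.+2]exprS /c.
  by field; rewrite -!natrD !pnatr_eq0 -lt0n fact_gt0.
- by apply: measurable_funeM.
- by move=> s; rewrite mule_ge0.
Qed.

Lemma LI_gauss N (nu : R) : 0 < nu ->
  LI (fun v : 'rV[C]_N => (expR (- nu * normsq v))%:E) = ((pi / nu) ^+ N)%:E.
Proof.
move=> nu0.
have mE M : mfun (fun v : 'rV[C]_M => (expR (- nu * normsq v))%:E).
  apply/measurable_EFinP; apply: measurableT_comp; first exact: measurable_expR.
  by apply: measurable_funM => //; apply: measurable_normsq; exact: vmeas_cvec.
have P0 M (v : 'rV[C]_M) : (0 <= (expR (- nu * normsq v))%:E)%E by rewrite lee_fin expR_ge0.
elim: N => [|N IH]; first by rewrite LI_nil// normsq_nil mulr0 expR0 expr0.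
rewrite LI_cons//; pose c := (pi / nu) ^+ N.
have c0 : 0 <= c by rewrite exprn_ge0// divr_ge0 ?pi_ge0// ltW.
pose phi (s : RR) := (expR (- nu * s))%:E.
have mphi : measurable_fun setT phi.
  apply/measurable_EFinP; apply: (@measurableT_comp _ _ _ _ _ _ (@expR R)); first exact: measurable_expR.
  exact: measurable_funM.
have phi0 s : (0 <= phi s)%E by rewrite lee_fin expR_ge0.
transitivity (PI (fun x => (fun s : RR => c%:E * phi s)%E (cabs x ^+ 2))).
  apply: eq_PI => x; rewrite /c -IH /LI muleC -ge0_integralZl//=; last exact: mE.
  by apply: eq_integral => t _; rewrite -EFinM -expRD normsq_ccons mulrDr.
rewrite (@PI_radial _ (fun s : RR => c%:E * phi s)%E).
- rewrite ge0_integralZl//=; last exact: measurable_funTS.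
  by rewrite integral_expR_neg// -!EFinM /c exprS; congr _%:E; ring.
- by apply: measurable_funeM.
- by move=> s; rewrite mule_ge0.
Qed.

Lemma vmeas_rsubmx d (T : measurableType d) n m (f : T -> 'rV[C]_(n + m)) : vmeas f ->
  vmeas (fun x => rsubmx (f x)).
Proof. by move=> mf j; under eq_fun do rewrite mxE; exact: mf. Qed.

Lemma vmeas_lsubmx d (T : measurableType d) n m (f : T -> 'rV[C]_(n + m)) : vmeas f ->
  vmeas (fun x => lsubmx (f x)).
Proof. by move=> mf j; under eq_fun do rewrite mxE; exact: mf. Qed.

(** The fibre over z is a ball of squared radius exp(- mu |z|^2), so the integral over it is a
    multiple of a Gaussian in z with parameter mu (k + m + 1). *)
Lemma LI_hartogs_pow n m k (mu : R) : 0 < mu ->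
  LI (fun w : 'rV[C]_(n + m.+1) => (cabs (rsubmx w 0 ord_max) ^+ k.*2 *
    (normsq (rsubmx w) < expR (- mu * normsq (lsubmx w)))%R%:R)%:E) =
  (pi ^+ (n + m.+1) * k`!%:R / (k + m).+1`!%:R / (mu * (k + m).+1%:R) ^+ n)%:E.
Proof.
move=> mu0; rewrite LI_cat; first last.
- by move=> v; rewrite lee_fin mulr_ge0 ?exprn_ge0 ?cabs_ge0.
- apply/measurable_EFinP; apply: measurable_funM.
    by apply: measurable_funX; apply: cmeas_cabs; exact: (vmeas_rsubmx (@vmeas_cvec R _) ord_max).
  apply: measurable_ltn; first by apply: measurable_normsq; apply: vmeas_rsubmx; exact: vmeas_cvec.
  apply: measurableT_comp; first exact: measurable_expR.
  by apply: measurable_funM => //; apply: measurable_normsq; apply: vmeas_lsubmx; exact: vmeas_cvec.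
pose c : R := pi ^+ m.+1 * k`!%:R / (k + m).+1`!%:R.
have c0 : 0 <= c by rewrite /c !mulr_ge0 ?invr_ge0 ?exprn_ge0 ?pi_ge0.
pose nu := mu * (k + m).+1%:R.
have nu0 : 0 < nu by rewrite mulr_gt0.
transitivity (LI (fun z : 'rV[C]_n => (c%:E * (expR (- nu * normsq z))%:E)%E)).
  apply: eq_LI => z.
  rewrite -EFinM -[RHS](_ : (c * Num.max (expR (- mu * normsq z)) 0 ^+ (k + m).+1)%:E = _); last first.
    rewrite max_l ?expR_ge0// -expRM_natl; congr (c * expR _)%:E.
    by rewrite /nu -mulr_natl; ring.
  rewrite -LI_ball_pow; apply: eq_LI => ze.
  by rewrite row_mxKr row_mxKl.
rewrite {1}/LI ge0_integralZl//=.
- rewrite -[X in (_ * X)%E](_ : LI (fun v : 'rV[C]_n => (expR (- nu * normsq v))%:E) = _)//.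
  rewrite LI_gauss// -EFinM exprMn exprVn /c /nu exprD; congr _%:E; ring.
- apply/measurable_EFinP; apply: measurableT_comp; first exact: measurable_expR.
  by apply: measurable_funM => //; apply: measurable_normsq; exact: vmeas_cvec.
Qed.

End NormIntegrals.

(** * Change of variables and averaging *)

Section OpenMeasurable.
Context {R : realType}.
Local Notation C := R[i].
Local Notation Co := R[i]^o.
Local Notation rV N := ('rV[C]_N : normedModType C).

Lemma nbhs_rVP N (w : 'rV[C]_N) (O : set 'rV[C]_N) :
  nbhs (w : rV N) O <-> exists2 e : R, 0 < e & forall v : 'rV[C]_N, (forall j, cabs (v 0 j - w 0 j) < e) -> O v.
Proof.
split.
  move=> /nbhs_ballP[e /= e0 eO]; exists (complex.Re e); first by move: e0; rewrite ltcE /= => /andP[].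
  move=> v vw; apply: eO; split => // i j; rewrite (ord1 i) /ball /= normCE cabsB.
  move: e0; rewrite ltcE /= => /andP[/eqP e0 _]; case: e e0 vw => e1 e2 /= -> vw.
  by rewrite ltcR; exact: vw.
move=> [e e0 eO]; apply/nbhs_ballP; exists e%:C; first by rewrite /= ltcR.
move=> v [_ vw]; apply: eO => j; move: (vw 0 j); rewrite /ball /= normCE cabsB.
by rewrite ltcR.
Qed.

(** An open set is a countable union of polydiscs with rational centres and radii 1 / (r + 1), each
    described by finitely many measurable inequalities. *)
Lemma nbhs_measurable N (O : set 'rV[C]_N) : (forall w, O w -> nbhs (w : rV N) O) ->
  measurable (@cvec R N @^-1` O).
Proof.
move=> nO.
pose box (p : N.-tuple (rat * rat) * nat) : set 'rV[C]_N :=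
  [set w | forall j, cabs (w 0 j - (ratr (tnth p.1 j).1 +i* ratr (tnth p.1 j).2)) < p.2.+1%:R^-1].
have mbox p : measurable (@cvec R N @^-1` box p).
  rewrite [X in measurable X](_ : _ = \bigcap_(j in [set: 'I_N]) ((fun t =>
      cabs (@cvec R N t 0 j - (ratr (tnth p.1 j).1 +i* ratr (tnth p.1 j).2))) @^-1` `]-oo, p.2.+1%:R^-1[)).
    apply: fin_bigcap_measurable => // j _; rewrite -[X in measurable X]setTI.
    have : measurable_fun setT (fun t =>
      cabs (@cvec R N t 0 j - (ratr (tnth p.1 j).1 +i* ratr (tnth p.1 j).2))).
      by apply: cmeas_cabs; apply: cmeasD; [exact: vmeas_cvec|exact: cmeas_cst].
    by apply => //; exact: measurable_itv.
  apply/seteqP; split => t /=.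
    by move=> h j _ /=; rewrite in_itv/=; exact: (h j).
  by move=> h j; have := h j I; rewrite /= in_itv.
have -> : @cvec R N @^-1` O = \bigcup_(k in [set: nat])
    (if unpickle k is Some p then [set t | box p (@cvec R N t) /\ box p `<=` O] else set0).
  apply/seteqP; split => t /=; last first.
    by move=> [k _]; case: (unpickle k) => //= p [h]; exact.
  move=> /nO/nbhs_rVP[e e0 eO]; set w := cvec t in eO *.
  (* A radius below e / 2 keeps the polydisc within distance e of [w]; approximating each real
     coordinate of [w] up to half the radius puts [w] inside. *)
  have [r re] : exists r : nat, r.+1%:R^-1 < e / 2.
    have e2 : 0 < e / 2 by rewrite divr_gt0.
    by have [r _ /(_ r (leqnn r))] := near_infty_natSinv_lt (PosNum e2); exists r.
  have r2 : 0 < (r.+1%:R^-1 / 2 : R) by rewrite divr_gt0// invr_gt0.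
  have Q (x : R) : exists q : rat, `|x - ratr q| < r.+1%:R^-1 / 2.
    have /rat_in_itvoo[q] : x - r.+1%:R^-1 / 2 < x + r.+1%:R^-1 / 2.
      by rewrite ltrD2l gtrN.
    rewrite in_itv /= => /andP[q1 q2]; exists q.
    by rewrite ltr_distl; apply/andP; split; rewrite ?ltrBlDr// -ltrBlDr.
  pose q x := projT1 (cid (Q x)); have qP x : `|x - ratr (q x)| < r.+1%:R^-1 / 2 := projT2 (cid (Q x)).
  pose p : N.-tuple (rat * rat) * nat :=
    ([tuple (q (complex.Re (w 0 j)), q (complex.Im (w 0 j))) | j < N], r).
  have bw : box p w.
    move=> j; rewrite tnth_mktuple /=; apply: (le_lt_trans (cabs_ReIm _)).
    by rewrite !(cReD, cImD) !(cReN, cImN) /= [ltRHS]splitr ltrD.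
  exists (pickle p) => //; rewrite pickleK; split => // v bv; apply: eO => j.
  rewrite -(subrKA (ratr (tnth p.1 j).1 +i* ratr (tnth p.1 j).2)).
  apply: (le_lt_trans (cabsD _ _)); rewrite [ltRHS]splitr ltrD//; first exact: (lt_trans (bv j)).
  by rewrite cabsB; exact: (lt_trans (bw j)).
apply: bigcupT_measurable => k; case: (unpickle k) => [p|]; last exact: measurable0.
have [h|h] := pselect (box p `<=` O); last first.
  by rewrite [X in measurable X](_ : _ = set0)//; apply/seteqP; split => // t [].
rewrite [X in measurable X](_ : _ = @cvec R N @^-1` box p)//.
by apply/seteqP; split => // t [].
Qed.

Lemma continuous_within_mfun N (D : set 'rV[C]_N) (f : 'rV[C]_N -> R) :
  measurable (@cvec R N @^-1` D) ->
  (forall w, D w -> forall A, nbhs (f w) A -> nbhs (w : rV N) (f @^-1` A)) ->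
  measurable_fun (@cvec R N @^-1` D) (fun t => f (cvec t)).
Proof.
move=> mD cf; apply: (measurability _ (RGenOpens.measurableE R)).
move=> _ [_ [a [b ->] <-]].
(* Since [f] is controlled only on [D], the preimage is replaced by the set of points of which it is
   a neighbourhood: this set is open and coincides with the preimage on [D]. *)
pose O : set 'rV[C]_N := [set w | nbhs (w : rV N) (f @^-1` `]a, b[)].
rewrite (_ : _ `&` _ = @cvec R N @^-1` D `&` @cvec R N @^-1` O); last first.
  apply/seteqP; split => t /= [Dt ft]; split => //; last exact: (nbhs_singleton ft).
  by apply: (cf _ Dt); apply: open_nbhs_nbhs; split => //; exact: interval_open.
apply: measurableI => //; apply: nbhs_measurable => w /nbhs_interior; exact.
Qed.

Lemma holomorphic_cmeas N (D : set 'rV[C]_N) (f : 'rV[C]_N -> C) :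
  measurable (@cvec R N @^-1` D) -> holomorphic D f ->
  measurable_fun (@cvec R N @^-1` D) (fun t => complex.Re (f (cvec t))) /\
  measurable_fun (@cvec R N @^-1` D) (fun t => complex.Im (f (cvec t))).
Proof.
move=> mD hf.
have cf w : D w -> {for (w : rV N), continuous (f : rV N -> Co)}.
  by move=> /hf; exact: differentiable_continuous.
split.
  apply: (continuous_within_mfun (f := fun w => complex.Re (f w)) mD) => w Dw A nA.
  have h := cf w Dw _ (@continuous_Re R (f w) A nA). exact: h.
apply: (continuous_within_mfun (f := fun w => complex.Im (f w)) mD) => w Dw A nA.
have h := cf w Dw _ (@continuous_Im R (f w) A nA). exact: h.
Qed.

End OpenMeasurable.

Section Transfer.
Context {R : realType}.
Local Notation C := R[i].
Local Notation Co := R[i]^o.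
Local Notation RR := (measurableTypeR R).
Local Notation PL := (measurableTypeR R * measurableTypeR R)%type.
Local Notation leb := (@lebesgue_measure R).
Local Notation nu N := (lebesgue_cvec (R := R) N).

Definition CI N (f : 'rV[C]_N -> C) : C := cInt (nu N) setT (fun t => f (cvec t)).

Definition RL1 N (u : 'rV[C]_N -> R) := (nu N).-integrable setT (fun t => (u (cvec t))%:E).

(** Integrability through the modulus, suited to domination arguments; [CL1_cintble] shows it
    equivalent to integrability of both components. *)
Definition CL1 N (f : 'rV[C]_N -> C) :=
  cmeas (fun t => f (@cvec R N t)) /\ (LI (fun w => (cabs (f w))%:E) < +oo)%E.

Lemma RL1P N (u : 'rV[C]_N -> R) :
  RL1 u <-> mfun u /\ (LI (fun w => `|u w|%:E) < +oo)%E.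
Proof.
split=> [/integrableP[/measurable_EFinP mu uoo]|[mu uoo]]; first by [].
by apply/integrableP; split => //; exact/measurable_EFinP.
Qed.

Lemma CL1_cintble N (f : 'rV[C]_N -> C) : CL1 f <-> cintble (nu N) setT (fun t => f (cvec t)).
Proof.
split=> [[[f1 f2] foo]|[h1 h2]].
  split; apply/integrableP; split; [exact/measurable_EFinP| |exact/measurable_EFinP|].
    apply: le_lt_trans foo; apply: ge0_le_integral => //.
    - by apply/measurable_EFinP; exact: measurableT_comp.
    - by apply/measurable_EFinP; exact: cmeas_cabs.
    - by move=> t _; rewrite /= lee_fin; exact: cabs_Re.
  apply: le_lt_trans foo; apply: ge0_le_integral => //.
  - by apply/measurable_EFinP; exact: measurableT_comp.
  - by apply/measurable_EFinP; exact: cmeas_cabs.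
  - by move=> t _; rewrite /= lee_fin; exact: cabs_Im.
have mf : cmeas (fun t => f (@cvec R N t)).
  by split; [have /integrableP[/measurable_EFinP] := h1|have /integrableP[/measurable_EFinP] := h2].
split => //; have /integrableP[_ h] := integrableD measurableT (integrable_abse h1) (integrable_abse h2).
apply: le_lt_trans h; apply: ge0_le_integral => //.
- by move=> t _; rewrite lee_fin cabs_ge0.
- by apply/measurable_EFinP; exact: cmeas_cabs.
- by apply: measurableT_comp => //; apply: emeasurable_funD; apply: measurableT_comp => //;
    apply/measurable_EFinP; [exact: mf.1|exact: mf.2].
- by move=> t _; rewrite gee0_abs ?adde_ge0//= -EFinD lee_fin; exact: cabs_ReIm.
Qed.

Lemma eq_CI N (f g : 'rV[C]_N -> C) : (forall w, f w = g w) -> CI f = CI g.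
Proof. by move=> fg; apply: eq_cInt => t _; rewrite fg. Qed.

Lemma eq_CL1 N (f g : 'rV[C]_N -> C) : (forall w, f w = g w) -> CL1 f -> CL1 g.
Proof. by move=> fg; rewrite (_ : f = g)//; exact/funext. Qed.

Lemma CL1_dom N (f g : 'rV[C]_N -> C) : cmeas (fun t => f (@cvec R N t)) -> CL1 g ->
  (forall w, cabs (f w) <= cabs (g w)) -> CL1 f.
Proof.
move=> mf [mg goo] fg; split => //; apply: le_lt_trans goo; apply: ge0_le_integral => //.
- by move=> t _; rewrite lee_fin cabs_ge0.
- by apply/measurable_EFinP; exact: cmeas_cabs.
- by apply/measurable_EFinP; exact: cmeas_cabs.
- by move=> t _; rewrite lee_fin.
Qed.

(* The change of variables w = T v has real Jacobian J. *)
Record transfer N (T : 'rV[C]_N -> 'rV[C]_N) (J : 'rV[C]_N -> R) : Prop := Transfer {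
  tr_vmeas : vmeas (fun t => T (cvec t));
  tr_mJ : mfun J;
  tr_J0 : forall w, 0 <= J w;
  tr_LI : forall P : 'rV[C]_N -> \bar R, mfun P -> (forall v, 0 <= P v)%E ->
     LI P = LI (fun w => P (T w) * (J w)%:E)%E }.

Section TransferCI.
Variables (N : nat) (T : 'rV[C]_N -> 'rV[C]_N) (J : 'rV[C]_N -> R).
Hypothesis trT : transfer T J.

Lemma transfer_mfun d (V : measurableType d) (P : 'rV[C]_N -> V) : mfun P -> mfun (fun w => P (T w)).
Proof. by move=> mP; exact: (mfun_comp mP (tr_vmeas trT)). Qed.

Lemma transfer_RL1 (u : 'rV[C]_N -> R) : RL1 u -> RL1 (fun w => J w * u (T w)).
Proof.
move=> /RL1P[mu uoo]; apply/RL1P; split.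
  by apply: measurable_funM; [exact: tr_mJ trT|exact: transfer_mfun].
apply: le_lt_trans uoo; rewrite [leRHS](tr_LI trT).
- apply: le_of_eq; apply: eq_LI => w.
  by rewrite normrM (ger0_norm (tr_J0 trT w)) mulrC EFinM.
- by apply/measurable_EFinP; apply: measurableT_comp.
- by [].
Qed.

(** [tr_LI] concerns nonnegative functions, so positive and negative parts are transported
    separately; J >= 0 commutes with taking them. *)
Lemma transfer_RI (u : 'rV[C]_N -> R) : RL1 u ->
  \int[nu N]_(t in setT) u (cvec t) = \int[nu N]_(t in setT) (J (cvec t) * u (T (cvec t))).
Proof.
move=> /RL1P[mu uoo]; rewrite /Rintegral; congr fine.
have mU : mfun (fun w => (u w)%:E) by exact/measurable_EFinP.
rewrite [LHS]integralE [RHS]integralE; congr (_ - _)%E.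
  have mP : mfun (fun w => maxe (u w)%:E 0%E) by apply: measurable_maxe.
  rewrite -[LHS](_ : LI (fun w => maxe (u w)%:E 0%E) = _); last first.
    by apply: eq_integral => t _; rewrite funeposE.
  rewrite (tr_LI trT mP); last by move=> v; rewrite le_max lexx orbT.
  apply: eq_integral => t _; rewrite funeposE EFinM muleC maxe_pMr ?mule0//.
  by rewrite lee_fin (tr_J0 trT).
have mP : mfun (fun w => maxe (- (u w)%:E)%E 0%E).
  by apply: measurable_maxe => //; exact: measurableT_comp.
rewrite -[LHS](_ : LI (fun w => maxe (- (u w)%:E)%E 0%E) = _); last first.
  by apply: eq_integral => t _; rewrite funenegE.
rewrite (tr_LI trT mP); last by move=> v; rewrite le_max lexx orbT.
apply: eq_integral => t _; rewrite funenegE EFinM muleC -muleN maxe_pMr ?mule0//.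
by rewrite lee_fin (tr_J0 trT).
Qed.

Lemma transfer_CI (f : 'rV[C]_N -> C) : CL1 f ->
  CL1 (fun w => (J w)%:C * f (T w)) /\ CI f = CI (fun w => (J w)%:C * f (T w)).
Proof.
move=> /CL1_cintble[f1 f2].
have E1 w : complex.Re ((J w)%:C * f (T w)) = J w * complex.Re (f (T w)).
  by rewrite cReM /= mul0r subr0.
have E2 w : complex.Im ((J w)%:C * f (T w)) = J w * complex.Im (f (T w)).
  by rewrite cImM /= mul0r addr0.
split.
  apply/CL1_cintble; split; [under eq_fun do rewrite E1|under eq_fun do rewrite E2].
    exact: (transfer_RL1 (u := fun w => complex.Re (f w)) f1).
  exact: (transfer_RL1 (u := fun w => complex.Im (f w)) f2).
congr Complex.
  rewrite (transfer_RI (u := fun w => complex.Re (f w)) f1).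
  by apply: eq_Rintegral => t _; rewrite E1.
rewrite (transfer_RI (u := fun w => complex.Im (f w)) f2).
by apply: eq_Rintegral => t _; rewrite E2.
Qed.

End TransferCI.

Section Averaging.
Variables (N : nat) (rho : R -> 'rV[C]_N -> 'rV[C]_N) (b : R).
Hypothesis b0 : 0 <= b.
Hypothesis mrho : vmeas (fun z : N.-tuple PL * RR => rho z.2 (cvec z.1)).
Hypothesis trho : forall x, transfer (rho x) (fun=> 1).

Let I : set RR := `[0, b].

(** Fubini's theorem: for each x in the interval, integration over the space gives the integral of u
    because [rho x] preserves measure, and the interval has length b. *)
Let average_real (u : 'rV[C]_N -> R) : RL1 u ->
  (forall w, leb.-integrable I (fun x => (u (rho x w))%:E)) ->
  RL1 (fun w => \int[leb]_(x in I) u (rho x w)) /\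
  \int[nu N]_(t in setT) (\int[leb]_(x in I) u (rho x (cvec t))) = b * \int[nu N]_(t in setT) u (cvec t).
Proof.
move=> /RL1P[mu uoo] iu.
have mI : measurable I by exact: measurable_itv.
(* The indicator extends the parameter to the whole line, so that the product of the two full
   measures can be used. *)
pose F (z : N.-tuple PL * RR) : \bar R := (\1_I z.2 * u (rho z.2 (cvec z.1)))%:E.
have mF : measurable_fun setT F.
  apply/measurable_EFinP; apply: measurable_funM; last exact: (mfun_comp mu mrho).
  by apply: measurableT_comp; [exact: measurable_indic|exact: measurable_snd].
have indI (x : RR) (y : R) : ((\1_I x * y)%:E = if x \in I then y%:E else 0)%E.
  by rewrite indicE; case: ifP => _; rewrite ?mul1r ?mul0r.
have lebI : (leb I = b%:E)%E.
  by rewrite lebesgue_measure_itv /= lte_fin; case: ltgtP b0 => // [_ _|<- _]; rewrite ?subr0 ?oppr0 ?adde0.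
have K (G : R -> \bar R) : (forall x, G x = G 0)%R ->
   (\int[leb]_x (if x \in I then G x else 0) = G 0%R * b%:E)%E.
  move=> Gc; rewrite -[LHS](_ : \int[leb]_(x in I) (cst (G 0%R)) x = _)%E.
    by rewrite integral_cst//; congr (_ * _)%E; exact: lebI.
  by rewrite integral_mkcond; apply: eq_integral => x _; rewrite patchE (Gc x).
have iF := proj2 (@integrable21ltyP _ _ _ _ R (nu N) leb F mF) _.
have {}iF : (nu N \x leb)%E.-integrable setT F.
  apply: iF.
  rewrite (_ : (fun x => _) = fun x => if x \in I then LI (fun w => `|u w|%:E) else 0%E).
    by rewrite (K (fun=> LI (fun w => `|u w|%:E)))// muleC lte_mul_pinfty.
  apply/funext => x; case: ifPn => xI.
    rewrite (tr_LI (trho x)); [|by apply/measurable_EFinP; apply: measurableT_comp|by []].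
    by apply: eq_integral => t _; rewrite /F indI /= xI mule1.
  under eq_integral do rewrite /F indI /= (negbTE xI) abse0.
  by rewrite integral0.
have FT t : (\int[leb]_x F (t, x) = \int[leb]_(x in I) (u (rho x (cvec t)))%:E)%E.
  by rewrite [RHS]integral_mkcond; apply: eq_integral => x _; rewrite /F indI patchE.
have fT t : ((\int[leb]_(x in I) (u (rho x (cvec t))))%R%:E = \int[leb]_x F (t, x))%E.
  by rewrite FT /Rintegral fineK//; exact: integrable_fin_num.
split.
  have := integrable_fubini_F iF; rewrite /RL1; congr (integrable _ _ _).
  by apply/funext => t; rewrite fT.
rewrite /Rintegral -[LHS]/(fine _).
under eq_integral do rewrite -/(Rintegral _ _ _) fT.
rewrite (integral12_prod_meas1 iF) -(integral21_prod_meas1 iF).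
rewrite (_ : (fun x => _) = fun x => if x \in I then (\int[nu N]_t (u (cvec t))%:E)%E else 0%E).
  rewrite (K (fun=> _))// fineM//=; first by rewrite mulrC.
  apply: integrable_fin_num => //; exact: ((RL1P u).2 (conj mu uoo)).
apply/funext => x; rewrite /fubini_G; case: ifPn => xI.
  under eq_integral do rewrite /F indI /= xI.
  have := transfer_RI (trho x) ((RL1P u).2 (conj mu uoo)).
  under [in X in _ = X]eq_Rintegral do rewrite mul1r.
  rewrite /Rintegral => hfine; have := congr1 EFin hfine; rewrite !fineK//.
    have := transfer_RL1 (trho x) ((RL1P u).2 (conj mu uoo)); rewrite /RL1.
    by under eq_fun do rewrite mul1r; move=> /integrable_fin_num; exact.
  by apply: integrable_fin_num => //; exact: ((RL1P u).2 (conj mu uoo)).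
under eq_integral do rewrite /F indI /= (negbTE xI).
by rewrite integral0.
Qed.

Lemma average_CI (f : 'rV[C]_N -> C) : CL1 f ->
  (forall w, cintble leb I (fun x => f (rho x w))) ->
  CL1 (fun w => sInt 0 b (fun x => f (rho x w))) /\
  CI (fun w => sInt 0 b (fun x => f (rho x w))) = b%:C * CI f.
Proof.
move=> /CL1_cintble[f1 f2] cf.
have [h1 h1'] := average_real (u := fun w => complex.Re (f w)) f1 (fun w => (cf w).1).
have [h2 h2'] := average_real (u := fun w => complex.Im (f w)) f2 (fun w => (cf w).2).
split; first by apply/CL1_cintble; split; [exact: h1|exact: h2].
apply: complex_ext; first by rewrite cReM /= mul0r subr0; exact: h1'.
by rewrite cImM /= mul0r addr0; exact: h2'.
Qed.

End Averaging.
End Transfer.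

(** * Taylor coefficients independent of the circle of integration *)

Section Taylor.
Context {R : realType}.
Local Notation C := R[i].
Local Notation Co := R[i]^o.
Local Notation tau := (pi *+ 2 : R).

Lemma cauchy_has_pseries (f : Co -> Co) (rho x : R) :
  (forall z : Co, cabs z < rho -> differentiable f z) -> expR x < rho ->
  has_pseries (coef f x) (expR x) f.
Proof.
move=> df xr; split; last by move=> t tx; exact: (cauchy_series df xr tx).
move=> r /andP[r0 rx]; eexists => k; apply: le_trans (coef_bound df xr k).
rewrite ler_wpM2l ?cabs_ge0//; apply: lerXn2r; rewrite ?nnegrE ?expR_ge0 ?ltW//.
Qed.

(** The circle of radius exp(-1) is one choice inside the unit disc; by [taylorE] every admissible
    radius yields the same coefficients. *)
Definition taylor (f : Co -> Co) : nat -> C := coef f (-1).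

Lemma expRN1_lt1 : expR (-1) < 1 :> R.
Proof. by rewrite expR_lt1 oppr_lt0. Qed.

Lemma taylorE (f : Co -> Co) (rho x : R) : 1 <= rho ->
  (forall z : Co, cabs z < rho -> differentiable f z) -> expR x < rho ->
  taylor f = coef f x.
Proof.
move=> r1 df xr; have h := cauchy_has_pseries df (lt_le_trans expRN1_lt1 r1).
exact: (has_pseries_unique (expR_gt0 _) (expR_gt0 _) h (cauchy_has_pseries df xr)).
Qed.

Lemma taylor_has_pseries (f : Co -> Co) :
  (forall z : Co, cabs z < 1 -> differentiable f z) -> has_pseries (taylor f) 1 f.
Proof.
move=> df; have K (r : R) : r < 1 -> exists x : R, [/\ r < expR x, expR x < 1 & taylor f = coef f x].
  (* The maximum with 1 / 2 makes [s] positive whatever [r] is, so that exp (ln s) = s. *)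
  move=> r1; pose s := Num.max ((r + 1) / 2) (1 / 2).
  have s1 : s < 1 by rewrite gt_max; apply/andP; split; lra.
  have rs : r < s by rewrite lt_max; apply/orP; left; lra.
  have s0 : 0 < s by rewrite lt_max; apply/orP; right; lra.
  have es : expR (ln s) = s by rewrite lnK.
  exists (ln s); rewrite es; split; [exact: rs|exact: s1|].
  by apply: (taylorE (lexx 1) df); rewrite es.
split=> [r /andP[r0 r1]|t t1].
  have [x [rx x1 ->]] := K r r1.
  by apply: (cauchy_has_pseries df x1).1; rewrite r0.
have [x [tx x1 ->]] := K _ t1; exact: (cauchy_has_pseries df x1).2.
Qed.

Lemma sInt_taylor (f : Co -> Co) (rho : R) k : 1 < rho ->
  (forall z : Co, cabs z < rho -> differentiable f z) ->
  sInt 0 tau (fun t => f (cexp (0 +i* t)) * (cexp (0 +i* t))^-1 ^+ k) = tau%:C * taylor f k.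
Proof.
move=> r1 df; rewrite (taylorE (ltW r1) df (x := 0)) ?expR0// /coef mulrA -rmorphM.
by rewrite mulfV ?mul1r// gt_eqF// pmulrn_lgt0// pi_gt0.
Qed.

Lemma taylor0 (f : Co -> Co) : (forall z : Co, cabs z < 1 -> differentiable f z) ->
  taylor f 0%N = f 0.
Proof. by move=> /taylor_has_pseries h; rewrite -(has_pseries0 _ h). Qed.

(** Uniqueness of coefficients. The case c = 0 is separate because [has_pseries_scale] works on the
    disc of radius 1 / |c|. *)
Lemma taylor_scale (f : Co -> Co) (c : C) k : cabs c < 1 ->
  (forall z : Co, cabs z < 1 -> differentiable f z) ->
  (forall z : Co, cabs z < 1 -> differentiable (fun t : Co => f (c * t) : Co) z) ->
  taylor (fun t => f (c * t)) k = c ^+ k * taylor f k.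
Proof.
move=> c1 df dfc; have [c0|c0] := eqVneq c 0.
  have h := taylor_has_pseries dfc.
  have h0 : has_pseries (fun k => c ^+ k * taylor f k) 1 (fun t => f (c * t)).
    split=> [r /andP[r0 r1]|t t1].
      exists (cabs (f 0)) => -[|j]; rewrite c0.
        by rewrite !expr0 mul1r mulr1 taylor0.
      by rewrite expr0n /= mul0r cabs0 mul0r cabs_ge0.
    apply: cvg_near_cst; exists 1%N => // -[//|j] _ /=; rewrite c0 mul0r.
    rewrite big_ord_recl !expr0 mul1r mulr1 taylor0// big1 ?addr0// => i _.
    by rewrite expr0n /= !mul0r.
  exact: (congr1 (fun a : nat -> C => a k) (has_pseries_unique ltr01 ltr01 h h0)).
have h := taylor_has_pseries dfc.
have h0 := has_pseries_scale c0 (taylor_has_pseries df).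
have ci : 0 < (cabs c)^-1 by rewrite invr_gt0 cabs_gt0.
exact: (congr1 (fun a : nat -> C => a k) (has_pseries_unique ltr01 ci h h0)).
Qed.

End Taylor.

(** * Moments of a holomorphic function on the domain *)

Section Domain.
Context {R : realType}.
Local Notation C := R[i].
Local Notation Co := R[i]^o.
Local Notation RR := (measurableTypeR R).
Local Notation PL := (measurableTypeR R * measurableTypeR R)%type.
Local Notation tau := (pi *+ 2 : R).

Lemma normsqE N (v : 'rV[C]_N) : normsq v = \sum_(j < N) cabs (v 0 j) ^+ 2.
Proof.
elim: N v => [|N IH] v; first by rewrite normsq_nil big_ord0.
rewrite (rV_ccons v) normsq_ccons big_ord_recl ccons0 IH; congr (_ + _).
by apply: eq_bigr => i _; rewrite cconsS.
Qed.

Lemma normsqZ N (a : C) (v : 'rV[C]_N) : normsq (a *: v) = cabs a ^+ 2 * normsq v.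
Proof. by rewrite !normsqE mulr_sumr; apply: eq_bigr => j _; rewrite mxE cabsM exprMn. Qed.

Lemma normsq_delta N (j : 'I_N) : normsq (delta_mx 0 j : 'rV[C]_N) = 1.
Proof. by rewrite /normsq herm_deltar mxE !eqxx. Qed.

Lemma ler_normsq N (v w : 'rV[C]_N) (r : R) : (forall j, cabs (v 0 j) <= r * cabs (w 0 j)) ->
  normsq v <= r ^+ 2 * normsq w.
Proof.
move=> vw; rewrite !normsqE mulr_sumr; apply: ler_sum => j _.
rewrite -exprMn; apply: lerXn2r; rewrite ?nnegrE ?cabs_ge0//.
by apply: le_trans (vw j); exact: cabs_ge0.
Qed.

(** A common phase on the coordinates selected by [S], which will be all but the last one, or all of
    them. *)
Definition rotd N (S : pred 'I_N) (x : R) : 'rV[C]_N := \row_j (if S j then cexp (0 +i* x) else 1).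

Definition rot N (S : pred 'I_N) (x : R) (w : 'rV[C]_N) : 'rV[C]_N := dscale (rotd S x) w.

Lemma cabs_rotd N (S : pred 'I_N) x j : cabs (rotd S x 0 j) = 1.
Proof. by rewrite mxE; case: ifP; rewrite ?cabs1// cabs_cexp expR0. Qed.

Lemma transfer_rot N (S : pred 'I_N) x : transfer (rot S x) (fun=> 1).
Proof.
have mr : vmeas (fun t => rot S x (@cvec R N t)).
  by apply: vmeas_dscale; [exact: vmeas_cst|exact: vmeas_cvec].
split => //; first exact: measurable_cst.
move=> P mP P0; rewrite -[LHS](@LI_dscale _ _ P (rotd S x))//; last first.
  by move=> j; rewrite -cabs_eq0 cabs_rotd oner_eq0.
rewrite big1; last by move=> j _; rewrite cabs_rotd expr1n.
by rewrite mul1e; apply: eq_LI => w; rewrite mule1.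
Qed.

Lemma vmeas_rot N (S : pred 'I_N) :
  vmeas (fun z : N.-tuple PL * RR => rot S z.2 (cvec z.1)).
Proof.
apply: vmeas_dscale; last exact: (vmeas_comp (@vmeas_cvec R N) measurable_fst).
move=> j; case: (boolP (S j)) => Sj.
  under eq_fun do rewrite mxE Sj; apply: cmeas_cexp; split => /=; first exact: measurable_cst.
  exact: measurable_snd.
by under eq_fun do rewrite mxE (negbTE Sj); exact: cmeas_cst.
Qed.

Lemma rsubmx_last n m (t : C) :
  rsubmx (t *: delta_mx 0 (rshift n ord_max) : 'rV[C]_(n + m.+1)) = t *: delta_mx 0 ord_max.
Proof. by apply/rowP => j; rewrite !mxE (inj_eq (@rshift_inj _ _)). Qed.

Lemma lsubmx_last n m (t : C) :
  lsubmx (t *: delta_mx 0 (rshift n ord_max) : 'rV[C]_(n + m.+1)) = 0.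
Proof. by apply/rowP => j; rewrite !mxE eq_lrshift andbF mulr0. Qed.

Section Hartogs.
Variables (n m : nat) (mu : R).
Hypothesis mu0 : 0 < mu.

Definition in_hartogs (w : 'rV[C]_(n + m.+1)) : bool :=
  normsq (rsubmx w) < expR (- mu * normsq (lsubmx w)).

(** Extension by zero makes integrals over the domain into integrals over the whole space, where the
    changes of variables are stated. *)
Definition zero_ext (g : 'rV[C]_(n + m.+1) -> C) w : C := if in_hartogs w then g w else 0.

Let l : 'I_(n + m.+1) := rshift n ord_max.

Lemma inD_le (r : R) (w w' : 'rV[C]_(n + m.+1)) : 0 <= r ->
  normsq (rsubmx w) * r ^+ 2 < expR (- mu * (normsq (lsubmx w) * r ^+ 2)) ->
  (forall j, cabs (w' 0 j) <= r * cabs (w 0 j)) -> in_hartogs w'.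
Proof.
move=> r0 h ww; rewrite /in_hartogs; apply: (@le_lt_trans _ _ (normsq (rsubmx w) * r ^+ 2)).
  by rewrite mulrC; apply: ler_normsq => j; rewrite !mxE; exact: ww.
apply: lt_le_trans h _; rewrite ler_expR !mulNr lerN2 ler_pM2l//.
by rewrite mulrC; apply: ler_normsq => j; rewrite !mxE; exact: ww.
Qed.

(** The strict inequality defining the domain survives a dilation by some r > 1. Slices through w
    are thus holomorphic on a disc strictly larger than the unit disc, and unit circle integrals are
    covered by [sInt_taylor]. *)
Lemma inD_nbhs (w : 'rV[C]_(n + m.+1)) : in_hartogs w -> exists2 r, 1 < r &
  forall w' : 'rV[C]_(n + m.+1), (forall j, cabs (w' 0 j) <= r * cabs (w 0 j)) -> in_hartogs w'.
Proof.
move=> Dw; set A := normsq (rsubmx w); set B := normsq (lsubmx w).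
pose q (r : R) := expR (- mu * (B * r ^+ 2)) - A * r ^+ 2.
have cq : {for 1, continuous q}.
  have c2 : {for (1 : R), continuous (fun r : R => r ^+ 2)} by exact: exprn_continuous.
  have cB : {for (1 : R), continuous (fun r : R => - mu * (B * r ^+ 2))}.
    by apply: cvgMr; apply: cvgMr; exact: c2.
  have cE := continuous_comp cB (@continuous_expR R _).
  by apply: cvgB; [exact: cE|apply: cvgMr; exact: c2].
have q1 : 0 < q 1 by rewrite /q expr1n !mulr1 subr_gt0.
have [d d0 hd] : exists2 d : R, 0 < d & forall r, `|1 - r| < d -> 0 < q r.
  have /nbhs_ballP[d d0 hd] := cq _ (lt_nbhsr q1).
  by exists d => // r rd; exact: hd.
exists (1 + d / 2); first by rewrite ltrDl divr_gt0.
move=> w'; apply: inD_le; first by rewrite addr_ge0 ?divr_ge0 ?(ltW d0).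
rewrite -subr_gt0; apply: hd; rewrite opprD addrA subrr add0r normrN gtr0_norm ?divr_gt0//.
by rewrite ltr_pdivrMr// ltr_pMr// ltr1n.
Qed.

Lemma inD_abs (w w' : 'rV[C]_(n + m.+1)) : (forall j, cabs (w' 0 j) = cabs (w 0 j)) ->
  in_hartogs w' = in_hartogs w.
Proof.
move=> ww; rewrite /in_hartogs !normsqE.
by under eq_bigr do rewrite mxE ww; under [in X in expR X]eq_bigr do rewrite mxE ww;
  under [in RHS]eq_bigr do rewrite mxE; under [in X in _ = (_ < expR X)]eq_bigr do rewrite mxE.
Qed.

Lemma inD_rot S x w : in_hartogs (rot S x w) = in_hartogs w.
Proof. by apply: inD_abs => j; rewrite mxE cabsM cabs_rotd mul1r. Qed.

Lemma inD_last (t : C) : in_hartogs (t *: delta_mx 0 l) = (cabs t < 1).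
Proof.
rewrite /in_hartogs rsubmx_last lsubmx_last normsqZ normsq_delta mulr1 [normsq 0]normsqE big1 ?mulr0 ?expR0; last first.
  by move=> j _; rewrite mxE cabs0 expr0n.
by rewrite expr_lt1 ?cabs_ge0.
Qed.

Lemma cabs_last w : in_hartogs w -> cabs (w 0 l) < 1.
Proof.
move=> /inD_nbhs[r r1 h]; rewrite -inD_last; apply: h => j; rewrite !mxE eqxx /=.
case: eqP => [->|_]; last by rewrite mulr0 cabs0 mulr_ge0 ?cabs_ge0// ltW// (lt_trans ltr01).
by rewrite mulr1 ler_peMl ?cabs_ge0// ltW.
Qed.

Lemma measurable_inD : mfun in_hartogs.
Proof.
apply: measurable_fun_ltr.
  by apply: measurable_normsq; apply: vmeas_rsubmx; exact: vmeas_cvec.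
apply: measurableT_comp; first exact: measurable_expR.
by apply: measurable_funM => //; apply: measurable_normsq; apply: vmeas_lsubmx; exact: vmeas_cvec.
Qed.

End Hartogs.
End Domain.

Section Moments.
Context {R : realType}.
Local Notation C := R[i].
Local Notation Co := R[i]^o.
Local Notation leb := (@lebesgue_measure R).
Local Notation tau := (@pi R *+ 2).

Lemma CI_Z N (c : C) (f : 'rV[C]_N -> C) : CL1 f -> CI (fun w => c * f w) = c * CI f.
Proof. by move=> /CL1_cintble h; exact: (cIntZ measurableT c h). Qed.

Lemma CL1_Z N (c : C) (f : 'rV[C]_N -> C) : CL1 f -> CL1 (fun w => c * f w).
Proof. by move=> /CL1_cintble h; apply/CL1_cintble; exact: (cintbleZ measurableT c h). Qed.

Lemma tau_gt0 : 0 < tau. Proof. by rewrite pmulrn_lgt0// pi_gt0. Qed.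

Lemma tau_neq0 : tau%:C != 0 :> C.
Proof. by rewrite -cabs_gt0 cabs_real normr_gt0 gt_eqF// tau_gt0. Qed.

Lemma cexp_unit (x : R) : cabs (cexp (0 +i* x)) = 1.
Proof. by rewrite cabs_cexp expR0. Qed.

Lemma conj_cexp_unit (x : R) : conjc (cexp (0 +i* x)) = (cexp (0 +i* x))^-1.
Proof.
apply: (mulfI (cexp_neq0 (0 +i* x))); rewrite divff ?cexp_neq0// mulcJ.
by rewrite cexp_unit expr1n.
Qed.

Lemma cintble_arc (F : Co -> Co) : (forall z : Co, cabs z = 1 -> {for z, continuous F}) ->
  cintble leb `[0, tau] (fun x => F (cexp (0 +i* x))).
Proof.
move=> cF; apply: cintble_cont => x _; apply: continuous_arc; apply: cF.
exact: cexp_unit.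
Qed.

Lemma sIntZ (a b : R) (c : C) (f : R -> C) : cintble leb `[a, b] f ->
  sInt a b (fun x => c * f x) = c * sInt a b f.
Proof. by move=> h; apply: cIntZ => //; exact: measurable_itv. Qed.

Variables (n m : nat) (mu : R).
Hypothesis mu0 : 0 < mu.
Local Notation N := (n + m.+1)%N.
Local Notation inD := (@in_hartogs R n m mu).
Local Notation zext := (@zero_ext R n m mu).
Local Notation l := (@rshift n m.+1 ord_max).
Local Notation el := (delta_mx 0 l : 'rV[C]_N).

Lemma zextM (f h : 'rV[C]_N -> C) w : zext (fun w => f w * h w) w = zext f w * h w.
Proof. by rewrite /zext; case: ifP; rewrite ?mul0r. Qed.

Lemma cmeas_zext (f : 'rV[C]_N -> C) : cmeas (fun t => f (cvec t)) ->
  cmeas (fun t => zext f (cvec t)).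
Proof.
move=> [f1 f2]; have mD := @measurable_inD R n m mu; split.
  rewrite (_ : (fun x => _) = fun t => if inD (cvec t) then complex.Re (f (cvec t)) else 0); last first.
    by apply/funext => t; rewrite /zero_ext; case: ifP.
  exact: measurable_fun_ifT.
rewrite (_ : (fun x => _) = fun t => if inD (cvec t) then complex.Im (f (cvec t)) else 0); last first.
  by apply/funext => t; rewrite /zero_ext; case: ifP.
exact: measurable_fun_ifT.
Qed.

Variable g : 'rV[C]_N -> C.
Hypothesis slice : forall (d c : 'rV[C]_N) (z : Co), inD (z *: d + c) ->
  differentiable (fun v : Co => g (v *: d + c) : Co) z.
Hypothesis ig : CL1 (zext g).

Let G (t : Co) : Co := g (t *: el).

Let dG (z : Co) : cabs z < 1 -> differentiable G z.
Proof.
move=> z1; have := @slice el 0 z; rewrite addr0 inD_last => /(_ z1).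
by under eq_fun do rewrite addr0.
Qed.

(** The orbit of w is the unit circle in a complex line whose point at parameter 0 is w_l e_l; the
    mean value property on this line is [mean1]. *)
Let rotE (w : 'rV[C]_N) x : rot (predC1 l) x w = cexp (0 +i* x) *: (w - w 0 l *: el) + w 0 l *: el.
Proof.
apply/rowP => j; rewrite !mxE eqxx /=; case: (eqVneq j l) => [->|jl] /=.
  by rewrite mul1r mulr1 subrr mulr0 add0r.
by rewrite mulr0 subr0 addr0.
Qed.

Let cabs_slice (r : R) (w : 'rV[C]_N) (z : C) j : 1 <= r -> cabs z <= r ->
  cabs ((z *: (w - w 0 l *: el) + w 0 l *: el) 0 j) <= r * cabs (w 0 j).
Proof.
move=> r1 zr; rewrite !mxE eqxx /=; case: (eqVneq j l) => [->|jl] /=.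
  by rewrite mulr1 subrr mulr0 add0r ler_peMl ?cabs_ge0.
by rewrite mulr0 subr0 addr0 cabsM ler_wpM2r ?cabs_ge0.
Qed.

Let slice1 (w : 'rV[C]_N) (z : Co) : Co := g (z *: (w - w 0 l *: el) + w 0 l *: el).

Let dslice1 w : inD w -> exists2 r, 1 < r & forall z : Co, cabs z < r -> differentiable (slice1 w) z.
Proof.
move=> /(inD_nbhs mu0)[r r1 h]; exists r => // z zr; apply: slice; apply: h => j.
by apply: cabs_slice; exact: ltW.
Qed.

Let mean1 w : inD w -> sInt 0 tau (fun x => g (rot (predC1 l) x w)) = tau%:C * G (w 0 l).
Proof.
move=> Dw; have [r r1 dh] := dslice1 Dw.
have := sInt_taylor 0 r1 dh; rewrite taylor0; last first.
  by move=> z z1; apply: dh; exact: lt_trans r1.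
rewrite /slice1 scale0r add0r => <-; congr sInt; apply/funext => x.
by rewrite expr0 mulr1 rotE.
Qed.

Let cmeas_last : cmeas (fun t => @cvec R N t 0 l).
Proof. exact: vmeas_cvec. Qed.

Let u k := zext (fun w => g w * conjc (w 0 l) ^+ k).

Let iu k : CL1 (u k).
Proof.
apply: (CL1_dom _ ig).
  under eq_fun do rewrite /u zextM; apply: cmeasM; first exact: ig.1.
  by apply: cmeasX; apply: cmeas_conj.
move=> w; rewrite /u zextM; rewrite /zext; case: ifP => Dw; last by rewrite mul0r.
rewrite cabsM cabsX cabs_conj ler_piMr ?cabs_ge0// exprn_ile1 ?cabs_ge0// ltW//.
exact: (cabs_last mu0 Dw).
Qed.

Let u2 k := zext (fun w => G (w 0 l) * conjc (w 0 l) ^+ k).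

(* Rotating all coordinates but the last replaces g by its restriction to the
   last axis; rotating all of them then isolates one Taylor coefficient. *)
Let average1 k : CL1 (u2 k) /\ CI (u k) = CI (u2 k).
Proof.
have rl (x : R) w : rot (predC1 l) x w 0 l = w 0 l by rewrite !mxE /= eqxx mul1r.
have ur w : (fun x : R => u k (rot (predC1 l) x w)) =
    (fun x => if inD w then conjc (w 0 l) ^+ k * slice1 w (cexp (0 +i* x)) else 0).
  by apply/funext => x; rewrite /u /zext inD_rot rl rotE mulrC.
have I0 w : inD w -> cintble leb `[0, tau] (fun x => slice1 w (cexp (0 +i* x))).
  move=> Dw; have [r r1 dr] := dslice1 Dw.
  apply: (@cintble_arc (slice1 w)) => z z1; apply: differentiable_continuous.
  by apply: dr; rewrite z1.
have E w : sInt 0 tau (fun x => u k (rot (predC1 l) x w)) = tau%:C * u2 k w.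
  rewrite ur /u2 /zext; case: ifP => Dw; last by rewrite mulr0 /sInt cInt0.
  rewrite mulrA -(mean1 Dw) mulrC (sIntZ _ (I0 w Dw)); congr (_ * _).
  by apply: eq_cInt => x _; rewrite rotE.
have I w : cintble leb `[0, tau] (fun x => u k (rot (predC1 l) x w)).
  rewrite ur; case: (boolP (inD w)) => Dw; last exact: cintble0.
  by apply: cintbleZ => //; exact: I0.
have [h1 h2] := average_CI (@tau_ge0 R) (vmeas_rot (predC1 l)) (transfer_rot (predC1 l)) (iu k) I.
have i2 : CL1 (u2 k).
  apply: eq_CL1 (CL1_Z (tau%:C)^-1 h1) => w.
  by rewrite E mulKf// tau_neq0.
split => //; apply: (mulfI tau_neq0); rewrite -h2 -CI_Z//.
exact: eq_CI.
Qed.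

Let h (c : C) (z : Co) : Co := G (c * z).

Let dh (c : C) : cabs c < 1 -> exists2 r, 1 < r & forall z : Co, cabs z < r -> differentiable (h c) z.
Proof.
move=> c1; have c0 := cabs_ge0 c; have p0 : 0 < 1 + cabs c by rewrite ltr_wpDr.
(* This radius exceeds 1, while its product with |c| stays below 1. *)
exists (2 / (1 + cabs c)); first by rewrite ltr_pdivlMr// mul1r; lra.
move=> z zr; have cz : cabs (c * z) < 1.
  rewrite cabsM; have [->|cn] := eqVneq (cabs c) 0; first by rewrite mul0r.
  have cp : 0 < cabs c by rewrite lt_def cn.
  apply: (@lt_trans _ _ (cabs c * (2 / (1 + cabs c)))); first by rewrite ltr_pM2l.
  by rewrite mulrA ltr_pdivrMr// mul1r; lra.
have dm : differentiable (fun z : Co => c * z : Co) z.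
  by apply: differentiableM; [exact: differentiable_cst|exact: differentiable_idC].
exact: (differentiable_comp dm (dG cz)).
Qed.

Let pw k : 'rV[C]_N -> C := zext (fun w => (cabs (w 0 l) ^+ k.*2)%:C).

(** On the orbit of w the integrand is conj(w_l)^k times G(w_l e^(ix)) e^(-ikx). Its circle integral
    is 2 pi times the k-th Taylor coefficient of z -> G(w_l z), that is w_l^k times that of G. *)
Let average2 k : CI (u2 k) = CI (fun w => taylor G k * pw k w).
Proof.
have rl (x : R) (w : 'rV[C]_N) : rot predT x w 0 l = cexp (0 +i* x) * w 0 l by rewrite !mxE.
have F (x : R) (w : 'rV[C]_N) : G (cexp (0 +i* x) * w 0 l) * conjc (cexp (0 +i* x) * w 0 l) ^+ k =
    conjc (w 0 l) ^+ k * (h (w 0 l) (cexp (0 +i* x)) * (cexp (0 +i* x))^-1 ^+ k).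
  rewrite /h [w 0 l * cexp _]mulrC conjcM conj_cexp_unit exprMn.
  by move: (G _) (_^-1 ^+ k) (conjc _ ^+ k) => a b c; ring.
have I0 w : inD w -> cintble leb `[0, tau] (fun x => h (w 0 l) (cexp (0 +i* x)) * (cexp (0 +i* x))^-1 ^+ k).
  move=> Dw; have [r r1 dr] := dh (cabs_last mu0 Dw).
  apply: (@cintble_arc (fun z : Co => h (w 0 l) z * z^-1 ^+ k : Co)) => z z1.
  apply: differentiable_continuous; apply: differentiableM; first by apply: dr; rewrite z1.
  apply: differentiable_pow; apply: differentiableV; first exact: differentiable_idC.
  by rewrite -cabs_eq0 z1 oner_eq0.
have ur w : (fun x : R => u2 k (rot predT x w)) = (fun x => if inD w then
    conjc (w 0 l) ^+ k * (h (w 0 l) (cexp (0 +i* x)) * (cexp (0 +i* x))^-1 ^+ k) else 0).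
  by apply/funext => x; rewrite /u2 /zext inD_rot rl F.
have E w : sInt 0 tau (fun x => u2 k (rot predT x w)) = tau%:C * (taylor G k * pw k w).
  rewrite ur /pw /zext; case: ifP => Dw; last by rewrite !mulr0 /sInt cInt0.
  have [r r1 dr] := dh (cabs_last mu0 Dw).
  rewrite (sIntZ _ (I0 w Dw)) (sInt_taylor k r1 dr).
  rewrite (taylor_scale k (cabs_last mu0 Dw) dG); last first.
    by move=> z z1; apply: dr; exact: lt_trans r1.
  have -> : (cabs (w 0 l) ^+ k.*2)%:C = w 0 l ^+ k * conjc (w 0 l) ^+ k.
    by rewrite -exprMn mulcJ -mul2n exprM rmorphXn.
  by move: (taylor G k) (w 0 l ^+ k) (conjc _ ^+ k) => a b c; ring.
have I w : cintble leb `[0, tau] (fun x => u2 k (rot predT x w)).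
  rewrite ur; case: (boolP (inD w)) => Dw; last exact: cintble0.
  by apply: cintbleZ => //; exact: I0.
have [h1 h2] := average_CI (@tau_ge0 R) (vmeas_rot predT) (transfer_rot predT) (average1 k).1 I.
have i2 : CL1 (fun w => taylor G k * pw k w).
  apply: eq_CL1 (CL1_Z (tau%:C)^-1 h1) => w.
  by rewrite E mulKf// tau_neq0.
apply: (mulfI tau_neq0); rewrite -h2 -CI_Z//; exact: eq_CI.
Qed.

Lemma LI_hartogs_last k : LI (fun w => (cabs (pw k w))%:E) =
  (pi ^+ N * k`!%:R / (k + m).+1`!%:R / (mu * (k + m).+1%:R) ^+ n)%:E.
Proof.
rewrite -(LI_hartogs_pow n m k mu0); apply: eq_LI => w; rewrite /pw /zext /inD mxE.
case: ifP => _; last by rewrite cabs0 mulr0.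
by rewrite mulr1 cabs_real ger0_norm// exprn_ge0// cabs_ge0.
Qed.

Lemma CL1_last k : CL1 (pw k).
Proof.
split; last by rewrite LI_hartogs_last ltry.
apply: cmeas_zext; apply: cmeas_real; apply: measurable_funX; exact: cmeas_cabs.
Qed.

Lemma CI_last k : CI (pw k) =
  (pi ^+ N * k`!%:R / (k + m).+1`!%:R / (mu * (k + m).+1%:R) ^+ n)%:C.
Proof.
apply: complex_ext => /=.
  rewrite -[RHS]/(fine (EFin _)) -LI_hartogs_last; congr fine; apply: eq_integral => t _.
  by rewrite /pw /zext; case: ifP => _; rewrite ?cabs0// cabs_real ger0_norm// exprn_ge0// cabs_ge0.
rewrite /Rintegral integral0_eq// => t _.
by rewrite /pw /zext; case: ifP.
Qed.

Lemma moment k : CL1 (u k) /\ CI (u k) =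
  taylor G k * (pi ^+ N * k`!%:R / (k + m).+1`!%:R / (mu * (k + m).+1%:R) ^+ n)%:C.
Proof.
split; first exact: iu.
by rewrite (average1 k).2 average2 CI_Z ?CI_last//; exact: CL1_last.
Qed.

End Moments.

(** * The reproducing formula at points of the last axis *)

Section BaseReproducing.
Context {R : realType}.
Local Notation C := R[i].
Local Notation Co := R[i]^o.

(** The error is the tail of the absolute series at radius [r]. Being independent of [t], it allows
    termwise integration against an integrable function. *)
Lemma pseries_uniform (a : nat -> C) (r : R) : pbounded a 1 -> 0 <= r < 1 ->
  exists eps : nat -> R, eps @ \oo --> (0 : R) /\
  forall N t, cabs t <= r -> cabs (psum a t - \sum_(k < N) a k * t ^+ k) <= eps N.
Proof.
move=> ba /andP[r0 r1]; have [K hK] := pbounded_sum ba (introT andP (conj r0 r1)).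
pose u k := cabs (a k) * r ^+ k; have u0 k : 0 <= u k by rewrite mulr_ge0 ?cabs_ge0 ?exprn_ge0.
pose B N := \sum_(k < N) u k.
have cB : cvgn B.
  apply: (@real_series_cvg _ _ K) => N; apply: le_trans (hK N); apply: ler_sum => k _.
  by rewrite ger0_norm.
have ndB : nondecreasing_seq B.
  by apply/nondecreasing_seqP => N; rewrite /B big_ord_recr /= lerDl.
exists (fun N => limn B - B N); split.
  rewrite -(subrr (limn B)); apply: cvgB; [exact: cvg_cst|exact: cB].
move=> N t tr; have t1 : cabs t < 1 by exact: le_lt_trans r1.
have ct := psum_cvg ba t1.
have cs : ((fun M => \sum_(k < M + N) a k * t ^+ k - \sum_(k < N) a k * t ^+ k : Co) : nat -> Co) @ \oo
    --> (psum a t - \sum_(k < N) a k * t ^+ k : Co).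
  have cst : ((fun=> \sum_(k < N) a k * t ^+ k : Co) : nat -> Co) @ \oo --> (\sum_(k < N) a k * t ^+ k : Co).
    exact: cvg_cst.
  have ct' := ct; rewrite -(cvg_shiftn N) in ct'.
  exact: (cvgB ct' cst).
apply: (cvg_cabs_le cs) => M; apply: (@le_trans _ _ (B (M + N)%N - B N)); last first.
  by rewrite lerD2r; exact: nondecreasing_cvgn_le.
rewrite addnC /B !big_split_ord /= [X in cabs X]addrAC subrr add0r [leRHS]addrAC subrr add0r.
apply: le_trans (cabs_sum _ _ _) _; apply: ler_sum => k _.
rewrite cabsM cabsX ler_wpM2l ?cabs_ge0//; apply: lerXn2r; rewrite ?nnegrE ?cabs_ge0//.
Qed.

Lemma cmeas_lim d (T : measurableType d) (F : nat -> T -> C) (f : T -> C) :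
  (forall k, cmeas (F k)) -> (forall x, ((fun k => F k x) : nat -> Co) @ \oo --> (f x : Co)) ->
  cmeas f.
Proof.
move=> mF Ff; split.
  apply: (measurable_fun_cvg (h := fun k x => complex.Re (F k x))); first by move=> k; exact: (mF k).1.
  by move=> x _; exact: (cvg_comp _ _ (Ff x) (@continuous_Re R (f x))).
apply: (measurable_fun_cvg (h := fun k x => complex.Im (F k x))); first by move=> k; exact: (mF k).2.
by move=> x _; exact: (cvg_comp _ _ (Ff x) (@continuous_Im R (f x))).
Qed.

Variables (n m : nat) (mu : R).
Hypothesis mu0 : 0 < mu.
Hypothesis n0 : (0 < n)%N.
Local Notation N := (n + m.+1)%N.
Local Notation inD := (@in_hartogs R n m mu).
Local Notation zext := (@zero_ext R n m mu).
Local Notation l := (@rshift n m.+1 ord_max).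
Local Notation el := (delta_mx 0 l : 'rV[C]_N).

Variable g : 'rV[C]_N -> C.
Hypothesis slice : forall (d c : 'rV[C]_N) (z : Co), inD (z *: d + c) ->
  differentiable (fun v : Co => g (v *: d + c) : Co) z.
Hypothesis ig : CL1 (zext g).

Let G (t : Co) : Co := g (t *: el).

Let dG (z : Co) : cabs z < 1 -> differentiable G z.
Proof.
move=> z1; have := @slice el 0 z; rewrite addr0 inD_last => /(_ z1).
by under eq_fun do rewrite addr0.
Qed.

Let b := @bcoef R n m.+1.

Let c0 : C := (mu ^+ n / pi ^+ N)%:C.

(* The coefficients of the kernel are the inverses of the norms in [moment]. *)
Let coefE k : c0 * b k * (pi ^+ N * k`!%:R / (k + m).+1`!%:R / (mu * (k + m).+1%:R) ^+ n)%:C = 1.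
Proof.
pose q : R := ((k + m.+1) ^_ m.+1)%:R * (k + m.+1)%:R ^+ n.
have nC j : (j%:R : C) = (j%:R : R)%:C by rewrite rmorph_nat.
have -> : b k = q%:C by rewrite /b /bcoef !nC -rmorphXn -rmorphM.
rewrite /c0 -!rmorphM -(rmorph1 (real_complex R)); congr (_%:C).
have f0 j : (j`!%:R : R) != 0 by rewrite pnatr_eq0 -lt0n fact_gt0.
have -> : q = (k + m).+1`!%:R / k`!%:R * (k + m).+1%:R ^+ n.
  rewrite /q addnS; congr (_ * _); apply: (canRL (mulfK (f0 k))); rewrite -natrM.
  by have := ffact_fact (leq_addl k m.+1); rewrite addnK addnS => ->.
rewrite exprMn; have p0 : pi ^+ N != 0 :> R by rewrite expf_neq0// gt_eqF// pi_gt0.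
have mn : mu ^+ n != 0 by rewrite expf_neq0// gt_eqF.
have kn : ((k + m).+1%:R : R) ^+ n != 0 by rewrite expf_neq0// pnatr_eq0.
move: (f0 k) (f0 (k + m).+1); move: (k`!%:R : R) ((k + m).+1`!%:R : R) (pi ^+ N) (mu ^+ n) ((k + m).+1%:R ^+ n) p0 mn kn.
by move=> x y p u v p0 u0 v0 x0 y0; field; rewrite p0 u0 v0 x0 y0.
Qed.

Lemma base_reproducing (s : C) : cabs s < 1 ->
  g (s *: el) = CI (zext (fun w => g w * (c0 * psum b (s * conjc (w 0 l))))).
Proof.
move=> s1; have pb : pbounded b 1 := (has_pseries_bcoef m.+1 n0).1.
have [eps [eps0 heps]] := pseries_uniform pb (introT andP (conj (cabs_ge0 s) s1)).
have sl w : inD w -> cabs (s * conjc (w 0 l)) <= cabs s.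
  by move=> /(cabs_last mu0)/ltW wl; rewrite cabsM cabs_conj ler_piMr ?cabs_ge0.
pose S M (w : 'rV[C]_N) : C := c0 * \sum_(k < M) b k * (s * conjc (w 0 l)) ^+ k.
pose T (w : 'rV[C]_N) : C := c0 * psum b (s * conjc (w 0 l)).
have iS M : CL1 (zext (fun w => g w * S M w)) /\
    CI (zext (fun w => g w * S M w)) = \sum_(k < M) taylor G k * s ^+ k.
  have E w : zext (fun w => g w * S M w) w =
      \sum_(k < M) (c0 * b k * s ^+ k) * zext (fun w => g w * conjc (w 0 l) ^+ k) w.
    rewrite /zero_ext; case: ifP => _; last by rewrite big1// => k _; rewrite mulr0.
    rewrite /S mulrA mulr_sumr; apply: eq_bigr => k _; rewrite exprMn.
    by move: (g w) (b k) (s ^+ k) (_ ^+ k) => x y z t; ring.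
  have hk k : CL1 (fun w => (c0 * b k * s ^+ k) * zext (fun w => g w * conjc (w 0 l) ^+ k) w).
    by apply: CL1_Z; exact: (moment mu0 slice ig k).1.
  split.
    apply: (eq_CL1 (fun w => esym (E w))); apply/CL1_cintble.
    exact: (@cintble_sum _ _ R (lebesgue_cvec N) setT measurableT M _ (fun k _ => (CL1_cintble _).1 (hk k))).
  rewrite (eq_CI E).
  rewrite [LHS](@cInt_sum _ _ R (lebesgue_cvec N) setT measurableT M _ (fun k _ => (CL1_cintble _).1 (hk k))).
  apply: eq_bigr => k _; have := CI_Z (c0 * b k * s ^+ k) (moment mu0 slice ig k).1; rewrite {1}/CI => ->.
  rewrite (moment mu0 slice ig k).2 -[RHS]mulr1 -(coefE k).
  by move: (taylor _ k) (s ^+ k) (b k) (_%:C) => x y z t; ring.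
have TS M w : cabs (zext (fun w => g w * T w) w - zext (fun w => g w * S M w) w) <=
    cabs c0 * eps M * cabs (zext g w).
  rewrite /zero_ext; case: ifP => Dw; last by rewrite subrr cabs0 mulr0.
  rewrite -mulrBr /T /S -mulrBr !cabsM mulrC ler_wpM2r ?cabs_ge0//.
  by rewrite ler_wpM2l ?cabs_ge0//; apply: heps; exact: sl.
have ig' M : CL1 (fun w => (cabs c0 * eps M)%:C * zext g w) by exact: CL1_Z.
have lim0 : (fun M => cabs c0 * eps M) @ \oo --> (0 : R).
  by rewrite -(mulr0 (cabs c0)); apply: cvgMr.
have iT : CL1 (zext (fun w => g w * T w)).
  (* The partial sum with no terms is zero, so [TS] at M = 0 bounds the full integrand by a multiple
     of |g|. *)
  have S0 w : zext (fun w => g w * S 0%N w) w = 0.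
    by rewrite /zero_ext; case: ifP => // _; rewrite /S big_ord0 !mulr0.
  apply: (CL1_dom _ (ig' 0%N)); last first.
    move=> w; have := TS 0%N w; rewrite S0 subr0 => /le_trans; apply.
    by rewrite cabsM cabs_real ler_wpM2r ?cabs_ge0// ler_norm.
  apply: (cmeas_lim (F := fun M t => zext (fun w => g w * S M w) (cvec t))).
    by move=> M; exact: (iS M).1.1.
  move=> t; apply/cvg_cabs0P.
  have z0 : (fun M => cabs c0 * eps M * cabs (zext g (cvec t))) @ \oo --> (0 : R).
    by rewrite -(mul0r (cabs (zext g (cvec t)))); apply: cvgMl.
  apply: squeeze_cvgr (cvg_cst 0) z0; apply: nearW => M; rewrite cabs_ge0 /=.
  by rewrite cabsB; exact: TS.
have cT : ((fun M => \sum_(k < M) taylor G k * s ^+ k) : nat -> Co) @ \oo --> (CI (zext (fun w => g w * T w)) : Co).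
  pose J := \int[lebesgue_cvec N]_(t in setT) cabs (zext g (cvec t)).
  apply/cvg_cabs0P.
  have z0 : (fun M => 2 * (cabs c0 * eps M * J)) @ \oo --> (0 : R).
    by rewrite -(mulr0 2) -(mul0r J); apply: cvgMr; apply: cvgMl.
  apply: squeeze_cvgr (cvg_cst 0) z0; apply: nearW => M; rewrite cabs_ge0 /= cabsB.
  have iJ : (lebesgue_cvec N).-integrable setT (EFin \o (fun t => cabs (zext g (cvec t)))).
    apply/integrableP; split; first by apply/measurable_EFinP; apply: cmeas_cabs; exact: ig.1.
    apply: le_lt_trans ig.2; apply: le_of_eq.
    by apply: eq_integral => t _; rewrite gee0_abs// lee_fin cabs_ge0.
  rewrite -(iS M).2 -[X in cabs X](_ : CI (fun w => zext (fun w => g w * T w) w - zext (fun w => g w * S M w) w) = _); last first.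
    apply: (cIntB measurableT); apply/CL1_cintble; [exact: iT|exact: (iS M).1].
  rewrite /J -RintegralZl//; apply: (cInt_bound measurableT).
  - apply: (cintbleB measurableT); apply/CL1_cintble; [exact: iT|exact: (iS M).1].
  - exact: (integrableZl measurableT (cabs c0 * eps M) iJ).
  - by move=> t _; exact: TS.
exact: (cvg_unique (@norm_hausdorff _ _) ((taylor_has_pseries dG).2 s s1) cT).
Qed.

End BaseReproducing.

(** * Automorphisms and the kernel *)

Section Automorphism.
Context {R : realType}.
Local Notation C := R[i].
Local Notation Co := R[i]^o.
Local Notation PL := (measurableTypeR R * measurableTypeR R)%type.
Variables (n m : nat) (mu : R).
Hypothesis mu0 : 0 < mu.
Local Notation N := (n + m.+1)%N.
Local Notation inD := (@in_hartogs R n m mu).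
Local Notation zext := (@zero_ext R n m mu).
Variables (a : 'rV[C]_n) (L : 'rV[C]_m.+1 -> 'rV[C]_m.+1).
Hypothesis iL : isometry L.

(** Its squared modulus is exp(- mu (|z + a|^2 - |z|^2)), the ratio of the squared radii of the
    fibres over z + a and z. *)
Definition hartogs_factor (z : 'rV[C]_n) : C :=
  cexp (- mu%:C * herm z a - (mu / 2 * normsq a)%:C).

Definition hartogs_aut (w : 'rV[C]_N) : 'rV[C]_N :=
  row_mx (lsubmx w + a) (hartogs_factor (lsubmx w) *: L (rsubmx w)).

(** The differential is block triangular with complex determinant factor^(m+1) det L; its squared
    modulus is the real Jacobian, as L is unitary. *)
Definition hartogs_jac (w : 'rV[C]_N) : R := cabs (hartogs_factor (lsubmx w)) ^+ (m.+1).*2.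

Lemma aut_factor_neq0 z : hartogs_factor z != 0. Proof. exact: cexp_neq0. Qed.

Lemma normsqD k (u v : 'rV[C]_k) : normsq (u + v) = normsq u + 2 * complex.Re (herm u v) + normsq v.
Proof.
rewrite /normsq !(hermDl, hermDr) !cReD (hermC v u) cReJ; ring.
Qed.

Lemma inD_aut w : inD (hartogs_aut w) = inD w.
Proof.
rewrite /in_hartogs /hartogs_aut row_mxKl row_mxKr normsqZ normsqD /hartogs_factor cabs_cexp.
have -> : normsq (L (rsubmx w)) = normsq (rsubmx w) by rewrite /normsq (iso_herm iL).
set z := lsubmx w; set A := normsq z; set B := normsq a.
have -> : complex.Re (- mu%:C * herm z a - (mu / 2 * B)%:C) = - mu * complex.Re (herm z a) - mu / 2 * B.
  by rewrite cReD [X in X + _]cReM cReN /= oppr0 mul0r subr0.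
set h := complex.Re _; rewrite -expRM_natl mulrC -ltr_pdivlMr ?expR_gt0// -expRN -expRD.
by congr (_ < expR _); field.
Qed.

Lemma cmeas_aut_factor d (T : measurableType d) (f : T -> 'rV[C]_n) : vmeas f ->
  cmeas (fun x => hartogs_factor (f x)).
Proof.
move=> mf; apply: cmeas_cexp; apply: cmeasD; last exact: cmeas_cst.
by apply: cmeasM; [exact: cmeas_cst|apply: cmeas_herm => //; exact: vmeas_cst].
Qed.

Lemma vmeas_isometry d (T : measurableType d) (f : T -> 'rV[C]_m.+1) : vmeas f ->
  vmeas (fun x => L (f x)).
Proof.
move=> mf j; have := cmeas_comp (iso_vmeas iL j) (measurable_untup mf).
by under eq_fun do rewrite untupK.
Qed.

Lemma vmeas_aut : vmeas (fun t => hartogs_aut (cvec t)).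
Proof.
have ml := vmeas_lsubmx (@vmeas_cvec R N).
apply: vmeas_row_mx; first by apply: vmeasD => //; exact: vmeas_cst.
apply: vmeasZ; first exact: cmeas_aut_factor.
by apply: vmeas_isometry; exact: vmeas_rsubmx (@vmeas_cvec R N).
Qed.

Lemma aut_jac_ge0 w : 0 <= hartogs_jac w. Proof. by rewrite exprn_ge0// cabs_ge0. Qed.

Lemma measurable_aut_jac : mfun hartogs_jac.
Proof.
apply: measurable_funX; apply: cmeas_cabs; apply: cmeas_aut_factor.
exact: vmeas_lsubmx (@vmeas_cvec R N).
Qed.

Lemma mfun_row_mx (P : 'rV[C]_N -> \bar R) z : mfun P -> mfun (fun ze : 'rV[C]_m.+1 => P (row_mx z ze)).
Proof.
move=> mP; apply: (mfun_comp mP); apply: vmeas_row_mx; first exact: vmeas_cst.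
exact: vmeas_cvec.
Qed.

(** By Tonelli's theorem it suffices to translate z and, for fixed z, to apply a unitary map and a
    scalar dilation to zeta. *)
Lemma transfer_aut : transfer hartogs_aut hartogs_jac.
Proof.
split; [exact: vmeas_aut|exact: measurable_aut_jac|exact: aut_jac_ge0|].
move=> P mP P0.
have mL : mfun (fun z : 'rV[C]_n => LI (fun ze => P (row_mx z ze))).
  apply: (measurable_LI_param (Q := fun t ze => P (row_mx (cvec t) ze))) => [|t v]; last exact: P0.
  apply: (mfun_comp mP); apply: vmeas_row_mx.
    exact: (vmeas_comp (@vmeas_cvec R n) measurable_fst).
  exact: (vmeas_comp (@vmeas_cvec R m.+1) measurable_snd).
rewrite (LI_cat mP P0) -(LI_translate a mL (fun z => LI_ge0 (fun _ => P0 _))).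
rewrite [RHS]LI_cat; first last.
- by move=> w; rewrite mule_ge0// lee_fin aut_jac_ge0.
- apply: emeasurable_funM; first exact: (mfun_comp mP vmeas_aut).
  by apply/measurable_EFinP; exact: measurable_aut_jac.
apply: eq_LI => z.
pose d : 'rV[C]_m.+1 := \row_j hartogs_factor z.
have dE v : dscale d v = hartogs_factor z *: v by apply/rowP => j; rewrite !mxE.
have mPz := mfun_row_mx (z + a) mP.
rewrite -(LI_dscale (d := d) _ mPz); [|by move=> j; rewrite mxE; exact: aut_factor_neq0|by move=> v; exact: P0].
have mPd : mfun (fun v => P (row_mx (z + a) (dscale d v))).
  by apply: (mfun_comp mPz); apply: vmeas_dscale; [exact: vmeas_cst|exact: vmeas_cvec].
rewrite -(iso_LI iL mPd (fun v => P0 _)).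
have -> : \prod_(j < m.+1) cabs (d 0 j) ^+ 2 = cabs (hartogs_factor z) ^+ (m.+1).*2.
  under eq_bigr do rewrite mxE; rewrite prodr_const card_ord -exprM mul2n.
  by [].
rewrite /LI -ge0_integralZl//=.
- apply: eq_integral => t _; rewrite /hartogs_aut /hartogs_jac row_mxKl row_mxKr dE muleC.
  by [].
- exact: (mfun_iso iL mPd).
- by rewrite lee_fin exprn_ge0// cabs_ge0.
Qed.

End Automorphism.

Section Pullback.
Context {R : realType}.
Local Notation C := R[i].
Local Notation Co := R[i]^o.
Variables (n m : nat) (mu : R).
Hypothesis mu0 : 0 < mu.
Local Notation N := (n + m.+1)%N.
Local Notation rV := ('rV[C]_N : normedModType C).
Local Notation inD := (@in_hartogs R n m mu).
Local Notation zext := (@zero_ext R n m mu).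
Local Notation D := (fock_bargmann_hartogs n m.+1 mu).

Lemma differentiable_affC (c e : C) (v : Co) : differentiable (fun v : Co => v * c + e : Co) v.
Proof.
apply: differentiableD; last exact: differentiable_cst.
by apply: differentiableM; [exact: differentiable_idC|exact: differentiable_cst].
Qed.

Lemma differentiable_scalevec (k : Co -> Co) (u : 'rV[C]_N) (v : Co) : differentiable k v ->
  differentiable (fun v : Co => k v *: u : rV) v.
Proof. move=> dk; exact: (differentiableZl (u : rV) dk). Qed.

Variables (a : 'rV[C]_n) (L : 'rV[C]_m.+1 -> 'rV[C]_m.+1).
Hypothesis iL : isometry L.
Local Notation aut := (hartogs_aut mu a L).
Local Notation aut_factor := (hartogs_factor mu a).

Lemma differentiable_aut_factor (d c : 'rV[C]_n) (v : Co) :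
  differentiable (fun v : Co => aut_factor (v *: d + c) : Co) v.
Proof.
have E : (fun v : Co => aut_factor (v *: d + c) : Co) =
    (fun v : Co => cexp (v * (- mu%:C * herm d a) + (- mu%:C * herm c a - (mu / 2 * normsq a)%:C)) : Co).
  by apply/funext => u; rewrite /hartogs_factor hermDl hermZl; congr cexp; ring.
rewrite E; exact: (differentiable_comp (differentiable_affC _ _ v) (@differentiable_cexp R _)).
Qed.

(** Along a complex line the automorphism is a sum of fixed vectors with scalar coefficients, which
    reduces its differentiability to one variable. *)
Lemma aut_line (d c : 'rV[C]_N) (v : C) : aut (v *: d + c) =
  v *: row_mx (lsubmx d) 0 + row_mx (lsubmx c + a) 0 +
  ((aut_factor (v *: lsubmx d + lsubmx c) * v) *: row_mx 0 (L (rsubmx d)) +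
   aut_factor (v *: lsubmx d + lsubmx c) *: row_mx 0 (L (rsubmx c))).
Proof.
have El : lsubmx (v *: d + c) = v *: lsubmx d + lsubmx c by apply/rowP => j; rewrite !mxE.
have Er : rsubmx (v *: d + c) = v *: rsubmx d + rsubmx c by apply/rowP => j; rewrite !mxE.
rewrite /hartogs_aut El Er (isoP iL) !scale_row_mx !add_row_mx !scaler0 !addr0 !add0r addrA.
by rewrite scalerDr scalerA.
Qed.

Lemma differentiable_aut_line (d c : 'rV[C]_N) (v : Co) :
  differentiable (fun v : Co => aut (v *: d + c) : rV) v.
Proof.
under eq_fun do rewrite aut_line.
have dc := differentiable_aut_factor (lsubmx d) (lsubmx c) v.
apply: differentiableD.
  apply: differentiableD; last exact: differentiable_cst.
  by apply: differentiable_scalevec; exact: differentiable_idC.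
apply: differentiableD; apply: differentiable_scalevec => //.
by apply: differentiableM => //; exact: differentiable_idC.
Qed.

Variable f : 'rV[C]_N -> C.
Hypothesis hf : holomorphic D f.

(** The weight is the complex Jacobian determinant up to the unimodular constant det L, so that the
    map from f to its pull-back preserves square integrability. *)
Definition pullback (w : 'rV[C]_N) : C := f (aut w) * aut_factor (lsubmx w) ^+ m.+1.

Lemma pullback_slice (d c : 'rV[C]_N) (z : Co) : inD (z *: d + c) ->
  differentiable (fun v : Co => pullback (v *: d + c) : Co) z.
Proof.
move=> Dz; rewrite /pullback; apply: differentiableM.
  apply: (differentiable_comp (differentiable_aut_line d c z)); apply: hf.
  by rewrite /fock_bargmann_hartogs /= -/(in_hartogs mu _) inD_aut.
apply: differentiable_pow.
have El v : lsubmx (v *: d + c) = v *: lsubmx d + lsubmx c by apply/rowP => j; rewrite !mxE.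
under eq_fun do rewrite El; exact: differentiable_aut_factor.
Qed.

End Pullback.

(** * The candidate kernel and its behaviour under automorphisms *)

Section KernelDefinition.
Context {R : realType}.
Local Notation C := R[i].
Local Notation Co := R[i]^o.
Variables (n m : nat) (mu : R).
Hypothesis mu0 : 0 < mu.
Hypothesis n0 : (0 < n)%N.
Local Notation N := (n + m.+1)%N.
Local Notation inD := (@in_hartogs R n m mu).
Local Notation zext := (@zero_ext R n m mu).
Local Notation D := (fock_bargmann_hartogs n m.+1 mu).
Local Notation l := (@rshift n m.+1 ord_max).
Local Notation el := (delta_mx 0 l : 'rV[C]_N).

Lemma measurable_D : measurable (@cvec R N @^-1` D).
Proof.
have /(_ measurableT [set true]) := @measurable_inD R n m mu.
by rewrite setTI; exact.
Qed.

Lemma zext_restrict (h : 'rV[C]_N -> C) (q : C -> R) : q 0 = 0 ->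
  (fun t => q (zext h (cvec t))) = (fun t => q (h (@cvec R N t))) \_ (@cvec R N @^-1` D).
Proof.
move=> q0; apply/funext => t; rewrite patchE /zero_ext.
have -> : (t \in @cvec R N @^-1` D) = inD (cvec t) by apply/idP/idP; rewrite inE.
by case: ifP.
Qed.

Lemma cintegral_zext (h : 'rV[C]_N -> C) : cintegral D h = CI (zext h).
Proof.
congr Complex; rewrite /Rintegral [in LHS]integral_mkcond; congr fine; apply: eq_integral => t _.
  have := congr1 (fun F => F t) (@zext_restrict h (@complex.Re R) erefl) => /= ->.
  by rewrite !patchE; case: ifP.
have := congr1 (fun F => F t) (@zext_restrict h (@complex.Im R) erefl) => /= ->.
by rewrite !patchE; case: ifP.
Qed.

Lemma holomorphic_zext (f : 'rV[C]_N -> C) : holomorphic D f -> cmeas (fun t => zext f (cvec t)).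
Proof.
move=> /(holomorphic_cmeas measurable_D)[h1 h2]; split.
  rewrite (@zext_restrict f (@complex.Re R) erefl).
  by apply/(measurable_restrictT _ measurable_D).
rewrite (@zext_restrict f (@complex.Im R) erefl).
by apply/(measurable_restrictT _ measurable_D).
Qed.

Lemma square_integrableP (f : 'rV[C]_N -> C) : cmeas (fun t => zext f (cvec t)) ->
  square_integrable D f <-> (LI (fun w => (cabs (zext f w) ^+ 2)%:E) < +oo)%E.
Proof.
move=> mf; rewrite /square_integrable (integrable_mkcond _ measurable_D).
have E : (fun t => (complex.Re (f (cvec t) * (f (cvec t))^*)%R)%:E) \_ (@cvec R N @^-1` D) =
    (fun t => (cabs (zext f (@cvec R N t)) ^+ 2)%:E).
  apply/funext => t; rewrite patchE /zero_ext.
  have -> : (t \in @cvec R N @^-1` D) = inD (cvec t) by apply/idP/idP; rewrite inE.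
  case: ifP => _; last by rewrite cabs0 expr0n.
  by rewrite -[f _ * _]/(f (cvec t) * conjc (f (cvec t))) mulcJ.
rewrite E; split => [/integrableP[_]|h].
  apply: le_lt_trans; apply: le_of_eq.
  by apply: eq_integral => t _; rewrite gee0_abs// lee_fin exprn_ge0 ?cabs_ge0.
apply/integrableP; split.
  by apply/measurable_EFinP; apply: measurable_funX; exact: cmeas_cabs.
apply: le_lt_trans h; apply: le_of_eq.
by apply: eq_integral => t _; rewrite gee0_abs// lee_fin exprn_ge0 ?cabs_ge0.
Qed.

Definition one_D : 'rV[C]_N -> C := zext (fun=> 1).

(** The volume of the domain is the squared norm of the monomial with k = 0. Its finiteness makes
    square integrable functions integrable, see [CL1_square]. *)
Lemma CL1_one : CL1 one_D.
Proof.
apply: eq_CL1 (CL1_last n m mu0 0%N) => w.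
by rewrite /one_D /zero_ext; case: ifP.
Qed.

Lemma CL1_mul (f g : 'rV[C]_N -> C) :
  cmeas (fun t => zext f (cvec t)) -> cmeas (fun t => zext g (cvec t)) ->
  (LI (fun w => (cabs (zext f w) ^+ 2)%:E) < +oo)%E ->
  (LI (fun w => (cabs (zext g w) ^+ 2)%:E) < +oo)%E -> CL1 (zext (fun w => f w * g w)).
Proof.
move=> mf mg foo goo.
have E w : zext (fun w => f w * g w) w = zext f w * zext g w.
  by rewrite /zero_ext; case: ifP; rewrite ?mul0r.
have m1 : mfun (fun w => (cabs (zext f w) ^+ 2)%:E).
  by apply/measurable_EFinP; apply: measurable_funX; exact: cmeas_cabs.
have m2 : mfun (fun w => (cabs (zext g w) ^+ 2)%:E).
  by apply/measurable_EFinP; apply: measurable_funX; exact: cmeas_cabs.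
have mfg : cmeas (fun t => zext (fun w => f w * g w) (cvec t)).
  by under eq_fun do rewrite E; exact: cmeasM.
split => //.
apply: (@le_lt_trans _ _ (LI (fun w => (cabs (zext f w) ^+ 2)%:E) + LI (fun w => (cabs (zext g w) ^+ 2)%:E))%E).
  rewrite /LI -ge0_integralD//; first apply: ge0_le_integral => //.
  - by move=> t _; rewrite lee_fin cabs_ge0.
  - by apply/measurable_EFinP; exact: cmeas_cabs.
  - exact: emeasurable_funD.
  (* For x, y >= 0 the product x y is at most x^2 + y^2, which replaces the inequality of Cauchy and
     Schwarz. *)
  - move=> t _; rewrite -EFinD lee_fin E cabsM.
    set x := cabs _; set y := cabs (zext g _); have := sqr_ge0 (x - y).
    have := sqr_ge0 (x + y); nra.
  - by move=> t _; rewrite lee_fin sqr_ge0.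
  - by move=> t _; rewrite lee_fin sqr_ge0.
by rewrite lte_add_pinfty.
Qed.

Lemma LI_one_sq : (LI (fun w => (cabs (one_D w) ^+ 2)%:E) < +oo)%E.
Proof.
apply: le_lt_trans CL1_one.2; apply: le_of_eq; apply: eq_LI => w.
by rewrite /one_D /zero_ext; case: ifP => _; rewrite ?cabs1 ?cabs0 ?expr1n ?expr0n.
Qed.

Lemma CL1_square (g : 'rV[C]_N -> C) : cmeas (fun t => zext g (cvec t)) ->
  (LI (fun w => (cabs (zext g w) ^+ 2)%:E) < +oo)%E -> CL1 (zext g).
Proof.
move=> mg goo; apply: eq_CL1 (CL1_mul CL1_one.1 mg LI_one_sq goo) => w.
by rewrite /zero_ext; case: ifP; rewrite ?mul1r.
Qed.

Section Pulled.
Variables (a : 'rV[C]_n) (L : 'rV[C]_m.+1 -> 'rV[C]_m.+1).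
Hypothesis iL : isometry L.
Local Notation aut := (hartogs_aut mu a L).
Local Notation aut_factor := (hartogs_factor mu a).
Local Notation aut_jac := (@hartogs_jac R n m mu a).

Lemma zext_pullback f w : zext (pullback mu a L f) w = zext f (aut w) * aut_factor (lsubmx w) ^+ m.+1.
Proof. by rewrite /zero_ext inD_aut// /pullback; case: ifP; rewrite ?mul0r. Qed.

Lemma CL1_pullback f : bergman_space D f -> CL1 (zext (pullback mu a L f)).
Proof.
move=> [hf sf]; have mf := holomorphic_zext hf.
have tr := transfer_aut mu a iL.
have mg : cmeas (fun t => zext (pullback mu a L f) (cvec t)).
  under eq_fun do rewrite zext_pullback; apply: cmeasM.
    have := cmeas_comp mf (measurable_untup (vmeas_aut mu a iL)).
    by under eq_fun do rewrite untupK.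
  by apply: cmeasX; apply: cmeas_aut_factor; exact: vmeas_lsubmx (@vmeas_cvec R N).
apply: CL1_square => //; move/(square_integrableP mf) : sf.
rewrite (tr_LI tr); [|by apply/measurable_EFinP; apply: measurable_funX; exact: cmeas_cabs|
  by move=> v; rewrite lee_fin sqr_ge0].
apply: le_lt_trans; apply: le_of_eq; apply: eq_LI => w.
by rewrite zext_pullback cabsM cabsX exprMn -exprM muln2 EFinM.
Qed.

End Pulled.

Definition hartogs_kernel (p w : 'rV[C]_N) : C :=
  (mu ^+ n / pi ^+ N)%:C * cexp (mu%:C * herm (lsubmx p) (lsubmx w)) ^+ m.+1 *
  psum (@bcoef R n m.+1) (cexp (mu%:C * herm (lsubmx p) (lsubmx w)) * herm (rsubmx p) (rsubmx w)).

(** The transformation rule of Bergman kernels. The number exp(mu <a, z + a>) is the inverse of the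
    product of the factor at 0 and the conjugate factor at z, and these two cancel in the argument
    of the series. *)
Lemma hartogs_kernel_aut a L s w : isometry L ->
  hartogs_kernel (hartogs_aut mu a L (s *: el)) (hartogs_aut mu a L w) =
  (conjc (hartogs_factor mu a (lsubmx w)) ^+ m.+1)^-1 * (hartogs_factor mu a 0 ^+ m.+1)^-1 *
  ((mu ^+ n / pi ^+ N)%:C * psum (@bcoef R n m.+1) (s * conjc (w 0 l))).
Proof.
move=> iL.
rewrite /hartogs_kernel /hartogs_aut !row_mxKl !row_mxKr lsubmx_last rsubmx_last add0r.
set z := lsubmx w; set c := hartogs_factor mu a z; set c1 := hartogs_factor mu a 0.
have E : cexp (mu%:C * herm a (z + a)) = (conjc c)^-1 * c1^-1.
  rewrite /c /c1 /hartogs_factor conj_cexp -!cexpN -cexpD; congr cexp.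
  rewrite conjcB conjcM conjcN !conjc_real -hermC hermDr !herm_normsq.
  have -> : herm 0 a = 0 by rewrite hermE big1// => j _; rewrite mxE mul0r.
  have -> : (mu / 2 * normsq a)%:C = mu%:C * (normsq a)%:C / 2.
    by rewrite -!rmorphM; apply: (canRL (mulfK _)); rewrite ?pnatr_eq0// -(rmorph_nat (real_complex R) 2) -rmorphM; congr (_%:C); field.
  by field.
have c0 : conjc c != 0 by rewrite conjc_eq0; exact: aut_factor_neq0.
have c10 : c1 != 0 := aut_factor_neq0 mu a 0.
rewrite E hermZl hermZr (iso_herm iL) hermZl herm_deltal mxE.
have -> : (conjc c)^-1 * c1^-1 * (c1 * (conjc c * (s * conjc (w 0 l)))) = s * conjc (w 0 l).
  by field; rewrite c0 c10.
rewrite exprMn !exprVn; move: (psum _ _) (_^-1) (_^-1) (_%:C) => x y u v; ring.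
Qed.

(** Translation by the z-part of p, with [L] aimed at the zeta-part divided by the factor at the
    origin. *)
Lemma point_aut (p : 'rV[C]_N) : exists L s, isometry L /\ hartogs_aut mu (lsubmx p) L (s *: el) = p.
Proof.
set c1 := hartogs_factor mu (lsubmx p) 0.
have [L [s [iL Ls]]] := isometry_to_last (c1^-1 *: rsubmx p).
exists L, s; split => //.
rewrite /hartogs_aut lsubmx_last rsubmx_last Ls add0r -/c1 scalerA divff ?aut_factor_neq0// scale1r.
exact: hsubmxK.
Qed.

End KernelDefinition.

(** * Convergence, Hermitian symmetry and holomorphy of the candidate kernel *)

Section KernelBergman.
Context {R : realType}.
Local Notation C := R[i].
Local Notation Co := R[i]^o.

Lemma conj_psum (a : nat -> C) (t : C) : (forall k, conjc (a k) = a k) -> pbounded a 1 -> cabs t < 1 ->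
  conjc (psum a t) = psum a (conjc t).
Proof.
move=> ra ba t1; have t1' : cabs (conjc t) < 1 by rewrite cabs_conj.
have h1 := cvg_comp _ _ (psum_cvg ba t1) (@continuous_conjc R (psum a t)).
have h2 := psum_cvg ba t1'.
apply: (cvg_unique (@norm_hausdorff _ _) _ h2).
rewrite (_ : (fun N => _) = conjc \o (fun N => \sum_(k < N) a k * t ^+ k)); first exact: h1.
apply/funext => M /=; rewrite rmorph_sum; apply: eq_bigr => k _.
by rewrite rmorphM rmorphXn /= ra.
Qed.

(** The weighted inequality of arithmetic and geometric means in each coordinate; the weight is
    tuned in [cabs_kernel_arg]. *)
Lemma cabs_herm_le N (u v : 'rV[C]_N) (x : R) : 0 < x ->
  cabs (herm u v) <= (x * normsq u + x^-1 * normsq v) / 2.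
Proof.
move=> x0; rewrite hermE !normsqE !mulr_sumr -big_split /= mulr_suml.
apply: le_trans (cabs_sum _ _ _) _; apply: ler_sum => j _.
rewrite cabsM cabs_conj; set p := cabs (u 0 j); set q := cabs (v 0 j).
rewrite ler_pdivlMr// -subr_ge0.
have -> : x * p ^+ 2 + x^-1 * q ^+ 2 - p * q * 2 = x^-1 * (x * p - q) ^+ 2.
  by field; rewrite gt_eqF.
by rewrite mulr_ge0 ?sqr_ge0// invr_ge0 ltW.
Qed.

Lemma conj_bcoef n m k : conjc (bcoef n m k : C) = bcoef n m k.
Proof. by rewrite /bcoef rmorphM rmorphXn /= !conjc_nat. Qed.

Variables (n m : nat) (mu : R).
Hypothesis mu0 : 0 < mu.
Hypothesis n0 : (0 < n)%N.
Local Notation N := (n + m.+1)%N.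
Local Notation rV := ('rV[C]_N : normedModType C).
Local Notation inD := (@in_hartogs R n m mu).
Local Notation zext := (@zero_ext R n m mu).
Local Notation D := (fock_bargmann_hartogs n m.+1 mu).
Local Notation l := (@rshift n m.+1 ord_max).
Local Notation el := (delta_mx 0 l : 'rV[C]_N).
Local Notation kernel0 := (@hartogs_kernel R n m mu).

Definition kernel_arg (p w : 'rV[C]_N) : C :=
  cexp (mu%:C * herm (lsubmx p) (lsubmx w)) * herm (rsubmx p) (rsubmx w).

Lemma cabs_kernel_arg p w : inD p -> inD w -> cabs (kernel_arg p w) < 1.
Proof.
rewrite /in_hartogs; set z := lsubmx p; set z' := lsubmx w; set A := normsq (rsubmx p).
set B := normsq (rsubmx w) => hA hB.
(* This weight balances the two points: both x |zeta|^2 and |zeta'|^2 / x are below [e]. On the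
   other side, 2 Re <z, z'> <= |z|^2 + |z'|^2 bounds the exponential by 1 / e. *)
pose x := expR (mu / 2 * (normsq z - normsq z')); have x0 : 0 < x := expR_gt0 _.
pose e := expR (- mu / 2 * (normsq z + normsq z')).
have hz : 2 * complex.Re (herm z z') <= normsq z + normsq z'.
  have := normsq_ge0 (z + (-1) *: z').
  rewrite normsqD normsqZ cabsN cabs1 expr1n mul1r hermZr.
  have -> : conjc (-1 : C) = -1 by apply: complex_ext; rewrite /= ?oppr0.
  by rewrite mulN1r cReN; lra.
rewrite /kernel_arg cabsM cabs_cexp.
have -> : complex.Re (mu%:C * herm z z') = mu * complex.Re (herm z z').
  by rewrite [LHS]cReM /= mul0r subr0.
have h1 : cabs (herm (rsubmx p) (rsubmx w)) < e.
  apply: le_lt_trans (cabs_herm_le _ _ x0) _; rewrite ltr_pdivrMr// mulr2n mulrDr mulr1.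
  apply: ltrD.
    rewrite mulrC -ltr_pdivlMr// /e /x -expRN -expRD; apply: lt_le_trans hA _.
    by rewrite ler_expR; apply: le_of_eq; field.
  rewrite mulrC -ltr_pdivlMr ?invr_gt0// invrK /e /x -expRD; apply: lt_le_trans hB _.
  by rewrite ler_expR; apply: le_of_eq; field.
have h2 : expR (mu * complex.Re (herm z z')) <= e^-1.
  rewrite /e -expRN ler_expR.
  rewrite (_ : - _ = mu / 2 * (normsq z + normsq z')); last by field.
  rewrite -mulrA ler_pM2l//; move: hz; lra.
apply: (@lt_le_trans _ _ (expR (mu * complex.Re (herm z z')) * e)).
  by rewrite ltr_pM2l ?expR_gt0.
by rewrite -ler_pdivlMr ?expR_gt0// mul1r.
Qed.

Lemma kernel0C p w : inD p -> inD w -> kernel0 p w = conjc (kernel0 w p).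
Proof.
move=> Dp Dw; have h := cabs_kernel_arg Dw Dp.
have pb : pbounded (@bcoef R n m.+1) 1 := (has_pseries_bcoef m.+1 n0).1.
have cE : conjc (cexp (mu%:C * herm (lsubmx w) (lsubmx p))) = cexp (mu%:C * herm (lsubmx p) (lsubmx w)).
  by rewrite conj_cexp conjcM conjc_real -hermC.
rewrite /hartogs_kernel !conjcM conjcX cE conjc_real (conj_psum _ pb h); last exact: conj_bcoef.
by rewrite conjcM cE -hermC.
Qed.

Lemma differentiable_linform (c : 'I_N -> C) (w : rV) :
  differentiable (fun w : rV => \sum_(j < N) (w : 'rV[C]_N) 0 j * c j : Co) w.
Proof.
rewrite (_ : (fun w : rV => _) = \sum_(j < N) (fun w : rV => (w : 'rV[C]_N) 0 j * c j : Co)).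
  apply: differentiable_sum => j; apply: differentiableM; last exact: differentiable_cst.
  exact: differentiable_coord.
by apply/funext => v; rewrite fct_sumE.
Qed.

Lemma differentiable_herm_l (a : 'rV[C]_n) (w : rV) :
  differentiable (fun w : rV => herm (lsubmx (w : 'rV[C]_N)) a : Co) w.
Proof.
rewrite (_ : (fun w : rV => _) = (fun w : rV => \sum_(j < N) (w : 'rV[C]_N) 0 j *
    (if fintype.split j is inl i then conjc (a 0 i) else 0) : Co)); first exact: differentiable_linform.
apply/funext => v; rewrite hermE [RHS]big_split_ord /= [X in _ + X]big1 ?addr0.
  by apply: eq_bigr => j _; rewrite mxE (unsplitK (inl j)).
by move=> j _; rewrite (unsplitK (inr j)) mulr0.
Qed.

Lemma differentiable_herm_r (a : 'rV[C]_m.+1) (w : rV) :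
  differentiable (fun w : rV => herm (rsubmx (w : 'rV[C]_N)) a : Co) w.
Proof.
rewrite (_ : (fun w : rV => _) = (fun w : rV => \sum_(j < N) (w : 'rV[C]_N) 0 j *
    (if fintype.split j is inr i then conjc (a 0 i) else 0) : Co)); first exact: differentiable_linform.
apply/funext => v; rewrite hermE [RHS]big_split_ord /= [X in X + _]big1 ?add0r.
  by apply: eq_bigr => j _; rewrite mxE (unsplitK (inr j)).
by move=> j _; rewrite (unsplitK (inl j)) mulr0.
Qed.

Lemma differentiable_kernel0 (p : 'rV[C]_N) (w : rV) : inD p -> inD w ->
  differentiable (fun w : rV => kernel0 w p : Co) w.
Proof.
move=> Dp Dw.
have d1 : differentiable (fun w : rV => cexp (mu%:C * herm (lsubmx (w : 'rV[C]_N)) (lsubmx p)) : Co) w.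
  have d0 : differentiable (fun w : rV => mu%:C * herm (lsubmx (w : 'rV[C]_N)) (lsubmx p) : Co) w.
    by apply: differentiableM; [exact: differentiable_cst|exact: differentiable_herm_l].
  exact: (differentiable_comp d0 (@differentiable_cexp R _)).
have d2 : differentiable (fun w : rV => kernel_arg w p : Co) w.
  by apply: differentiableM; [exact: d1|exact: differentiable_herm_r].
have pb : pbounded (@bcoef R n m.+1) 1 := (has_pseries_bcoef m.+1 n0).1.
have d3 : differentiable (psum (@bcoef R n m.+1) : Co -> Co) (kernel_arg w p : Co).
  exact: (has_pseries_differentiable (has_pseries_psum pb) (cabs_kernel_arg Dw Dp)).
apply: differentiableM; last exact: (differentiable_comp d2 d3).
by apply: differentiableM; [exact: differentiable_cst|exact: differentiable_pow].
Qed.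

End KernelBergman.

(** * Membership in the Bergman space, reproducing property and uniqueness *)

Section KernelReproducing.
Context {R : realType}.
Local Notation C := R[i].
Local Notation Co := R[i]^o.
Variables (n m : nat) (mu : R).
Hypothesis mu0 : 0 < mu.
Hypothesis n0 : (0 < n)%N.
Local Notation N := (n + m.+1)%N.
Local Notation inD := (@in_hartogs R n m mu).
Local Notation zext := (@zero_ext R n m mu).
Local Notation D := (fock_bargmann_hartogs n m.+1 mu).
Local Notation l := (@rshift n m.+1 ord_max).
Local Notation el := (delta_mx 0 l : 'rV[C]_N).
Local Notation kernel0 := (@hartogs_kernel R n m mu).
Local Notation c0 := ((mu ^+ n / pi ^+ N)%:C : C).
Local Notation b := (@bcoef R n m.+1).

Lemma holomorphic_kernel0 p : inD p -> holomorphic D (fun w => kernel0 w p).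
Proof. by move=> Dp w Dw; exact: (differentiable_kernel0 mu0 n0 Dp Dw). Qed.

Section AtPoint.
Variables (p : 'rV[C]_N) (L : 'rV[C]_m.+1 -> 'rV[C]_m.+1) (s : C).
Hypothesis Dp : inD p.
Hypothesis iL : isometry L.
Local Notation aut := (hartogs_aut mu (lsubmx p) L).
Local Notation aut_factor := (hartogs_factor mu (lsubmx p)).
Local Notation aut_jac := (@hartogs_jac R n m mu (lsubmx p)).
Hypothesis ps : aut (s *: el) = p.

Let s1 : cabs s < 1.
Proof. by rewrite -(inD_last n m mu) -(inD_aut mu (lsubmx p) iL) ps. Qed.

Let tr := transfer_aut mu (lsubmx p) iL.

Let k1 : C := (aut_factor 0 ^+ m.+1)^-1.

Let T (w : 'rV[C]_N) : C := c0 * psum b (s * conjc (w 0 l)).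

Let kernelE w : kernel0 p (aut w) = (conjc (aut_factor (lsubmx w)) ^+ m.+1)^-1 * k1 * T w.
Proof. by rewrite -{1}ps hartogs_kernel_aut. Qed.

Let zaut f w : zext f (aut w) = if inD w then f (aut w) else 0.
Proof. by rewrite /zero_ext inD_aut. Qed.

(** The Jacobian absorbs the factor that the transformation rule attaches to w. What remains is
    bounded on the domain, hence square integrable because the volume is finite. *)
Let norm_kernel w : cabs (zext (fun w => kernel0 w p) (aut w)) ^+ 2 * aut_jac w =
  cabs (zext (fun w => k1 * T w) w) ^+ 2.
Proof.
rewrite zaut /zero_ext; case: ifP => Dw; last by rewrite cabs0 expr0n /= mul0r.
rewrite kernel0C// ?inD_aut// cabs_conj kernelE -mulrA [in LHS]cabsM [in LHS]cabsV [in LHS]cabsX.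
rewrite [in LHS]cabs_conj /hartogs_jac -muln2 exprM -exprMn mulrAC.
by rewrite mulVf ?mul1r// expf_neq0// cabs_eq0 aut_factor_neq0.
Qed.

Lemma kernel0_L2 : (LI (fun w => (cabs (zext (fun w => kernel0 w p) w) ^+ 2)%:E) < +oo)%E.
Proof.
have mk := holomorphic_zext (holomorphic_kernel0 Dp).
have mk2 : mfun (fun w => (cabs (zext (fun w => kernel0 w p) w) ^+ 2)%:E).
  by apply/measurable_EFinP; apply: measurable_funX; exact: cmeas_cabs.
have pb : pbounded b 1 := (has_pseries_bcoef m.+1 n0).1.
have [eps [_ heps]] := pseries_uniform pb (introT andP (conj (cabs_ge0 s) s1)).
pose K : R := (cabs k1 * (cabs c0 * eps 0%N)) ^+ 2.
have KI : (K%:E * LI (fun w => (cabs (@one_D R n m mu w) ^+ 2)%:E) < +oo)%E.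
  by apply: lte_mul_pinfty; rewrite ?lee_fin ?sqr_ge0//; exact: (LI_one_sq n m mu0).
apply: le_lt_trans KI.
have mo : mfun (fun w => (cabs (@one_D R n m mu w) ^+ 2)%:E).
  by apply/measurable_EFinP; apply: measurable_funX; apply: cmeas_cabs; exact: (CL1_one n m mu0).1.
rewrite (tr_LI tr mk2); last by move=> v; rewrite lee_fin sqr_ge0.
rewrite [in leRHS]/LI -ge0_integralZl//; [|by move=> t _; rewrite lee_fin sqr_ge0|by rewrite lee_fin sqr_ge0].
apply: ge0_le_integral => //.
- by move=> t _; rewrite mule_ge0 ?lee_fin ?sqr_ge0// exprn_ge0// cabs_ge0.
- apply: emeasurable_funM; first exact: (transfer_mfun tr mk2).
  by apply/measurable_EFinP; exact: measurable_aut_jac.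
- exact: measurable_funeM.
move=> t _; set w := cvec t; rewrite -!EFinM lee_fin norm_kernel /one_D /zero_ext.
case: ifP => Dw; last by rewrite cabs0 expr0n /= mulr0.
rewrite cabs1 expr1n mulr1 /K; apply: lerXn2r; rewrite ?nnegrE ?cabs_ge0//.
  rewrite !mulr_ge0 ?cabs_ge0//; apply: le_trans (heps 0%N 0 _); rewrite ?cabs0 ?cabs_ge0//.
rewrite [in leLHS]cabsM ler_wpM2l ?cabs_ge0// /T [in leLHS]cabsM ler_wpM2l ?cabs_ge0//.
have := heps 0%N (s * conjc (w 0 l)); rewrite big_ord0 subr0; apply.
by rewrite cabsM cabs_conj ler_piMr ?cabs_ge0// ltW//; exact: (cabs_last mu0 Dw).
Qed.

(** After the change of variables the Jacobian splits as factor^(m+1) times its conjugate. The first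
    part goes into the pull-back of f, the second cancels against the kernel, and the formula at s
    e_l applies to the pull-back. *)
Lemma kernel0_reproducing_aux f : bergman_space D f ->
  CL1 (zext (fun w => f w * conjc (kernel0 w p))) /\
  f p = CI (zext (fun w => f w * conjc (kernel0 w p))).
Proof.
move=> bf; have [hf sf] := bf; have mf := holomorphic_zext hf.
have zC h w : zext (fun w => conjc (h w)) w = conjc (zext h w).
  by rewrite /zero_ext; case: ifP; rewrite ?conjc0.
have mk : cmeas (fun t => zext (fun w => conjc (kernel0 w p)) (cvec t)).
  under eq_fun do rewrite zC; apply: cmeas_conj.
  exact: (holomorphic_zext (holomorphic_kernel0 Dp)).
have k2 : (LI (fun w => (cabs (zext (fun w => conjc (kernel0 w p)) w) ^+ 2)%:E) < +oo)%E.
  apply: le_lt_trans kernel0_L2; apply: le_of_eq.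
  by apply: eq_LI => w; rewrite zC cabs_conj.
have i1 : CL1 (zext (fun w => f w * conjc (kernel0 w p))).
  by apply: CL1_mul => //; exact/(square_integrableP mf).
split => //; have [i2 ->] := transfer_CI tr i1.
have ig := CL1_pullback mu0 (lsubmx p) iL bf.
have B := base_reproducing mu0 n0 (pullback_slice (lsubmx p) iL hf) ig s1.
have E w : (aut_jac w)%:C * zext (fun w => f w * conjc (kernel0 w p)) (aut w) =
    k1 * zext (fun w => pullback mu (lsubmx p) L f w * T w) w.
  rewrite zaut /zero_ext; case: ifP => Dw; last by rewrite !mulr0.
  rewrite -kernel0C ?inD_aut// kernelE /pullback.
  have -> : (aut_jac w)%:C = aut_factor (lsubmx w) ^+ m.+1 * conjc (aut_factor (lsubmx w)) ^+ m.+1.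
    by rewrite -exprMn mulcJ /hartogs_jac -mul2n exprM rmorphXn.
  have cn : conjc (aut_factor (lsubmx w)) ^+ m.+1 != 0 by rewrite expf_neq0// conjc_eq0 aut_factor_neq0.
  move: (conjc _ ^+ _) cn (aut_factor _ ^+ _) (f _) (T w) => x x0 y u v.
  by field.
have i3 : CL1 (zext (fun w => pullback mu (lsubmx p) L f w * T w)).
  have k0 : k1 != 0 by rewrite invr_neq0// expf_neq0// aut_factor_neq0.
  by apply: eq_CL1 (CL1_Z k1^-1 i2) => w; rewrite E mulKf.
(* The remaining constant [k1] removes the weight that the pull-back has at s e_l, where the z-part
   is 0. *)
rewrite (eq_CI E) CI_Z// -B /pullback ps lsubmx_last mulrC mulfK// expf_neq0//.
exact: aut_factor_neq0.
Qed.

End AtPoint.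

Lemma kernel0_bergman p : inD p -> bergman_space D (fun w => kernel0 w p).
Proof.
move=> Dp; have [L [s [iL ps]]] := point_aut mu p.
split; first exact: holomorphic_kernel0.
apply/(square_integrableP (holomorphic_zext (holomorphic_kernel0 Dp))).
exact: (kernel0_L2 Dp iL ps).
Qed.

Lemma kernel0_reproducing p f : inD p -> bergman_space D f ->
  f p = cintegral D (fun w => f w * conjc (kernel0 w p)).
Proof.
move=> Dp bf; have [L [s [iL ps]]] := point_aut mu p.
by rewrite cintegral_zext; exact: (kernel0_reproducing_aux Dp iL ps bf).2.
Qed.

Lemma bergman_kernel0 : is_bergman_kernel D (fun p w => conjc (kernel0 w p)).
Proof.
move=> p Dp; split; last by move=> f bf; exact: kernel0_reproducing.
have := kernel0_bergman Dp; congr (bergman_space _ _).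
by apply/funext => w; rewrite [RHS]conjcK.
Qed.

Lemma CL1_bergman f g : bergman_space D f -> bergman_space D g ->
  CL1 (zext (fun w => f w * conjc (g w))).
Proof.
move=> [hf sf] [hg sg]; have mf := holomorphic_zext hf; have mg := holomorphic_zext hg.
have zC w : zext (fun w => conjc (g w)) w = conjc (zext g w).
  by rewrite /zero_ext; case: ifP; rewrite ?conjc0.
apply: CL1_mul => //.
- by under eq_fun do rewrite zC; exact: cmeas_conj.
- exact/(square_integrableP mf).
move/(square_integrableP mg) : sg; apply: le_lt_trans; apply: le_of_eq.
by apply: eq_LI => w; rewrite zC cabs_conj.
Qed.

(* The inner product <K0_q, K_p> is computed with both reproducing properties. *)
Lemma bergman_kernel_unique K p q : is_bergman_kernel D K -> inD p -> inD q ->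
  K p q = kernel0 p q.
Proof.
move=> hK Dp Dq; have [bK rK] := hK p Dp.
have b0 := kernel0_bergman Dq.
have h1 := rK _ b0; have h2 := kernel0_reproducing Dq bK.
have i1 := CL1_bergman bK b0.
move: h2; rewrite cintegral_zext => h2.
move: h1; rewrite cintegral_zext => h1.
have e : conjc (CI (zext (fun w => conjc (K p w) * conjc (kernel0 w q)))) =
    CI (zext (fun w => kernel0 w q * K p w)).
  rewrite [LHS](@conj_cInt _ _ R (lebesgue_cvec N) setT measurableT _ ((CL1_cintble _).1 i1)).
  apply: eq_cInt => t _; rewrite /zero_ext; case: ifP => _; last exact: conjc0.
  by rewrite conjcM !conjcK mulrC.
by rewrite [RHS]h1 -e -[X in conjc X]h2 conjcK.
Qed.

End KernelReproducing.

Theorem theorem2 (R : realType) (n m : nat) (mu : R) :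
  (0 < n)%N -> (0 < m)%N -> 0 < mu ->
  (exists K, is_bergman_kernel (fock_bargmann_hartogs n m mu) K) /\
  forall K, is_bergman_kernel (fock_bargmann_hartogs n m mu) K ->
  forall (z z' : 'rV[R[i]]_n) (zeta zeta' : 'rV[R[i]]_m),
    fock_bargmann_hartogs n m mu (row_mx z zeta) ->
    fock_bargmann_hartogs n m mu (row_mx z' zeta') ->
    K (row_mx z zeta) (row_mx z' zeta') =
      (mu ^+ n / pi ^+ (n + m))%:C * cexp (m%:R * mu%:C * herm z z') *
      derive1n m (polylog (- n%:R) : R[i] -> R[i]^o)
        (cexp (mu%:C * herm z z') * herm zeta zeta') /\
    K (row_mx z zeta) (row_mx z' zeta') =
      (mu ^+ n / pi ^+ (n + m))%:C *
      derive1n m.-1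
        (quot_by_id (fun t => polylog (- n.+1%:R) (cexp (mu%:C * herm z z') * t))
          : R[i] -> R[i]^o)
        (herm zeta zeta').
Proof.
move=> n0; case: m => [//|m] m0 mu0; split.
  by eexists; exact: (bergman_kernel0 mu0 n0).
move=> K hK z z' zeta zeta' Dp Dq.
rewrite (bergman_kernel_unique mu0 n0 hK Dp Dq).
have arg1 := cabs_kernel_arg mu0 Dp Dq.
have cE : cexp (m.+1%:R * mu%:C * herm z z') = cexp (mu%:C * herm z z') ^+ m.+1.
  by rewrite -mulrA cexp_natM.
rewrite /kernel_arg !row_mxKl !row_mxKr in arg1.
rewrite /hartogs_kernel !row_mxKl !row_mxKr cE; split.
  by rewrite -(has_pseriesE (has_pseries_bcoef m.+1 n0) arg1).
by rewrite (polylog_quotE m0 (cexp_neq0 _) n0 arg1) mulrA.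
Qed.
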